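(* Let $\alpha>0$, let $s>\frac12$, and let $u$ be the solution of $i\partial_tu=\Pi(|u|^2u)+\alpha(u|1)$ with initial data $u_0\in H^s_+(\mathbb S^1)$. Let $\sigma_k>0$ be a singular value of $K_u$. If there exists a crossing at $\sigma_k$ at time $t=t_0$, then $\ell_k<0$.
   Context: $L^2_+=L^2_+(\mathbb S^1)$ is the Hardy space of $L^2$ functions with only nonnegative frequencies, $H^s_+=H^s(\mathbb S^1)\cap L^2_+$; $\Pi:L^2(\mathbb S^1)\to L^2_+$ is the orthogonal projector; $(u|v)=\int_{\mathbb S^1}u\bar v\,\frac{d\theta}{2\pi}$ and $\|\cdot\|$ is the $L^2$ norm. $H_u(h)=\Pi(u\bar h)$ is an antilinear operator on $L^2_+$, $S$ is the shift $Sh=zh$, and $K_u:=S^*H_u$. The eigenvalues of $K_{u(t)}^2$, with multiplicities, do not depend on $t$; singular values of $K_u$ are the square roots of these eigenvalues. For $\tau\ge0$, $E_u(\tau)=\ker(H_u^2-\tau^2I)$, $F_u(\tau)=\ker(K_u^2-\tau^2I)$, and $\Sigma_H(u)=\{\tau>0: u\not\perp E_u(\tau)\}$ is the set of dominant eigenvalues of $H_u$. A crossing at $\sigma$ at time $t_0$ means: $\sigma\in\Sigma_H(u(t_0))$ and $\dim E_{u(t_0)}(\sigma)\ge2$. $\ell_k:=\|u_k'\|^2-\alpha\|v_k'\|^2$, where $u_k',v_k'$ are the orthogonal projections of $u$ and of the constant function $1$ onto $F_u(\sigma_k)$; $\ell_k$ does not depend on $t$. *)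

(* Defs.v *)
From HB Require Import structures.
From mathcomp Require Import all_boot all_order all_algebra.
From mathcomp Require Import complex.
From mathcomp Require Import all_classical all_reals all_analysis.

Set Implicit Arguments.
Unset Strict Implicit.
Unset Printing Implicit Defensive.

Import Order.TTheory GRing.Theory Num.Theory.
Import numFieldNormedType.Exports.

Local Open Scope classical_set_scope.
Local Open Scope complex_scope.
Local Open Scope ring_scope.

(* A function on the circle is given by its values at the angles
   theta in [0, 2 pi]; values outside that interval play no role.  Elements of
   L^2 are represented by Borel functions, and equality in L^2 is [eqae]. *)

Section Circle.
Variable R : realType.
Implicit Types (f g h u : R -> R[i]) (V : set (R -> R[i])).

Definition circle : set R := `[0, 2 * pi]%classic.

Definition eqae f g : Prop := ae_eq (@lebesgue_measure R) circle f g.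

Definition re_part f : R -> R := fun x => complex.Re (f x).
Definition im_part f : R -> R := fun x => complex.Im (f x).
Definition sq_modulus f : R -> R :=
  fun x => ComplexField.Normc.normc (f x) ^+ 2.

(* Integral of a complex function against d theta / 2 pi. *)
Definition cint f : R[i] :=
  ((2 * pi)^-1 * \int[@lebesgue_measure R]_(x in circle) re_part f x) +i*
  ((2 * pi)^-1 * \int[@lebesgue_measure R]_(x in circle) im_part f x).

Definition inner f g : R[i] := cint (fun x => f x * ((g x)^*)%C).

Definition L2 : set (R -> R[i]) := [set f |
  [/\ measurable_fun circle (re_part f),
      measurable_fun circle (im_part f) &
      (@lebesgue_measure R).-integrable circle (EFin \o sq_modulus f)]].

Definition L2norm f : R :=
  Num.sqrt ((2 * pi)^-1 *
    \int[@lebesgue_measure R]_(x in circle) sq_modulus f x).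

Definition expi (n : int) : R -> R[i] :=
  fun x => cos (n%:~R * x) +i* sin (n%:~R * x).

Definition fourier f (n : int) : R[i] := inner f (expi n).

Definition Hardy : set (R -> R[i]) :=
  [set f | L2 f /\ forall n : int, n < 0 -> fourier f n = 0].

Definition Hs_sqnorm (s : R) f : \bar R :=
  \esum_(n in [set: int])
    ((1 + n%:~R ^+ 2) `^ s
       * ComplexField.Normc.normc (fourier f n) ^+ 2)%:E.

Definition Hs_norm (s : R) f : R := Num.sqrt (fine (Hs_sqnorm s f)).

Definition Hs_plus (s : R) : set (R -> R[i]) :=
  [set f | Hardy f /\ (Hs_sqnorm s f < +oo)%E].

(* A representative of the orthogonal projection of f onto V, unique up to
   [eqae] when V is a subspace of L^2; the default value 0 is only taken when
   there is no such projection. *)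
Definition oproj V f : R -> R[i] :=
  xget (fun=> 0)
    [set g | V g /\ forall h, V h -> inner (fun x => f x - g x) h = 0].

Definition szego_proj f : R -> R[i] := oproj Hardy f.

Definition hankel u h : R -> R[i] := szego_proj (fun x => u x * ((h x)^*)%C).

Definition shift h : R -> R[i] := fun x => expi 1 x * h x.

(* Adjoint of [shift] as an operator on the Hardy space. *)
Definition shift_adj h : R -> R[i] :=
  xget (fun=> 0)
    [set g | Hardy g /\ forall f, Hardy f -> inner g f = inner h (shift f)].

Definition shifted_hankel u h : R -> R[i] := shift_adj (hankel u h).

Definition eigH u (tau : R) : set (R -> R[i]) :=
  [set h | Hardy h /\
    eqae (hankel u (hankel u h)) (fun x => (tau ^+ 2)%:C * h x)].

Definition eigK u (tau : R) : set (R -> R[i]) :=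
  [set h | Hardy h /\
    eqae (shifted_hankel u (shifted_hankel u h))
         (fun x => (tau ^+ 2)%:C * h x)].

Definition singular_value_K u (tau : R) : Prop :=
  0 <= tau /\ exists h, eigK u tau h /\ ~ eqae h (fun=> 0).

Definition SigmaH u : set R :=
  [set tau | 0 < tau /\ exists h, eigH u tau h /\ inner u h <> 0].

(* Dimension in L^2, i.e. with functions taken up to [eqae]. *)
Definition dim_ge (n : nat) V : Prop :=
  exists e : 'I_n -> (R -> R[i]),
    (forall j, V (e j)) /\
    (forall c : 'I_n -> R[i],
       eqae (fun x => \sum_(j < n) c j * e j x) (fun=> 0) ->
       forall j, c j = 0).

Definition crossing (u : R -> R -> R[i]) (sigma t0 : R) : Prop :=
  SigmaH (u t0) sigma /\ dim_ge 2 (eigH (u t0) sigma).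

Definition ell (alpha : R) u (sigma : R) : R :=
  L2norm (oproj (eigK u sigma) u) ^+ 2
  - alpha * L2norm (oproj (eigK u sigma) (fun=> 1)) ^+ 2.

Definition szego_rhs (alpha : R) u : R -> R[i] :=
  fun x => szego_proj (fun y => (sq_modulus u y)%:C * u y) x
           + alpha%:C * inner u (fun=> 1).

(* u is in C(R; H^s_+), and the time derivative exists in L^2. *)
Definition szego_solution (s alpha : R) (u0 : R -> R[i])
    (u : R -> R -> R[i]) : Prop :=
  [/\ forall t, Hs_plus s (u t),
      forall t0, Hs_norm s (fun x => u t x - u t0 x) @[t --> t0] --> (0 : R),
      eqae (u 0) u0 &
      forall t,
        L2norm (fun x => 'i%C * ((h^-1)%:C * (u (t + h) x - u t x))
                         - szego_rhs alpha (u t) x) @[h --> 0^'] --> (0 : R)].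

End Circle.

(* Main.v *)
Require Import Defs.
From HB Require Import structures.
From mathcomp Require Import all_boot all_order all_algebra.
From mathcomp Require Import complex.
From mathcomp Require Import all_classical all_reals all_analysis.
From mathcomp Require Import measurable_realfun.
From mathcomp Require Import ring lra.

Set Implicit Arguments.
Unset Strict Implicit.
Unset Printing Implicit Defensive.

Import Order.TTheory GRing.Theory Num.Theory.
Import numFieldNormedType.Exports.

Local Open Scope classical_set_scope.
Local Open Scope complex_scope.
Local Open Scope ring_scope.

(** The quantity [ell] is constant in time, and at the time of the crossing it
    reduces to minus [alpha] times a squared norm that cannot vanish.

    Conservation. Write [T u] for the Toeplitz operator of symbol [|u|^2] and
    [gen u = - i T u + (i / 2) K u K u], which is skew-adjoint. The identity
    [K (T u u) = T u (K u) + K u (T u) - K u (K u (K u))] of [lax_identity],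
    together with the vanishing of [K] for the constant symbol 1, which makes
    the perturbation [alpha (u | 1)] invisible to [K u], says that along the flow
    the derivative of [K u] is the commutator of [gen u] with [K u]. Hence [K u] commutes with the covariant
    derivative [x' - gen u x]. The covariant derivatives of [u] and of the
    constant [1] are explicit combinations of [1], [u], [K u (K u u)] and
    [K u (K u 1)], and they cancel in the derivative of the moments
    [(K^(2n) u | u) - alpha (K^(2n) 1 | 1)]; this is [moment_constant]. The
    projection on an eigenspace of the bounded self-adjoint operator [K u K u]
    is a limit of polynomials in that operator ([spectral_projection]), with
    coefficients that can be chosen independent of time; therefore [ell], as a
    limit of combinations of moments, is conserved ([ell_conserved]).

    Crossing. The identity [K u (K u x) = H u (H u x) - (x | u) u] of [K2_H2]
    shows that if [u] is not orthogonal to the eigenspace [E] of [H u H u], then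
    the corresponding eigenspace [F] of [K u K u] is the set of the elements of
    [E] orthogonal to [u] ([eigenK_eigenH]). It is nonzero because [E] has
    dimension at least 2, and the projection of [u] on it is zero, so that
    [ell] is minus [alpha] times the squared norm of the projection of [1].
    If [F] were also orthogonal to [1], then [H u] would map [F] to itself, and
    so would the backward shift, since [K u] is the backward shift after
    [H u]; every Fourier coefficient of an element of [F] would be the scalar
    product with [1] of an element of [F], hence zero ([eigenK_one]).

    Analytic foundations. Completeness of the space of square-integrable
    functions and uniqueness of Fourier coefficients provide the Hardy space
    with its projector and its orthonormal basis. For [s > 1 / 2], elements of
    the Sobolev space have summable Fourier coefficients ([Hs_wiener]); this
    class of bounded functions is stable under [K u] ([wienerK]), and there
    [K] can be differentiated in time by the product rule ([deriv_K]). *)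

(** * Integrals over the circle *)

Section RealIntegrals.
Variable R : realType.
Local Notation mu := (@lebesgue_measure R).
Local Notation D := (@circle R).
Implicit Types f g : R -> R.

Definition integr f : Prop := mu.-integrable D (EFin \o f).

Lemma measurable_circle : measurable (D : set (measurableTypeR R)).
Proof. exact: measurable_itv. Qed.
Hint Resolve measurable_circle : core.

Lemma twopi_gt0 : 0 < 2 * pi :> R.
Proof. by rewrite mulr_gt0// pi_gt0. Qed.

Lemma circle_measure : mu D = (2 * pi)%:E.
Proof.
rewrite /circle lebesgue_measure_itv/= lte_fin twopi_gt0.
by rewrite oppr0 adde0.
Qed.

Lemma integrD f g : integr f -> integr g -> integr (fun x => f x + g x).
Proof. by move=> fi gi; exact: (integrableD measurable_circle fi gi). Qed.

Lemma integrZ (c : R) f : integr f -> integr (fun x => c * f x).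
Proof. by move=> fi; apply: (integrableZl measurable_circle c fi). Qed.

Lemma integr_le f g : measurable_fun D f ->
  (forall x, `|f x| <= g x) -> integr g -> integr f.
Proof.
move=> mf fg gi; apply: (@le_integrable _ _ _ mu D measurable_circle _ (EFin \o g)) => //.
  exact/measurable_EFinP.
move=> x _ /=; rewrite lee_fin; apply: le_trans (fg x) _; exact: ler_norm.
Qed.

Lemma integr_cst c : integr (fun=> c).
Proof.
apply: measurable_bounded_integrable => //.
- by have := ltry (2 * pi : R); rewrite -circle_measure.
- exact: (@bounded_cst _ R).
Qed.

End RealIntegrals.
#[global] Hint Resolve measurable_circle : core.

Section ComplexIntegrals.
Variable R : realType.
Local Notation mu := (@lebesgue_measure R).
Local Notation D := (@circle R).
Implicit Types f g h : R -> R[i].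

Definition cintegr f : Prop := integr (re_part f) /\ integr (im_part f).

Lemma cintD f g : cintegr f -> cintegr g ->
  cint (fun x => f x + g x) = cint f + cint g.
Proof.
move=> [f1 f2] [g1 g2]; rewrite /cint.
rewrite (_ : re_part _ = fun x => re_part f x + re_part g x); last first.
  by apply/funext => x; rewrite /re_part; case: (f x) (g x) => ? ? [].
rewrite (_ : im_part (fun x => _) = fun x => im_part f x + im_part g x); last first.
  by apply/funext => x; rewrite /im_part; case: (f x) (g x) => ? ? [].
by rewrite !RintegralD// !mulrDr.
Qed.

Lemma cintZ (c : R[i]) f : cintegr f -> cint (fun x => c * f x) = c * cint f.
Proof.
case: c => a b [f1 f2]; rewrite /cint.
rewrite (_ : re_part _ = fun x => a * re_part f x - b * im_part f x); last first.
  by apply/funext => x; rewrite /re_part /im_part; case: (f x).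
rewrite (_ : im_part (fun x => _ * _) = fun x => a * im_part f x + b * re_part f x); last first.
  by apply/funext => x; rewrite /im_part /re_part; case: (f x).
rewrite RintegralB ?RintegralD//; try exact: integrZ.
rewrite !RintegralZl//.
by apply/eqP; rewrite eq_complex/=; apply/andP; split; apply/eqP; ring.
Qed.

Lemma cint_conj f : cintegr f -> cint (fun x => (f x)^*%C) = (cint f)^*%C.
Proof.
move=> [f1 f2]; rewrite /cint.
rewrite (_ : re_part (fun x => _) = re_part f); last first.
  by apply/funext => x; rewrite /re_part; case: (f x).
rewrite (_ : im_part (fun x => _) = fun x => -1 * im_part f x); last first.
  by apply/funext => x; rewrite /im_part mulN1r; case: (f x).
rewrite RintegralZl//.
by apply/eqP; rewrite eq_complex/=; apply/andP; split; apply/eqP; ring.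
Qed.

(** * Square-integrable functions *)

Lemma sq_modulusE f x : sq_modulus f x = re_part f x ^+ 2 + im_part f x ^+ 2.
Proof.
rewrite /sq_modulus /re_part /im_part; case: (f x) => a b /=.
by rewrite sqr_sqrtr// addr_ge0// sqr_ge0.
Qed.

Lemma sq_modulus_ge0 f x : 0 <= sq_modulus f x.
Proof. exact: sqr_ge0. Qed.

Lemma meas_sq_modulus f : measurable_fun D (re_part f) ->
  measurable_fun D (im_part f) -> measurable_fun D (sq_modulus f).
Proof.
move=> mr mi; rewrite (_ : sq_modulus f = fun x => re_part f x ^+ 2 + im_part f x ^+ 2).
  by apply: measurable_funD; apply: measurable_funX.
by apply/funext => x; rewrite sq_modulusE.
Qed.

Lemma L2_integr f : L2 f -> integr (sq_modulus f).
Proof. by case. Qed.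

Lemma L2_cintegr f : L2 f -> cintegr f.
Proof.
move=> [mr mi i2].
have i3 : integr (fun x => 1 + sq_modulus f x) by apply: integrD => //; apply: integr_cst.
split; apply: integr_le i3 => // x; rewrite sq_modulusE;
 rewrite ler_norml; apply/andP; split; nra.
Qed.

Lemma L2_mul f g : L2 f -> L2 g -> cintegr (fun x => f x * g x).
Proof.
move=> [mr mi i2] [mr' mi' i2'].
have i3 : integr (fun x => sq_modulus f x + sq_modulus g x) by exact: integrD.
have bnd (a b c d : R) : `|a * c - b * d| <= a ^+ 2 + b ^+ 2 + (c ^+ 2 + d ^+ 2).
  have := sqr_ge0 (a - c); have := sqr_ge0 (a + c).
  have := sqr_ge0 (b - d); have := sqr_ge0 (b + d).
  have := sqr_ge0 a; have := sqr_ge0 b; have := sqr_ge0 c; have := sqr_ge0 d.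
  rewrite ler_norml => *; apply/andP; split; nra.
split; apply: integr_le i3.
- rewrite (_ : re_part _ = fun x => re_part f x * re_part g x - im_part f x * im_part g x).
    by apply: measurable_funB; apply: measurable_funM.
  by apply/funext => x; rewrite /re_part /im_part; case: (f x) (g x) => ? ? [].
- move=> x; rewrite !sq_modulusE /re_part /im_part; case: (f x) (g x) => a b [c d] /=.
  exact: bnd.
- rewrite (_ : im_part _ = fun x => re_part f x * im_part g x + im_part f x * re_part g x).
    by apply: measurable_funD; apply: measurable_funM.
  by apply/funext => x; rewrite /re_part /im_part; case: (f x) (g x) => ? ? [].
- move=> x; rewrite !sq_modulusE /re_part /im_part; case: (f x) (g x) => a b [c d] /=.
  by have := bnd a (- b) d c; rewrite mulNr opprK sqrrN [c ^+ 2 + _]addrC.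
Qed.

Lemma L2D f g : L2 f -> L2 g -> L2 (fun x => f x + g x).
Proof.
move=> [mr mi i2] [mr' mi' i2'].
have E1 : re_part (fun x => f x + g x) = fun x => re_part f x + re_part g x.
  by apply/funext => x; rewrite /re_part; case: (f x) (g x) => ? ? [].
have E2 : im_part (fun x => f x + g x) = fun x => im_part f x + im_part g x.
  by apply/funext => x; rewrite /im_part; case: (f x) (g x) => ? ? [].
have M1 : measurable_fun D (re_part (fun x => f x + g x)).
  by rewrite E1; exact: measurable_funD.
have M2 : measurable_fun D (im_part (fun x => f x + g x)).
  by rewrite E2; exact: measurable_funD.
split=> //.
have i3 : integr (fun x => 2 * (sq_modulus f x + sq_modulus g x)).
  by apply: integrZ; exact: integrD.
apply: integr_le i3; first exact: meas_sq_modulus.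
move=> x; rewrite ger0_norm ?sq_modulus_ge0// !sq_modulusE E1 E2.
have := sqr_ge0 (re_part f x - re_part g x).
have := sqr_ge0 (im_part f x - im_part g x).
nra.
Qed.

Lemma L2_conj f : L2 f -> L2 (fun x => (f x)^*%C).
Proof.
move=> [mr mi i2].
have E1 : re_part (fun x => (f x)^*%C) = re_part f.
  by apply/funext => x; rewrite /re_part; case: (f x).
have E2 : im_part (fun x => (f x)^*%C) = fun x => - im_part f x.
  by apply/funext => x; rewrite /im_part; case: (f x).
split; rewrite ?E1 ?E2//; first exact: measurableT_comp.
move: i2; congr integr; apply/funext => x.
by rewrite !sq_modulusE E1 E2 sqrrN.
Qed.

(** The bound is only required almost everywhere, so that it passes from a
    function to any other representative of its class. *)
Definition bounded_by (C : R) f : Prop :=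
  L2 f /\ {ae mu, forall x, D x -> sq_modulus f x <= C ^+ 2}.

Lemma sq_modulusM f g x :
  sq_modulus (fun x => f x * g x) x = sq_modulus f x * sq_modulus g x.
Proof. by rewrite /sq_modulus ComplexField.Normc.normcM exprMn. Qed.

Lemma L2M C f g : bounded_by C f -> L2 g -> L2 (fun x => f x * g x).
Proof.
move=> [[mr mi i2] fC] [mr' mi' i2'].
have M1 : measurable_fun D (re_part (fun x => f x * g x)).
  rewrite (_ : re_part _ = fun x => re_part f x * re_part g x - im_part f x * im_part g x).
    by apply: measurable_funB; apply: measurable_funM.
  by apply/funext => x; rewrite /re_part /im_part; case: (f x) (g x) => ? ? [].
have M2 : measurable_fun D (im_part (fun x => f x * g x)).
  rewrite (_ : im_part _ = fun x => re_part f x * im_part g x + im_part f x * re_part g x).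
    by apply: measurable_funD; apply: measurable_funM.
  by apply/funext => x; rewrite /re_part /im_part; case: (f x) (g x) => ? ? [].
split=> //.
have M3 := meas_sq_modulus M1 M2.
apply/integrableP; split; first exact/measurable_EFinP.
have i3 : integr (fun x => C ^+ 2 * sq_modulus g x) by exact: integrZ.
move/integrableP: i3 => [m3]; apply: le_lt_trans.
apply: ae_ge0_le_integral => //.
- by apply: measurableT_comp => //; exact/measurable_EFinP.
- by apply: measurableT_comp.
case: fC => N [mN N0 sub]; exists N; split => // x nx; apply: sub => /= fx; apply: nx.
move=> /fx{}fx.
rewrite !lee_fin !ger0_norm ?sq_modulus_ge0//; last first.
  by rewrite mulr_ge0 ?sqr_ge0 ?sq_modulus_ge0.
by rewrite sq_modulusM ler_wpM2r// sq_modulus_ge0.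
Qed.

End ComplexIntegrals.

(** * Spaces with a semi-definite Hermitian form *)

Section Dot.
Variables (R : realType) (V : lmodType R[i]) (dot : V -> V -> R[i]).
Local Notation Re := complex.Re.
Local Notation normc := ComplexField.Normc.normc.

Record is_dot : Prop := IsDot {
  dotDl : forall x y z, dot (x + y) z = dot x z + dot y z;
  dotZl : forall c x z, dot (c *: x) z = c * dot x z;
  dotC : forall x y, dot y x = (dot x y)^*%C;
  dot_ge0 : forall x, 0 <= Re (dot x x) }.

Hypothesis D : is_dot.

Lemma dotDr x y z : dot z (x + y) = dot z x + dot z y.
Proof. by rewrite (dotC D) dotDl// rmorphD/= -!(dotC D). Qed.
Lemma dotZr c x z : dot z (c *: x) = c^*%C * dot z x.
Proof. by rewrite (dotC D) dotZl// rmorphM/= -(dotC D). Qed.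
Lemma dot0l x : dot 0 x = 0.
Proof. by rewrite -(scale0r 0) dotZl// mul0r. Qed.
Lemma dot0r x : dot x 0 = 0.
Proof. by rewrite (dotC D) dot0l rmorph0. Qed.
Lemma dotNl x y : dot (- x) y = - dot x y.
Proof. by rewrite -scaleN1r dotZl// mulN1r. Qed.
Lemma dotNr x y : dot x (- y) = - dot x y.
Proof. by rewrite (dotC D) dotNl rmorphN/= -(dotC D). Qed.
Lemma dotBl x y z : dot (x - y) z = dot x z - dot y z.
Proof. by rewrite dotDl// dotNl. Qed.
Lemma dotBr x y z : dot z (x - y) = dot z x - dot z y.
Proof. by rewrite dotDr dotNr. Qed.
Lemma dot_suml I (r : seq I) (P : pred I) F z :
  dot (\sum_(i <- r | P i) F i) z = \sum_(i <- r | P i) dot (F i) z.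
Proof. by apply: (big_morph (dot ^~ z)) => [x y|]; rewrite ?dotDl// dot0l. Qed.
Lemma dot_sumr I (r : seq I) (P : pred I) F z :
  dot z (\sum_(i <- r | P i) F i) = \sum_(i <- r | P i) dot z (F i).
Proof. by apply: (big_morph (dot z)) => [x y|]; rewrite ?dotDr// dot0r. Qed.

Definition nsq x : R := Re (dot x x).

Lemma nsq_ge0 x : 0 <= nsq x. Proof. exact: dot_ge0. Qed.

Lemma dotxx x : dot x x = (nsq x)%:C.
Proof.
have := dotC D x x; rewrite /nsq; case: (dot x x) => a b [] /eqP.
by rewrite -addr_eq0 -mulr2n mulrn_eq0/= => /eqP ->.
Qed.

Lemma nsq0 : nsq 0 = 0. Proof. by rewrite /nsq dot0l. Qed.

Lemma nsqN x : nsq (- x) = nsq x.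
Proof. by rewrite /nsq dotNl dotNr opprK. Qed.

Lemma nsqD x y : nsq (x + y) = nsq x + nsq y + 2 * Re (dot x y).
Proof.
rewrite /nsq !(dotDr, dotDl D) (dotC D x y).
by case: (dot x x) (dot y y) (dot x y) => a b [c d] [e f] /=; ring.
Qed.

Lemma nsqB x y : nsq (x - y) = nsq x + nsq y - 2 * Re (dot x y).
Proof. by rewrite nsqD nsqN dotNr; case: (dot x y) => a b /=; ring. Qed.

Lemma nsqD_le x y : nsq (x + y) <= 2 * nsq x + 2 * nsq y.
Proof. by have := nsq_ge0 (x - y); rewrite nsqB nsqD; lra. Qed.

Lemma nsqBC x y : nsq (x - y) = nsq (y - x).
Proof. by rewrite -nsqN opprB. Qed.

Lemma normc_sq (z : R[i]) : normc z ^+ 2 = Re z ^+ 2 + complex.Im z ^+ 2.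
Proof. by case: z => a b /=; rewrite sqr_sqrtr// addr_ge0// sqr_ge0. Qed.

Lemma normc_ge0 (z : R[i]) : 0 <= normc z.
Proof. by case: z => a b; exact: sqrtr_ge0. Qed.

Lemma mul_conj (z : R[i]) : z * z^*%C = (normc z ^+ 2)%:C.
Proof.
rewrite normc_sq; case: z => a b; apply/eqP; rewrite eq_complex/=.
by apply/andP; split; apply/eqP; ring.
Qed.

Lemma nsqZ c x : nsq (c *: x) = normc c ^+ 2 * nsq x.
Proof.
by rewrite /nsq (dotZl D) dotZr mulrA mul_conj dotxx/= mulr0 subr0.
Qed.

Lemma cauchy_schwarz x y : normc (dot x y) ^+ 2 <= nsq x * nsq y.
Proof.
set b := dot x y; set a := nsq y.
have key (s t : R) : 0 <= s ^+ 2 * nsq x + t ^+ 2 * (normc b ^+ 2 * a)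
    - 2 * (s * t * normc b ^+ 2).
  have := nsq_ge0 (s%:C *: x - (t%:C * b) *: y).
  have n1 (r : R) : normc r%:C ^+ 2 = r ^+ 2 by rewrite normc_sq/= expr0n addr0.
  rewrite nsqB !nsqZ (dotZl D) dotZr -/b -/a n1 ComplexField.Normc.normcM exprMn n1.
  rewrite (_ : Re _ = s * t * normc b ^+ 2); first by rewrite !mulrA.
  by rewrite normc_sq; case: b => p q /=; ring.
have a0 : 0 <= a := nsq_ge0 y.
have b0 := sqr_ge0 (normc b).
move: a0; rewrite le_eqVlt => /predU1P[a0|a0].
  rewrite -a0 mulr0 leNgt; apply/negP => bp.
  have := key 1 ((nsq x + 1) / normc b ^+ 2).
  rewrite -a0 !(mulr0, addr0, mul1r, expr1n) divfK ?gt_eqF//.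
  have := nsq_ge0 x; lra.
have := key a 1; rewrite expr1n mul1r mulr1 => h.
have : 0 <= a * (nsq x * a - normc b ^+ 2) by move: h; nra.
by rewrite pmulr_rge0// subr_ge0.
Qed.

Definition nrm x : R := Num.sqrt (nsq x).

Lemma nrm_ge0 x : 0 <= nrm x. Proof. exact: sqrtr_ge0. Qed.
Lemma nrm_sq x : nrm x ^+ 2 = nsq x.
Proof. by rewrite sqr_sqrtr// nsq_ge0. Qed.
Lemma nrm0 : nrm 0 = 0. Proof. by rewrite /nrm nsq0 sqrtr0. Qed.
Lemma nrmN x : nrm (- x) = nrm x. Proof. by rewrite /nrm nsqN. Qed.
Lemma nrmZ c x : nrm (c *: x) = normc c * nrm x.
Proof.
by rewrite /nrm nsqZ sqrtrM ?sqr_ge0// sqrtr_sqr ger0_norm// normc_ge0.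
Qed.

Lemma dot_le x y : normc (dot x y) <= nrm x * nrm y.
Proof.
rewrite -(@ler_pXn2r _ 2) ?nnegrE ?mulr_ge0 ?normc_ge0 ?nrm_ge0//.
by rewrite exprMn !nrm_sq cauchy_schwarz.
Qed.

Lemma Re_le_normc (z : R[i]) : `|Re z| <= normc z.
Proof.
by case: z => a b /=; rewrite -sqrtr_sqr ler_wsqrtr// lerDl sqr_ge0.
Qed.

Lemma nrmD x y : nrm (x + y) <= nrm x + nrm y.
Proof.
rewrite -(@ler_pXn2r _ 2) ?nnegrE ?addr_ge0 ?nrm_ge0//.
rewrite nrm_sq nsqD sqrrD !nrm_sq.
have := le_trans (Re_le_normc _) (dot_le x y); rewrite ler_norml => /andP[_].
lra.
Qed.

Lemma nrmB x y : nrm (x - y) <= nrm x + nrm y.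
Proof. by rewrite -(nrmN y) nrmD. Qed.

Lemma nrm_le x c : 0 <= c -> nsq x <= c ^+ 2 -> nrm x <= c.
Proof.
by move=> c0 h; rewrite -(@ler_pXn2r _ 2) ?nnegrE ?nrm_ge0// nrm_sq.
Qed.

(** * Orthonormal families *)

Variable e : nat -> V.
Hypothesis orthonormal : forall m n, dot (e m) (e n) = (m == n)%:R.

Definition partial x N : V := \sum_(n < N) dot x (e n) *: e n.

Lemma dot_partial x N m : dot (partial x N) (e m) = dot x (e m) *+ (m < N)%N.
Proof.
rewrite /partial dot_suml.
under eq_bigr => n _ do rewrite (dotZl D) orthonormal.
case: ltnP => mN.
  rewrite (bigD1 (Ordinal mN))//= eqxx mulr1 big1 ?addr0// => n /negbTE nm.
  by rewrite -val_eqE/= in nm; rewrite nm mulr0.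
by rewrite big1// => n _; rewrite ltn_eqF ?mulr0// (leq_trans _ mN).
Qed.

Lemma dot_partial_partial x y M N : (M <= N)%N ->
  dot (partial x M) (partial y N) = dot (partial x M) (partial y M).
Proof.
move=> MN.
have key K : dot (partial x M) (partial y K) =
    \sum_(n < K) (dot y (e n))^*%C * (dot x (e n) *+ (n < M)%N).
  rewrite {2}/partial dot_sumr; apply: eq_bigr => n _.
  by rewrite dotZr dot_partial.
rewrite !key -(subnKC MN) big_split_ord/= [X in _ + X]big1 ?addr0// => i _.
by rewrite ltnNge leq_addr mulr0n mulr0.
Qed.

Lemma nsq_partial x N :
  nsq (partial x N) = \sum_(n < N) normc (dot x (e n)) ^+ 2.
Proof.
rewrite /nsq {2}/partial dot_sumr.
rewrite (_ : \sum_(i < N) _ = (\sum_(n < N) normc (dot x (e n)) ^+ 2)%:C)//.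
rewrite rmorph_sum/=; apply: eq_bigr => n _.
by rewrite dotZr dot_partial ltn_ord mulr1n mulrC mul_conj.
Qed.

Lemma dot_partialr x N : dot x (partial x N) = (nsq (partial x N))%:C.
Proof.
rewrite nsq_partial /partial dot_sumr rmorph_sum; apply: eq_bigr => n _ /=.
by rewrite dotZr mulrC mul_conj.
Qed.

Lemma nsq_sub_partial x N : nsq (x - partial x N) = nsq x - nsq (partial x N).
Proof. by rewrite nsqB dot_partialr /=; ring. Qed.

Lemma bessel x N : \sum_(n < N) normc (dot x (e n)) ^+ 2 <= nsq x.
Proof. by rewrite -nsq_partial -subr_ge0 -nsq_sub_partial nsq_ge0. Qed.

Lemma nsq_partialB x M N : (M <= N)%N ->
  nsq (partial x N - partial x M) = nsq (partial x N) - nsq (partial x M).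
Proof.
move=> MN; rewrite nsqBC nsqB dot_partial_partial// dotxx /=.
by ring.
Qed.

Definition cauchy_seq_dot (x : nat -> V) := forall eps : R, 0 < eps ->
  exists N, forall m n, (N <= m)%N -> (N <= n)%N -> nsq (x m - x n) <= eps.

(** The partial sums of a Fourier series and the iterates that approximate a
    spectral projection both converge by this criterion, their squared norms
    being monotone. *)
Lemma cauchy_of_monotone (x : nat -> V) (a : nat -> R) (B : R) :
  (forall m n, (m <= n)%N -> nsq (x n - x m) <= a n - a m) ->
  (forall n, a n <= B) -> cauchy_seq_dot x.
Proof.
move=> xa aB eps e0.
have nd : nondecreasing_seq a.
  by move=> m n mn; rewrite -subr_ge0; apply: le_trans (xa _ _ mn); exact: nsq_ge0.
have cva : cvgn a by apply: nondecreasing_is_cvgn => //; exists B => _ [n _ <-].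
have [N _ HN] : \forall n \near \oo, limn a - a n < eps.
  have : limn a - a n @[n --> \oo] --> limn a - limn a.
    by apply: cvgB => //; exact: cvg_cst.
  rewrite subrr => /cvgr0Pnorm_lt /(_ _ e0); apply: filterS => n.
  by apply: le_lt_trans; exact: ler_norm.
exists N => m n.
wlog mn : m n / (m <= n)%N => [hw|Nm Nn].
  by case/orP: (leq_total m n) => h Nm Nn; [|rewrite nsqBC]; apply: hw.
rewrite nsqBC (le_trans (xa _ _ mn))// (le_trans _ (ltW (HN m Nm)))//.
by rewrite lerB// nondecreasing_cvgn_le.
Qed.

Definition cvg_dot (x : nat -> V) (l : V) := forall eps : R, 0 < eps ->
  exists N, forall n, (N <= n)%N -> nsq (l - x n) <= eps.

(** The scalar products needed below are constant along the approximating
    sequence, so that they pass to the limit without any limit of numbers. *)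
Lemma cvg_dot_eventually x l h c N0 : cvg_dot x l ->
  (forall n, (N0 <= n)%N -> dot (x n) h = c) -> dot l h = c.
Proof.
move=> xl xc; apply/eqP; rewrite -subr_eq0; apply/eqP.
apply: ComplexField.Normc.eq0_normc; apply/eqP; rewrite -sqrf_eq0.
apply: contraT => w0; set w := normc _ ^+ 2 in w0.
have {}w0 : 0 < w by rewrite lt_neqAle eq_sym w0 sqr_ge0.
have h0 := nsq_ge0 h.
have [|N NP] := xl (w / (2 * (nsq h + 1))); first by rewrite divr_gt0//; lra.
have le1 := NP (maxn N0 N) (leq_maxr _ _).
have := cauchy_schwarz (l - x (maxn N0 N)) h.
rewrite dotBl xc ?leq_maxl// -/w => /le_trans/(_ (ler_wpM2r h0 le1)).
rewrite mulrAC ler_pdivlMr; last lra.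
by have := mulr_ge0 h0 (ltW w0); nra.
Qed.

Lemma cvg_dot_nsq x l : cvg_dot x l -> forall eps, 0 < eps ->
  exists N, forall n, (N <= n)%N -> nrm (l - x n) <= eps.
Proof.
move=> xl eps e0; have [N NP] := xl (eps ^+ 2) (exprn_gt0 _ e0).
by exists N => n Nn; apply: nrm_le; [exact: ltW|exact: NP].
Qed.

Lemma partial_cauchy x : cauchy_seq_dot (partial x).
Proof.
apply: (@cauchy_of_monotone _ (fun n => nsq (partial x n)) (nsq x)).
  by move=> m n mn; rewrite nsq_partialB.
by move=> n; rewrite nsq_partial bessel.
Qed.

End Dot.

(** * The space of square-integrable functions *)

Section L2space.
Variable R : realType.
Local Notation mu := (@lebesgue_measure R).
Local Notation D := (@circle R).
Local Notation normc := ComplexField.Normc.normc.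

Lemma L2_0 : L2 (fun=> 0 : R[i]).
Proof.
split; [exact: measurable_cst|exact: measurable_cst|].
have := integr_cst (0 : R); congr integr; apply/funext => x.
by rewrite sq_modulusE /re_part /im_part/= expr0n addr0.
Qed.

Lemma bounded_cst (c : R[i]) : bounded_by (normc c) (fun=> c).
Proof.
split.
  split; [exact: measurable_cst|exact: measurable_cst|].
  exact: (integr_cst (normc c ^+ 2)).
exists set0; split => // x; apply; by move=> _ /=.
Qed.

Lemma L2_cst (c : R[i]) : L2 (fun=> c).
Proof. by have [] := bounded_cst c. Qed.

Lemma L2Z (c : R[i]) f : L2 f -> L2 (fun x => c * f x).
Proof. exact: L2M (bounded_cst c). Qed.

Lemma L2N f : L2 f -> L2 (fun x : R => - f x : R[i]).
Proof. by move=> /(L2Z (-1)); under eq_fun do rewrite mulN1r. Qed.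

Lemma L2B f g : L2 f -> L2 g -> L2 (fun x : R => f x - g x : R[i]).
Proof. by move=> f2 g2; apply: L2D => //; exact: L2N. Qed.

Record L2fun := MkL2fun { l2val :> R -> R[i]; l2P : L2 l2val }.

HB.instance Definition _ := gen_eqMixin L2fun.
HB.instance Definition _ := gen_choiceMixin L2fun.

Lemma L2fun_ext (f g : L2fun) : l2val f =1 l2val g -> f = g.
Proof.
case: f g => f f2 [g g2] /= /funext fg; subst g; congr MkL2fun.
exact: Prop_irrelevance.
Qed.

Definition l2zero := MkL2fun L2_0.
Definition l2add (f g : L2fun) := MkL2fun (L2D (l2P f) (l2P g)).
Definition l2opp (f : L2fun) := MkL2fun (L2N (l2P f)).
Definition l2scale (c : R[i]) (f : L2fun) := MkL2fun (L2Z c (l2P f)).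

Fact l2addA : associative l2add.
Proof. by move=> f g h; apply: L2fun_ext => x /=; rewrite addrA. Qed.
Fact l2addC : commutative l2add.
Proof. by move=> f g; apply: L2fun_ext => x /=; rewrite addrC. Qed.
Fact l2add0 : left_id l2zero l2add.
Proof. by move=> f; apply: L2fun_ext => x /=; rewrite add0r. Qed.
Fact l2addN : left_inverse l2zero l2opp l2add.
Proof. by move=> f; apply: L2fun_ext => x /=; rewrite addNr. Qed.
HB.instance Definition _ :=
  GRing.isZmodule.Build L2fun l2addA l2addC l2add0 l2addN.

Fact l2scaleA a b f : l2scale a (l2scale b f) = l2scale (a * b) f.
Proof. by apply: L2fun_ext => x /=; rewrite mulrA. Qed.
Fact l2scale1 : left_id 1 l2scale.
Proof. by move=> f; apply: L2fun_ext => x /=; rewrite mul1r. Qed.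
Fact l2scaleDr : right_distributive l2scale +%R.
Proof. by move=> c f g; apply: L2fun_ext => x /=; rewrite mulrDr. Qed.
Fact l2scaleDl f : {morph l2scale^~ f : a b / a + b}.
Proof. by move=> a b; apply: L2fun_ext => x /=; rewrite mulrDl. Qed.
HB.instance Definition _ := GRing.Zmodule_isLmodule.Build R[i] L2fun
  l2scaleA l2scale1 l2scaleDr l2scaleDl.

Definition l2dot (f g : L2fun) : R[i] := inner f g.

Lemma inner_integr f g : L2 f -> L2 g ->
  cintegr (fun x : R => f x * ((g x)^*)%C : R[i]).
Proof. by move=> f2 g2; apply: L2_mul => //; exact: L2_conj. Qed.

Lemma inner_self (f : R -> R[i]) : L2 f ->
  inner f f = ((2 * pi)^-1 * \int[mu]_(x in D) sq_modulus f x)%:C.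
Proof.
move=> f2; rewrite /inner /cint.
rewrite (_ : re_part _ = sq_modulus f); last first.
  by apply/funext => x; rewrite sq_modulusE /re_part /im_part; case: (f x) => a b /=; ring.
rewrite (_ : im_part (fun x => _ * _) = fun=> 0); last first.
  by apply/funext => x; rewrite /im_part; case: (f x) => a b /=; ring.
by rewrite Rintegral_cst// mul0r mulr0.
Qed.

Lemma l2_is_dot : is_dot l2dot.
Proof.
split.
- move=> f g h; rewrite /l2dot/inner -cintD; try exact: (inner_integr (l2P _) (l2P _)).
  by congr cint; apply/funext => x /=; rewrite mulrDl.
- move=> c f h; rewrite /l2dot/inner -cintZ; try exact: (inner_integr (l2P _) (l2P _)).
  by congr cint; apply/funext => x /=; rewrite mulrA.
- move=> f g; rewrite /l2dot/inner -cint_conj; try exact: (inner_integr (l2P _) (l2P _)).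
  congr cint; apply/funext => x /=; case: (f x) (g x) => a b [c d]; apply/eqP; rewrite eq_complex /=; apply/andP; split; apply/eqP; ring.
- move=> f; rewrite /l2dot inner_self /=; last exact: l2P.
  apply: mulr_ge0; first by rewrite invr_ge0 ltW// twopi_gt0.
  by apply: Rintegral_ge0 => x _; exact: sq_modulus_ge0.
Qed.

Local Notation l2sq := (nsq l2dot).

Lemma l2sqE (f : L2fun) :
  l2sq f = (2 * pi)^-1 * \int[mu]_(x in D) sq_modulus f x.
Proof. by rewrite /nsq /l2dot inner_self//; exact: l2P. Qed.

Lemma L2norm_nrm (f : L2fun) : L2norm f = nrm l2dot f.
Proof. by rewrite /L2norm -l2sqE. Qed.

Lemma l2sq_integral (f : L2fun) :
  (\int[mu]_(x in D) (sq_modulus f x)%:E = (2 * pi * l2sq f)%:E)%E.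
Proof.
rewrite l2sqE mulrA divff ?gt_eqF ?twopi_gt0// mul1r fineK//.
by apply: integrable_fin_num => //; exact: L2_integr (l2P f).
Qed.

Lemma l2sq_eq0 (f : L2fun) : l2sq f = 0 <-> eqae f (fun=> 0).
Proof.
have [mr mi _] := l2P f.
have ms := meas_sq_modulus mr mi.
have key : (\int[mu]_(x in D) `|(sq_modulus f x)%:E|)%E = (2 * pi * l2sq f)%:E.
  rewrite -l2sq_integral; apply: eq_integral => x _.
  by rewrite gee0_abs// lee_fin sq_modulus_ge0.
have aeP := @ae_eq_integral_abs _ _ R mu D (@measurable_circle R)
  (EFin \o sq_modulus f).
have sq0 x : sq_modulus f x = 0 -> f x = 0.
  rewrite /sq_modulus => /eqP; rewrite expf_eq0/= => /eqP.
  exact: ComplexField.Normc.eq0_normc.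
split => [f0|[N [mN N0 sub]]].
- have /aeP : (\int[mu]_(x in D) `|(EFin \o sq_modulus f) x| = 0)%E.
    by rewrite key f0 mulr0.
  case; first exact/measurable_EFinP.
  move=> N [mN N0 sub]; exists N; split => // x nx; apply: sub => /= h; apply: nx.
  by move=> /h [] /sq0.
- have [_ ] := aeP ltac:(exact/measurable_EFinP).
  rewrite /comp key => h.
  suff /h [] : ae_eq mu D (fun x => (sq_modulus f x)%:E) (cst 0%E).
    by move/eqP; rewrite mulf_eq0 gt_eqF ?twopi_gt0//= => /eqP.
  exists N; split => // x nx; apply: sub => /= fx; apply: nx => /fx.
  by rewrite /sq_modulus => ->; rewrite ComplexField.Normc.normc0 expr0n.
Qed.

(** A total embedding; the value 0 is a default for the functions that are not
    square-integrable. *)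
Definition toL2 (f : R -> R[i]) : L2fun :=
  if pselect (L2 f) is left f2 then MkL2fun f2 else 0.

Lemma toL2E f : L2 f -> l2val (toL2 f) = f.
Proof. by rewrite /toL2; case: pselect. Qed.

Lemma toL2K (f : L2fun) : toL2 f = f.
Proof. by apply: L2fun_ext => x; rewrite toL2E//; exact: l2P. Qed.

Lemma toL2D f g : L2 f -> L2 g -> toL2 (fun x => f x + g x) = toL2 f + toL2 g.
Proof.
by move=> f2 g2; apply: L2fun_ext => x /=; rewrite !toL2E//; exact: L2D.
Qed.

Lemma toL2B f g : L2 f -> L2 g -> toL2 (fun x => f x - g x) = toL2 f - toL2 g.
Proof.
by move=> f2 g2; apply: L2fun_ext => x /=; rewrite !toL2E//; exact: L2B.
Qed.

Lemma toL2Z c f : L2 f -> toL2 (fun x => c * f x) = c *: toL2 f.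
Proof.
by move=> f2; apply: L2fun_ext => x /=; rewrite !toL2E//; exact: L2Z.
Qed.

Lemma inner_toL2 f g : L2 f -> L2 g -> inner f g = l2dot (toL2 f) (toL2 g).
Proof. by move=> f2 g2; rewrite /l2dot !toL2E. Qed.

Lemma eqae_l2sq f g : L2 f -> L2 g ->
  eqae f g <-> l2sq (toL2 f - toL2 g) = 0.
Proof.
move=> f2 g2; rewrite l2sq_eq0 -toL2B// toL2E; last exact: L2B.
split=> -[N [mN N0 sub]]; exists N; split=> // x nx; apply: sub => /= h;
  apply: nx => /h /=; last by move=> /subr0_eq.
by move=> ->; rewrite subrr.
Qed.

Lemma l2sqM C f (g : L2fun) : bounded_by C f ->
  l2sq (toL2 (fun x => f x * g x)) <= C ^+ 2 * l2sq g.
Proof.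
move=> fC; have fg2 := L2M fC (l2P g).
rewrite -(@ler_pM2l _ (2 * pi)) ?twopi_gt0// [leRHS]mulrCA -lee_fin (EFinM (C ^+ 2) (_ * _)).
rewrite -!l2sq_integral.
have [mr mi i2] := l2P g; have ms := meas_sq_modulus mr mi.
rewrite -ge0_integralZl//; first last.
- by rewrite lee_fin sqr_ge0.
- by move=> x _; rewrite lee_fin sq_modulus_ge0.
- exact/measurable_EFinP.
rewrite toL2E//; have [mr' mi' _] := fg2; have ms' := meas_sq_modulus mr' mi'.
apply: ae_ge0_le_integral => //.
- by move=> x _; rewrite lee_fin sq_modulus_ge0.
- exact/measurable_EFinP.
- by move=> x _; rewrite lee_fin mulr_ge0 ?sqr_ge0 ?sq_modulus_ge0.
- by apply/measurable_EFinP; apply: measurable_funM => //; exact: measurable_cst.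
case: fC => _ [N [mN N0 sub]]; exists N; split => // x nx; apply: sub => /= fx; apply: nx.
move=> /fx{}fx.
by rewrite lee_fin sq_modulusM ler_wpM2r// sq_modulus_ge0.
Qed.

End L2space.
Notation l2sq := (nsq (@l2dot _)).

(** * Completeness of the space of square-integrable functions *)

Section Complete.
Variable R : realType.
Local Notation mu := (@lebesgue_measure R).
Local Notation D := (@circle R).

Local Notation p2 n := ((2^-1 : R) ^+ n).

(** The sequences [v] and [w] below are monotone and enclose [r], with a gap that
    tends to 0. *)
Lemma geometric_increments (r : nat -> R) (c : R) :
  (forall k, `|r k.+1 - r k| <= c * p2 k) ->
  exists l, r @ \oo --> l /\ forall k, `|l - r k| <= 2 * c * p2 k.
Proof.
move=> rc.
pose v n := r n - 2 * c * p2 n; pose w n := r n + 2 * c * p2 n.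
have p0 : 2 * c * p2 n @[n --> \oo] --> (0 : R).
  rewrite -(mulr0 (2 * c)); apply: cvgM; first exact: cvg_cst.
  by apply: cvg_expr; rewrite ger0_norm ?invf_lt1 ?ltr1n ?invr_ge0.
have step n : p2 n = 2 * p2 n.+1 by rewrite exprS mulrA divff// mul1r.
have iv : nondecreasing_seq v.
  apply/nondecreasing_seqP => n; have := rc n; rewrite ler_norml => /andP[+ _].
  by rewrite /v (step n); nra.
have dw : nonincreasing_seq w.
  apply/nonincreasing_seqP => n; have := rc n; rewrite ler_norml => /andP[_].
  by rewrite /w (step n); nra.
have c0 : 0 <= c by have := rc 0%N; rewrite expr0 mulr1; apply: le_trans.
have pge n : 0 <= 2 * c * p2 n by rewrite !mulr_ge0// exprn_ge0// invr_ge0.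
have vw n : v n <= w n by have := pge n; rewrite /v /w; lra.
have cw : cvgn w.
  apply: nonincreasing_is_cvgn => //; exists (v 0%N) => _ [n _ <-].
  by apply: le_trans (vw n); apply: iv.
have cr : r @ \oo --> limn w.
  rewrite (_ : r = fun n => w n - 2 * c * p2 n); last by apply/funext => n; rewrite /w addrK.
  by rewrite -[limn w]subr0; exact: (cvgB cw p0).
have cv : v @ \oo --> limn w.
  by rewrite -[limn w]subr0; exact: (cvgB cr p0).
exists (limn w); split => // k.
have h1 := nonincreasing_cvgn_ge dw cw k.
have h2 := nondecreasing_cvgn_le iv (cvgP _ cv) k.
rewrite (cvg_lim _ cv)// in h2.
by move: h1 h2; rewrite ler_norml /v /w => h1 h2; apply/andP; split; lra.
Qed.

(** An upper limit is measurable and defined everywhere, also at the points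
    where the sequence diverges. *)
Definition limit_part (g : nat -> R -> R) (x : R) : R :=
  fine (limn_esup (fun k => (g k x)%:E)).

Lemma limit_part_meas (g : nat -> R -> R) : (forall k, measurable_fun D (g k)) ->
  measurable_fun D (limit_part g).
Proof.
move=> mg; apply: (measurableT_comp (@fine_measurable R setT measurableT)) => //.
by apply: measurable_fun_limn_esup => k; apply/measurable_EFinP.
Qed.

Lemma limit_partE (g : nat -> R -> R) x l :
  (fun k => g k x) @ \oo --> l -> limit_part g x = l.
Proof.
move=> gl; rewrite /limit_part.
have : (fun k => (g k x)%:E) @ \oo --> l%:E by apply/fine_cvgP; split => //; exact: nearW.
by case/cvg_limn_einf_sup => _ ->.
Qed.

Let f_lim (f : nat -> L2fun R) (x : R) : R[i] :=
  limit_part (fun k => re_part (f k)) x +i* limit_part (fun k => im_part (f k)) x.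

(** The sum [H] of the functions [4 ^ k * |f (k + 1) - f k| ^ 2] has a finite
    integral. Where it is finite, the increments are at most
    [sqrt H / 2 ^ k], so that [f] converges and the squared distance to the
    limit is at most [8 * H / 4 ^ k]: a factor 4 for the real part and the same
    for the imaginary part. Where [H] is infinite this bound is trivial; its
    integral bounds the norm. *)
Lemma L2_complete_fast (f : nat -> L2fun R) :
  (forall k, l2sq (f k.+1 - f k) <= (8^-1) ^+ k) ->
  exists g : L2fun R, exists C : R, forall k, l2sq (g - f k) <= C * (4^-1) ^+ k.
Proof.
move=> fc.
pose a k x := sq_modulus (f k.+1 - f k) x.
have ma k : measurable_fun D (a k).
  by have [mr mi _] := l2P (f k.+1 - f k); exact: meas_sq_modulus.
have a0 k x : 0 <= a k x by exact: sq_modulus_ge0.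
pose b k x : \bar R := (4 ^+ k * a k x)%:E.
have b0 k x : (0 <= b k x)%E by rewrite lee_fin mulr_ge0// exprn_ge0.
have mb k : measurable_fun D (b k).
  by apply/measurable_EFinP; apply: measurable_funM => //; exact: measurable_cst.
pose H x : \bar R := (\sum_(k <oo) b k x)%E.
have H0 x : (0 <= H x)%E by apply: nneseries_ge0 => k _ _.
have bH k x : (b k x <= H x)%E.
  apply: le_trans (@nneseries_lim_ge R (b^~ x) xpredT 0%N k.+1 _); last by move=> *; exact: b0.
  by rewrite big_nat_recr//= leeDr// sume_ge0// => i _; exact: b0.
have mH : measurable_fun D H by exact: ge0_emeasurable_sum.
have iH : (\int[mu]_(x in D) H x <= (4 * pi)%:E)%E.
  rewrite integral_nneseries//.
  apply: le_trans (epsilon_trick0 xpredT _); last by rewrite mulr_ge0 ?pi_ge0.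
  apply: lee_nneseries => k _; first by move=> _; apply: integral_ge0 => x _; exact: b0.
  have -> : (\int[mu]_(x in D) b k x = (4 ^+ k)%:E * (2 * pi * l2sq (f k.+1 - f k))%:E)%E.
    rewrite -l2sq_integral -ge0_integralZl//.
    - by apply/measurable_EFinP; exact: ma.
    - by move=> x _; rewrite lee_fin; exact: a0.
  rewrite -EFinM lee_fin.
  have w0 : 0 <= 4 ^+ k * (2 * pi) :> R.
    by rewrite mulr_ge0 ?exprn_ge0// ltW// twopi_gt0.
  rewrite mulrA; apply: le_trans (ler_wpM2l w0 (fc k)) _.
  rewrite (_ : 8 = 4 * 2 :> R); last by rewrite -natrM.
  rewrite natrX exprS exprVn exprMn !invfM.
  have k4 : (4 : R) ^+ k != 0 by rewrite expf_neq0.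
  have k2 : (2 : R) ^+ k != 0 by rewrite expf_neq0.
  rewrite le_eqVlt; apply/orP; left; apply/eqP; field.
  by rewrite k4 k2.
pose g := f_lim f.
have mre : measurable_fun D (re_part g).
  by apply: limit_part_meas => k; case: (l2P (f k)).
have mim : measurable_fun D (im_part g).
  by apply: limit_part_meas => k; case: (l2P (f k)).
have incr k x : sq_modulus (f k.+1 - f k) x =
    (re_part (f k.+1) x - re_part (f k) x) ^+ 2 +
    (im_part (f k.+1) x - im_part (f k) x) ^+ 2.
  by rewrite sq_modulusE /re_part /im_part/=; case: (f k.+1 x) (f k x) => ? ? [].
have diff k x : sq_modulus (fun x => g x - f k x) x =
    (limit_part (fun k => re_part (f k)) x - re_part (f k) x) ^+ 2 +
    (limit_part (fun k => im_part (f k)) x - im_part (f k) x) ^+ 2.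
  by rewrite sq_modulusE /re_part /im_part/=; case: (f k x) => ? ?.
have bound k x : ((sq_modulus (fun x => g x - f k x) x)%:E <=
    (8 * (4^-1) ^+ k)%:E * H x)%E.
  have k40 : 0 < 8 * (4^-1) ^+ k :> R by rewrite mulr_gt0// exprn_gt0// invr_gt0.
  case Hx : (H x) => [h| |]; last 2 first.
  - by rewrite gt0_muley ?leey// lte_fin.
  - by have := H0 x; rewrite Hx.
  have h0 : 0 <= h by have := H0 x; rewrite Hx.
  pose c := Num.sqrt h.
  have c2 : c ^+ 2 = h by rewrite sqr_sqrtr.
  have c0 : 0 <= c by exact: sqrtr_ge0.
  have inc_le j : a j x <= (c * p2 j) ^+ 2.
    have := bH j x; rewrite Hx lee_fin => le1.
    rewrite exprMn c2 -exprM mulnC exprM (_ : (2^-1) ^+ 2 = 4^-1 :> R); last first.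
      by rewrite exprVn -natrX.
    by rewrite exprVn ler_pdivlMr ?exprn_gt0// mulrC.
  have cp0 j : 0 <= c * p2 j by rewrite mulr_ge0// exprn_ge0// invr_ge0.
  have sqle (y z : R) : 0 <= z -> y ^+ 2 <= z ^+ 2 -> `|y| <= z.
    by move=> z0 yz; rewrite -(ger0_norm z0) -ler_sqr ?nnegrE// !real_normK ?num_real.
  have [l1 [cv1 b1]] : exists l, (fun k => re_part (f k) x) @ \oo --> l /\
      forall k, `|l - re_part (f k) x| <= 2 * c * p2 k.
    apply: geometric_increments => j; apply: sqle => //.
    by apply: le_trans (inc_le j); rewrite /a incr lerDl sqr_ge0.
  have [l2 [cv2 b2]] : exists l, (fun k => im_part (f k) x) @ \oo --> l /\
      forall k, `|l - im_part (f k) x| <= 2 * c * p2 k.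
    apply: geometric_increments => j; apply: sqle => //.
    by apply: le_trans (inc_le j); rewrite /a incr lerDr sqr_ge0.
  rewrite -EFinM lee_fin diff (limit_partE cv1) (limit_partE cv2).
  have q : (2 * c * p2 k) ^+ 2 = 4 * (4^-1) ^+ k * h.
    rewrite exprMn exprMn c2 -exprM mulnC exprM.
    rewrite (_ : (2^-1) ^+ 2 = 4^-1 :> R); last by rewrite exprVn -natrX.
    by rewrite -natrX; ring.
  have sq1 (y z : R) : `|y| <= z -> y ^+ 2 <= z ^+ 2.
    by move=> yz; rewrite -(real_normK (num_real y)) lerXn2r ?nnegrE// (le_trans _ yz).
  apply: le_trans (lerD (sq1 _ _ (b1 k)) (sq1 _ _ (b2 k))) _.
  by rewrite q; lra.
have i_diff k : (\int[mu]_(x in D) (sq_modulus (fun x => g x - f k x) x)%:E <=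
    (8 * (4^-1) ^+ k * (4 * pi))%:E)%E.
  have k40 : 0 <= 8 * (4^-1) ^+ k :> R by rewrite mulr_ge0// exprn_ge0// invr_ge0.
  have mdiff : measurable_fun D (sq_modulus (fun x => g x - f k x)).
    have [mr mi _] := l2P (f k); apply: meas_sq_modulus.
      rewrite (_ : re_part _ = fun x => re_part g x - re_part (f k) x).
        exact: measurable_funB.
      by apply/funext => x; rewrite /re_part; case: (g x) (f k x) => ? ? [].
    rewrite (_ : im_part _ = fun x => im_part g x - im_part (f k) x).
      exact: measurable_funB.
    by apply/funext => x; rewrite /im_part; case: (g x) (f k x) => ? ? [].
  apply: (@le_trans _ _ (\int[mu]_(x in D) ((8 * (4^-1) ^+ k)%:E * H x))%E).
    apply: ge0_le_integral => //.
    - by move=> x _; rewrite lee_fin sq_modulus_ge0.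
    - exact/measurable_EFinP.
    - exact: measurable_funeM.
  by rewrite ge0_integralZl// ?lee_fin// (EFinM (8 * _)) lee_wpmul2l// lee_fin.
have gL2 k : L2 (fun x => g x - f k x).
  have [mr mi _] := l2P (f k).
  have m1 : measurable_fun D (re_part (fun x => g x - f k x)).
    rewrite (_ : re_part _ = fun x => re_part g x - re_part (f k) x).
      exact: measurable_funB.
    by apply/funext => x; rewrite /re_part; case: (g x) (f k x) => ? ? [].
  have m2 : measurable_fun D (im_part (fun x => g x - f k x)).
    rewrite (_ : im_part _ = fun x => im_part g x - im_part (f k) x).
      exact: measurable_funB.
    by apply/funext => x; rewrite /im_part; case: (g x) (f k x) => ? ? [].
  split => //.
  apply/integrableP; split; first by apply/measurable_EFinP; exact: meas_sq_modulus.
  under eq_integral do rewrite gee0_abs ?lee_fin ?sq_modulus_ge0//.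
  exact: le_lt_trans (i_diff k) (ltry _).
have g2 : L2 g.
  have := L2D (gL2 0%N) (l2P (f 0%N)); congr L2; apply/funext => x.
  by rewrite subrK.
exists (MkL2fun g2), 16 => k.
rewrite -(@ler_pM2l _ (2 * pi)) ?twopi_gt0// -lee_fin -l2sq_integral.
apply: le_trans (i_diff k) _; rewrite lee_fin le_eqVlt; apply/orP; left; apply/eqP.
by ring.
Qed.

(** A Cauchy sequence converges as soon as one of its subsequences does, and the
    subsequence [f (t k)] has increments of squared norm at most [8 ^ - k]. *)
Lemma L2_complete (f : nat -> L2fun R) : cauchy_seq_dot (@l2dot R) f ->
  exists g : L2fun R, forall eps, 0 < eps -> exists N, forall n, (N <= n)%N ->
    l2sq (g - f n) <= eps.
Proof.
move=> cf.
have /choice [s sP] : forall k : nat, exists N, forall m n, (N <= m)%N -> (N <= n)%N ->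
    l2sq (f m - f n) <= (8^-1 : R) ^+ k.
  by move=> k; apply: cf; rewrite exprn_gt0// invr_gt0.
pose t := fix t k := if k is k'.+1 then maxn (t k').+1 (s k'.+1) else s 0%N.
have st k : (s k <= t k)%N by case: k => //= k; exact: leq_maxr.
have tt k : (t k < t k.+1)%N by exact: leq_maxl.
have [g [C gC]] := @L2_complete_fast (fun k => f (t k))
  (fun k => sP k _ _ (leq_trans (st k) (ltnW (tt k))) (st k)).
have C0 : 0 <= C by have := gC 0%N; rewrite expr0 mulr1; apply: le_trans; exact: nsq_ge0 (l2_is_dot R) _.
exists g => eps e0.
have [N NP] := cf (eps / 4) (divr_gt0 e0 (ltr0n _ 4)).
have [k [kN kC]] : exists k, (N <= t k)%N /\ C * (4^-1) ^+ k <= eps / 4.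
  have : C * (4^-1) ^+ n @[n --> \oo] --> (0 : R).
    rewrite -(mulr0 C); apply: cvgM; first exact: cvg_cst.
    by apply: cvg_expr; rewrite ger0_norm ?invf_lt1 ?ltr1n ?invr_ge0.
  move/cvgr0Pnorm_lt => /(_ (eps / 4) (divr_gt0 e0 (ltr0n _ 4))) [K _ KP].
  have kt n : (n <= t n)%N by elim: n => // n ih; exact: leq_ltn_trans ih (tt n).
  exists (maxn K N); split; first exact: leq_trans (leq_maxr _ _) (kt _).
  by apply: ltW; apply: le_lt_trans (KP _ (leq_maxl _ _)); exact: ler_norm.
exists N => n Nn.
have -> : g - f n = (g - f (t k)) + (f (t k) - f n) by rewrite addrA subrK.
have D2 := l2_is_dot R.
apply: le_trans (nsqD_le D2 _ _) _.
by have := le_trans (gC k) kC; have := NP (t k) n kN Nn; lra.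
Qed.

End Complete.

(** * Exponentials *)

Section Exponentials.
Variable R : realType.
Local Notation mu := (@lebesgue_measure R).
Local Notation D := (@circle R).
Implicit Types (m n : int).

Lemma expiD m n x : expi (m + n) x = expi m x * expi n x :> R[i].
Proof.
rewrite /expi intrD mulrDl cosD sinD; apply/eqP; rewrite eq_complex/=.
by apply/andP; split; apply/eqP; ring.
Qed.

Lemma expi_conj n x : (expi n x)^*%C = expi (- n) x :> R[i].
Proof. by rewrite /expi/= intrN mulNr cosN sinN. Qed.

Lemma expi0 : expi 0 = (fun=> 1) :> (R -> R[i]).
Proof. by apply/funext => x; rewrite /expi mul0r cos0 sin0. Qed.

Lemma sq_modulus_expi n x : sq_modulus (@expi R n) x = 1.
Proof. by rewrite sq_modulusE /re_part /im_part/= cos2Dsin2. Qed.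

Lemma expi_cos_continuous n : continuous (fun x : R => cos (n%:~R * x)).
Proof.
move=> x; have h : (fun y : R => n%:~R * y) y @[y --> x] --> n%:~R * x.
  by apply: cvgM; [exact: cvg_cst|exact: cvg_id].
exact: (cvg_comp _ _ h (@continuous_cos R _)).
Qed.

Lemma expi_sin_continuous n : continuous (fun x : R => sin (n%:~R * x)).
Proof.
move=> x; have h : (fun y : R => n%:~R * y) y @[y --> x] --> n%:~R * x.
  by apply: cvgM; [exact: cvg_cst|exact: cvg_id].
exact: (cvg_comp _ _ h (@continuous_sin R _)).
Qed.

Lemma bounded_expi n : bounded_by 1 (@expi R n).
Proof.
split; last by exists set0; split => // x; apply => _; rewrite /= sq_modulus_expi expr1n.
split.
- apply: measurable_funTS; apply: continuous_measurable_fun; exact: expi_cos_continuous.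
- apply: measurable_funTS; apply: continuous_measurable_fun; exact: expi_sin_continuous.
- have := integr_cst (1 : R); congr integr; apply/funext => x.
  by rewrite sq_modulus_expi.
Qed.

Lemma L2_expi n : L2 (@expi R n). Proof. by have [] := bounded_expi n. Qed.

Lemma cos_int_twopi n : cos (n%:~R * (2 * pi)) = 1 :> R.
Proof.
have key (k : nat) : cos (k%:R * (2 * pi)) = 1 :> R.
  elim: k => [|k ih]; first by rewrite mul0r cos0.
  rewrite -(natr1 k) mulrDl mul1r.
  by rewrite (_ : 2 * pi = pi + pi) in ih *; [rewrite addrA !cosDpi opprK|rewrite mulr2n mulrDl mul1r].
by case: n => k; rewrite ?NegzE ?intrN ?mulNr ?cosN; exact: key.
Qed.

Lemma cint_expi n : n != 0 -> cint (@expi R n) = 0.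
Proof.
move=> n0; have nR : n%:~R != 0 :> R by rewrite intr_eq0.
have ab : (0 : R) < 2 * pi := twopi_gt0 R.
have dl (x : R) : is_derive x 1 (fun x => n%:~R * x) n%:~R.
  have := is_deriveZ (n%:~R : R) (is_derive_id x (1 : R)).
  by move=> h; apply: is_derive_eq h _; rewrite /GRing.scale/= mulr1.
have ds (x : R) : is_derive x 1 (fun x => n%:~R^-1 * sin (n%:~R * x)) (cos (n%:~R * x)).
  have h : is_derive x 1 (sin \o (fun x => n%:~R * x)) (cos (n%:~R * x) * n%:~R).
    exact: is_derive1_comp.
  apply: (is_derive_eq (is_deriveZ (n%:~R^-1 : R) h)).
  by rewrite /GRing.scale/= mulrC mulfK.
have dc (x : R) : is_derive x 1 (fun x => - n%:~R^-1 * cos (n%:~R * x)) (sin (n%:~R * x)).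
  have h : is_derive x 1 (cos \o (fun x => n%:~R * x)) (- sin (n%:~R * x) * n%:~R).
    exact: is_derive1_comp.
  apply: (is_derive_eq (is_deriveZ (- n%:~R^-1 : R) h)).
  by rewrite /GRing.scale/=; field.
have ftc (f F : R -> R) : continuous f -> (forall x : R, is_derive x (1 : R) F (f x)) ->
    \int[mu]_(x in D) f x = F (2 * pi) - F 0.
  move=> cf dF; rewrite /Rintegral (continuous_FTC2 ab _ (F := F))//.
  - exact: continuous_subspaceT.
  - have cF : continuous F.
      by move=> x; apply: differentiable_continuous; apply/derivable1_diffP; case: (dF x).
    split.
    + by move=> x _; case: (dF x).
    + exact/cvg_at_right_filter/cF.
    + exact/cvg_at_left_filter/cF.
  - by move=> x _; rewrite derive1E; case: (dF x).
rewrite /cint (ftc (re_part (expi n)) _ (@expi_cos_continuous n) ds).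
rewrite (ftc (im_part (expi n)) _ (@expi_sin_continuous n) dc).
rewrite !mulr0 sin0 cos0 cos_int_twopi subrr mulr0.
have -> : sin (n%:~R * (2 * pi)) = 0 :> R.
  by apply/eqP; rewrite -sqrf_eq0 sin2cos2 cos_int_twopi expr1n subrr.
by rewrite mulr0 subrr mulr0.
Qed.

Lemma expi_orthonormal m n : inner (@expi R m) (expi n) = (m == n)%:R.
Proof.
rewrite /inner; under eq_fun do rewrite expi_conj -expiD.
have [->|mn] := eqVneq m n; last by rewrite cint_expi// subr_eq0.
rewrite subrr expi0 /cint /re_part /im_part !Rintegral_cst//.
rewrite (_ : fine _ = 2 * pi); last by rewrite -[RHS]/(fine (2 * pi)%:E) -circle_measure.
by rewrite /= mul0r mulr0 mul1r mulVf// gt_eqF// twopi_gt0.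
Qed.

(** * Approximation of a step function by polynomials *)

Lemma bernoulli_ge (a : R) k : 0 <= a -> 1 + k%:R * a <= (1 + a) ^+ k.
Proof.
move=> a0; elim: k => [|k ih]; first by rewrite mul0r addr0 expr0.
rewrite exprS -natr1; apply: le_trans (ler_wpM2l _ ih); last by rewrite addr_ge0.
have := mulr_ge0 (ler0n R k) (sqr_ge0 a); nra.
Qed.

Lemma bernoulli_le (a : R) k : 0 <= a <= 1 -> 1 - k%:R * a <= (1 - a) ^+ k.
Proof.
move=> /andP[a0 a1]; elim: k => [|k ih]; first by rewrite mul0r subr0 expr0.
rewrite exprS -natr1; apply: le_trans (ler_wpM2l _ ih); last by rewrite subr_ge0.
have := mulr_ge0 (ler0n R k) (sqr_ge0 a); nra.
Qed.

(** By the Bernoulli inequalities this polynomial is at least [1 - (2 z) ^ k] and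
    at most [(2 z) ^ - k]: on [0, 1] it converges to 1 below 1/2 and to 0
    above. *)
Definition step_poly (k : nat) (z : R) : R := (1 - z ^+ k) ^+ (2 ^ k).

Lemma step_poly_01 k z : 0 <= z <= 1 -> 0 <= step_poly k z <= 1.
Proof.
move=> /andP[z0 z1].
have zk0 : 0 <= z ^+ k by rewrite exprn_ge0.
have zk1 : z ^+ k <= 1 by rewrite exprn_ile1.
by rewrite exprn_ge0 ?subr_ge0// exprn_ile1 ?subr_ge0// gerBl.
Qed.

Lemma step_poly_low z : 0 <= z < 2^-1 -> step_poly k z @[k --> \oo] --> (1 : R).
Proof.
move=> /andP[z0 z1].
have zle1 : z <= 1 by lra.
apply: (@squeeze_cvgr _ _ _ _ (fun k => 1 - (2 * z) ^+ k) (fun=> 1)).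
- apply: nearW => k; have /andP[_ ->] := step_poly_01 k (introT andP (conj z0 zle1)).
  rewrite andbT exprMn -natrX; apply: bernoulli_le.
  by rewrite exprn_ge0// exprn_ile1.
- rewrite -[X in _ --> X]subr0; apply: cvgB; first exact: cvg_cst.
  by apply: cvg_expr; rewrite ger0_norm; lra.
- exact: cvg_cst.
Qed.

Lemma step_poly_high z : 2^-1 < z <= 1 -> step_poly k z @[k --> \oo] --> (0 : R).
Proof.
move=> /andP[z0 z1].
have z2 : 0 < 2 * z by lra.
apply: (@squeeze_cvgr _ _ _ _ (fun=> 0) (fun k => ((2 * z)^-1) ^+ k)).
- apply: nearW => k; have z00 : 0 <= z by lra.
  have /andP[-> _]/= := step_poly_01 k (introT andP (conj z00 z1)).
  have zk0 : 0 <= z ^+ k by rewrite exprn_ge0.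
  rewrite exprVn -div1r ler_pdivlMr ?exprn_gt0//.
  have /le_trans h : (2 * z) ^+ k <= (1 + z ^+ k) ^+ (2 ^ k).
    rewrite exprMn -natrX; apply: le_trans (bernoulli_ge _ zk0).
    by rewrite lerDr.
  have sp0 : 0 <= step_poly k z by have /andP[] := step_poly_01 k (introT andP (conj z00 z1)).
  apply: le_trans (ler_wpM2l sp0 (h _ (lexx _))) _.
  rewrite /step_poly -exprMn exprn_ile1//.
    by apply: mulr_ge0; [rewrite subr_ge0 exprn_ile1|rewrite addr_ge0].
  by have := sqr_ge0 (z ^+ k); nra.
- exact: cvg_cst.
- apply: cvg_expr; rewrite ger0_norm ?invr_ge0 ?ltW// invf_lt1//; lra.
Qed.

End Exponentials.

(** * Uniqueness of Fourier coefficients *)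

Section Uniqueness.
Variable R : realType.
Local Notation mu := (@lebesgue_measure R).
Local Notation D := (@circle R).

(** Lebesgue differentiation. *)
Lemma null_of_primitive (g : R -> R) : integr g ->
  (forall y, 0 <= y <= 2 * pi -> \int[mu]_(x in `[0, y]) g x = 0) ->
  ae_eq mu D g (fun=> 0).
Proof.
move=> gi g0; pose h := g \_ D.
have hi : mu.-integrable setT (EFin \o h).
  have [+ _] : mu.-integrable D (EFin \o g) <-> mu.-integrable setT ((EFin \o g) \_ D).
    exact: (integrable_mkcond _ (@measurable_circle R)).
  by rewrite restrict_EFin; apply.
have hl : locally_integrable setT h.
  exact: (integrable_locally_restrict (@measurable_circle R) gi).
have hiy y : mu.-integrable [set` Interval (BLeft (0:R)) (BRight y)] (EFin \o h).
  by apply: integrableS hi.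
have := FTC1 hiy hl.
set F := fun y => _.
have F0 y : F y = 0.
  rewrite /F; have [y0|y0] := ltP y 0.
    by rewrite set_itv_ge ?Rintegral_set0// bnd_simp -ltNge.
  have [y1|y1] := leP y (2 * pi).
    rewrite -[RHS](g0 y (introT andP (conj y0 y1))).
    apply: eq_Rintegral => x; rewrite inE/= in_itv/= => /andP[x0 x1].
    by rewrite /h patchE mem_set// /circle/= in_itv/= x0 (le_trans x1).
  rewrite -Rintegral_mkcondr setIC.
  rewrite (_ : D `&` _ = D).
    by apply: g0; rewrite lexx andbT ltW// twopi_gt0.
  rewrite setIidl// => x; rewrite /circle/= !in_itv/= => /andP[-> /=].
  by move=> /le_lt_trans/(_ y1)/ltW.
have F0' : F = fun=> 0 by apply/funext.
rewrite F0' => -[N [mN N0 sub]].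
exists (N `|` [set 0]); split.
- exact: measurableU.
- by rewrite measureU0//; exact: lebesgue_measure_set1.
- move=> x /= nx; have [->|x0] := eqVneq x 0; [by right|left].
  apply: sub => /= hx; apply: nx => Dx.
  have [|_] := hx; first by rewrite lte_fin lt_neqAle eq_sym x0; case/andP: Dx.
  by rewrite derive1_cst /h patchE mem_set.
Qed.

(** The functions whose Fourier coefficients all vanish are stable under
    multiplication by trigonometric polynomials. *)
Definition no_coef (f : R -> R[i]) : Prop :=
  L2 f /\ forall n : int, cint (fun x => f x * expi n x) = 0.

Definition multiplier (w : R -> R[i]) : Prop :=
  forall f, no_coef f -> no_coef (fun x => w x * f x).

Lemma multiplier_expi k : multiplier (expi k).
Proof.
move=> f [f2 fn]; split; first exact: L2M (bounded_expi R k) f2.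
move=> n; rewrite -(fn (k + n)); congr cint; apply/funext => x.
by rewrite expiD; ring.
Qed.

Lemma multiplier_cst c : multiplier (fun=> c).
Proof.
move=> f [f2 fn]; split; first exact: L2Z.
move=> n; under eq_fun do rewrite -mulrA.
by rewrite cintZ ?fn ?mulr0//; apply: L2_mul => //; exact: L2_expi.
Qed.

Lemma multiplierD w1 w2 : multiplier w1 -> multiplier w2 ->
  multiplier (fun x => w1 x + w2 x).
Proof.
move=> m1 m2 f Zf; have [f1 fn1] := m1 f Zf; have [f2 fn2] := m2 f Zf; split.
  by under eq_fun do rewrite mulrDl; exact: L2D.
move=> n; under eq_fun do rewrite !mulrDl.
by rewrite cintD ?fn1 ?fn2 ?addr0//; apply: L2_mul => //; exact: L2_expi.
Qed.

Lemma multiplierM w1 w2 : multiplier w1 -> multiplier w2 ->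
  multiplier (fun x => w1 x * w2 x).
Proof. by move=> m1 m2 f Zf; under eq_fun do rewrite -mulrA; apply/m1/m2. Qed.

Lemma multiplierX w k : multiplier w -> multiplier (fun x => w x ^+ k).
Proof.
move=> m; elim: k => [|k ih].
  by under eq_fun do rewrite expr0; exact: multiplier_cst.
by under eq_fun do rewrite exprS; exact: multiplierM.
Qed.

(** A trigonometric polynomial with values in [0, 1]. By [zfunE] it differs from
    1/2 by [- sin (x / 2) * sin ((y - x) / 2) / 2], so that it is less than 1/2
    for [x] between 0 and [y], and greater for [x] between [y] and [2 pi]: the
    composition with [step_poly] approximates the
    indicator function of this interval. *)
Let zfun (y x : R) : R := 2^-1 - (cos (x - y / 2) - cos (y / 2)) / 4.

Lemma multiplier_step y k : multiplier (fun x => (step_poly k (zfun y x))%:C).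
Proof.
pose c := y / 2.
have mz : multiplier (fun x => (zfun y x)%:C).
  have -> : (fun x => (zfun y x)%:C) = fun x =>
      (2^-1 + cos c / 4)%:C +
      ((- 8^-1) * cos c +i* (8^-1 * sin c) * expi 1 x +
       (- 8^-1) * cos c +i* (- 8^-1 * sin c) * expi (-1) x).
    apply/funext => x; rewrite /zfun -/c cosB /expi intrN mulr1z mulN1r mul1r cosN sinN.
    by apply/eqP; rewrite eq_complex/=; apply/andP; split; apply/eqP; field.
  apply: multiplierD; first exact: multiplier_cst.
  by apply: multiplierD; apply: multiplierM; try exact: multiplier_cst; exact: multiplier_expi.
have -> : (fun x => (step_poly k (zfun y x))%:C) =
    fun x => (1 + -1 * (zfun y x)%:C ^+ k) ^+ (2 ^ k).
  by apply/funext => x; rewrite /step_poly rmorphXn rmorphB rmorphXn rmorph1 mulN1r.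
apply: multiplierX; apply: multiplierD; first exact: multiplier_cst.
by apply: multiplierM; [exact: multiplier_cst|exact: multiplierX].
Qed.

Lemma no_coef_step f y k : no_coef f ->
  \int[mu]_(x in D) (re_part f x * step_poly k (zfun y x)) = 0.
Proof.
move=> /(multiplier_step y k)[_ /(_ 0)] [/eqP + _].
rewrite mulf_eq0 invr_eq0 gt_eqF ?twopi_gt0//= => /eqP <-.
apply: eq_Rintegral => x _; rewrite /re_part expi0 mulr1.
by case: (f x) => a b /=; ring.
Qed.

Lemma zfunE y x : zfun y x = 2^-1 - sin (x / 2) * sin ((y - x) / 2) / 2.
Proof.
rewrite /zfun (_ : x - y / 2 = x / 2 - (y - x) / 2); last by field.
rewrite (_ : cos (y / 2) = cos (x / 2 + (y - x) / 2)); last by congr cos; field.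
by rewrite cosB cosD; field.
Qed.

Lemma zfun01 y x : 0 <= zfun y x <= 1.
Proof.
rewrite /zfun; have := cos_le1 (x - y / 2); have := cos_geN1 (x - y / 2).
have := cos_le1 (y / 2); have := cos_geN1 (y / 2) => *.
by apply/andP; split; lra.
Qed.

Lemma zfun_low y x : 0 < x < y -> y <= 2 * pi -> zfun y x < 2^-1.
Proof.
move=> /andP[x0 xy] y2; rewrite zfunE.
have s1 : 0 < sin (x / 2) by apply: sin_gt0_pi; apply/andP; split; lra.
have s2 : 0 < sin ((y - x) / 2) by apply: sin_gt0_pi; apply/andP; split; lra.
have := mulr_gt0 s1 s2; lra.
Qed.

Lemma zfun_high y x : 0 <= y < x -> x < 2 * pi -> 2^-1 < zfun y x.
Proof.
move=> /andP[y0 yx] x2; rewrite zfunE.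
have s1 : 0 < sin (x / 2) by apply: sin_gt0_pi; apply/andP; split; lra.
have s2 : 0 < sin ((x - y) / 2) by apply: sin_gt0_pi; apply/andP; split; lra.
have -> : sin ((y - x) / 2) = - sin ((x - y) / 2) by rewrite -sinN; congr sin; field.
have := mulr_gt0 s1 s2; lra.
Qed.

(** The integrals of [re_part f] against the trigonometric polynomials
    [step_poly k (zfun y x)] vanish, and they converge to its integral over
    [0, y] by dominated convergence. *)
Lemma no_coef_primitive f y : no_coef f -> 0 <= y <= 2 * pi ->
  \int[mu]_(x in `[0, y]) re_part f x = 0.
Proof.
move=> Zf /andP[y0 y2]; have [f2 _] := Zf; have [fi _] := L2_cintegr f2.
pose F k x := re_part f x * step_poly k (zfun y x).
pose G := re_part f \_ `[0, y].
have mf : measurable_fun D (re_part f) by case: f2.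
have mz : measurable_fun D (zfun y).
  apply: measurable_funTS; apply: continuous_measurable_fun => x.
  apply: cvgB; first exact: cvg_cst.
  apply: cvgM; last exact: cvg_cst.
  apply: cvgB; last exact: cvg_cst.
  have h : (t - y / 2) @[t --> x] --> x - y / 2 by apply: cvgB; [exact: cvg_id|exact: cvg_cst].
  exact: (cvg_comp _ _ h (@continuous_cos R _)).
have mF k : measurable_fun D (F k).
  apply: measurable_funM => //; apply: measurable_funX.
  by apply: measurable_funB; [exact: measurable_cst|exact: measurable_funX].
have mG : measurable_fun D G.
  have mI : measurable (`[0, y] : set R) by exact: measurable_itv.
  have [+ _] := measurable_restrict (re_part f) mI (@measurable_circle R).
  by apply; apply: measurable_funS mf => //; exact: (@measurable_circle R).
have lim x : D x -> x != 0 -> x != y -> x != 2 * pi -> F k x @[k --> \oo] --> G x.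
  rewrite /circle/= in_itv/= => /andP[x0 x2] xn0 xny xn2.
  have xp : 0 < x by rewrite lt_neqAle eq_sym xn0.
  have xl : x < 2 * pi by rewrite lt_neqAle xn2.
  rewrite /F /G patchE; have [xy|yx|xy] := ltgtP x y; last by rewrite xy eqxx in xny.
  - rewrite mem_set; last by rewrite /= in_itv/= x0 ltW.
    rewrite -[X in _ --> X]mulr1; apply: cvgM; first exact: cvg_cst.
    apply: step_poly_low; have /andP[-> _]/= := zfun01 y x.
    by apply: zfun_low => //; rewrite xp xy.
  - rewrite memNset; last by rewrite /= in_itv/= => /andP[_]; rewrite leNgt yx.
    rewrite -[X in _ --> X](mulr0 (re_part f x)); apply: cvgM; first exact: cvg_cst.
    apply: step_poly_high; have /andP[_ ->] := zfun01 y x.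
    by rewrite andbT zfun_high// y0 yx.
have aelim : {ae mu, forall x, D x -> (EFin \o F k) x @[k --> \oo] --> (EFin \o G) x}.
  exists ([set 0] `|` [set y] `|` [set 2 * pi]); split.
  - by apply: measurableU => //; exact: measurableU.
  - by apply: countable_lebesgue_measure0; apply: finite_set_countable; rewrite !finite_setU.
  move=> x /= nx; apply: contrapT => /not_orP[/not_orP[/eqP n1 /eqP n2] /eqP n3].
  by apply: nx => Dx; apply: cvg_EFin; [exact: nearW|exact: lim].
have aebnd : {ae mu, forall x k, D x ->
    (`|(EFin \o F k) x| <= (EFin \o (fun x => `|re_part f x|%R)) x)%E}.
  exists set0; split => // x; apply => k _ /=; rewrite lee_fin /F normrM ler_piMr//.
  by have /andP[p0 p1] := step_poly_01 k (zfun01 y x); rewrite ger0_norm.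
have [_ _ cvg] := @dominated_convergence _ _ R mu D (@measurable_circle R)
  (fun k => EFin \o F k) (EFin \o G) (EFin \o (fun x => `|re_part f x|))
  (fun k => (measurable_EFinP _ _).2 (mF k)) ((measurable_EFinP _ _).2 mG) aelim
  (integrable_norm fi) aebnd.
have IF k : (\int[mu]_(x in D) (EFin \o F k) x = 0)%E.
  have iF : integr (F k).
    apply: integr_le (integrable_norm fi) => // x /=.
    rewrite /F normrM ler_piMr//.
    by have /andP[p0 p1] := step_poly_01 k (zfun01 y x); rewrite ger0_norm.
  rewrite -[LHS]fineK; last exact: integrable_fin_num.
  by congr EFin; exact: no_coef_step.
have : \int[mu]_(x in D) G x = 0.
  have : (\int[mu]_(x in D) (EFin \o G) x = 0)%E.
    apply: cvg_unique cvg _ => //.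
    rewrite (_ : (fun n => _) = fun=> 0%E); first exact: cvg_cst.
    by apply/funext => k; exact: IF.
  by rewrite /Rintegral => ->.
rewrite /G -Rintegral_mkcondr setIC setIidl// => x; rewrite /circle/= !in_itv/=.
by move=> /andP[-> /le_trans]; exact.
Qed.

Lemma no_coef_ae0 f : no_coef f -> eqae f (fun=> 0).
Proof.
have re0 g : no_coef g -> ae_eq mu D (re_part g) (fun=> 0).
  move=> Zg; apply: null_of_primitive; last by move=> y; exact: no_coef_primitive.
  by have [g2 _] := Zg; have [] := L2_cintegr g2.
move=> Zf; have [N1 [mN1 N10 sub1]] := re0 f Zf.
have [N2 [mN2 N20 sub2]] := re0 _ (multiplier_cst 'i%C Zf).
exists (N1 `|` N2); split; [exact: measurableU| |].
  by rewrite measureU0.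
move=> x /= nx; apply: contrapT => /not_orP[n1 n2]; apply: nx => Dx.
have r1 : re_part f x = 0.
  by apply: contrapT => h; apply: n1; apply: sub1 => /= /(_ Dx).
have r2 : re_part (fun x => 'i%C * f x) x = 0.
  by apply: contrapT => h; apply: n2; apply: sub2 => /= /(_ Dx).
move: r1 r2; rewrite /re_part; case: (f x) => a b /= ->.
by rewrite mul0r mul1r sub0r => /eqP; rewrite oppr_eq0 => /eqP ->.
Qed.

End Uniqueness.

(** * The Hardy space *)

Section HardySpace.
Variable R : realType.
Local Notation L2D := (l2_is_dot R).

Definition en (n : nat) : L2fun R := MkL2fun (L2_expi R n%:Z).

Lemma en_orthonormal m n : l2dot (en m) (en n) = (m == n)%:R.
Proof. exact: expi_orthonormal. Qed.

Local Notation part := (partial (@l2dot R) en).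

Lemma partial_negfreq f N (n : int) : n < 0 ->
  l2dot (part f N) (MkL2fun (L2_expi R n)) = 0.
Proof.
move=> n0; rewrite /partial (dot_suml L2D) big1// => k _.
rewrite (dotZl L2D) /l2dot/= expi_orthonormal.
by case: eqP => [e|_]; [rewrite -e in n0|rewrite mulr0].
Qed.

Lemma partial_limit f : exists g : L2fun R, [/\ cvg_dot (@l2dot R) (part f) g,
  forall n, l2dot g (en n) = l2dot f (en n) & Hardy g].
Proof.
have [g gP] := L2_complete (partial_cauchy L2D en_orthonormal f).
exists g; split => //.
- move=> n; apply: (cvg_dot_eventually L2D (N0 := n.+1) gP) => N nN.
  by rewrite (dot_partial L2D en_orthonormal) nN.
- split; first exact: l2P.
  move=> n n0; apply: (cvg_dot_eventually L2D (N0 := 0) (h := MkL2fun (L2_expi R n)) gP).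
  by move=> N _; exact: partial_negfreq.
Qed.

(** The partial sums have a limit by completeness; its Fourier coefficients are
    those of [h], so that it is [h] by uniqueness. *)
Lemma Hardy_partial (h : L2fun R) : Hardy h -> cvg_dot (@l2dot R) (part h) h.
Proof.
move=> [_ hn]; have [g [gc gn [_ gneg]]] := partial_limit h.
suff h0 : l2sq (h - g) = 0.
  move=> eps e0; have [N NP] := gc (eps / 2) (divr_gt0 e0 (ltr0n _ 2)).
  exists N => n Nn; have -> : h - part h n = (h - g) + (g - part h n).
    by rewrite addrA subrK.
  by apply: le_trans (nsqD_le L2D _ _) _; rewrite h0; have := NP n Nn; lra.
apply/l2sq_eq0; apply: no_coef_ae0; split; first exact: l2P.
move=> n; have -> : cint (fun x => (h - g) x * expi n x) =
    l2dot (h - g) (MkL2fun (L2_expi R (- n))).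
  rewrite /l2dot /inner; congr cint; apply/funext => x.
  by rewrite -[n in LHS]opprK -expi_conj.
rewrite (dotBl L2D); have [n0|n0] := ltP 0 n.
  by rewrite /l2dot /= -!/(fourier _ _) hn ?gneg ?subrr ?oppr_lt0.
have : 0 <= - n by rewrite oppr_ge0.
by case: (- n) => // k _; rewrite -/(en k) gn subrr.
Qed.

Lemma orthogonal_Hardy (f : L2fun R) : (forall n, l2dot f (en n) = 0) ->
  forall h : L2fun R, Hardy h -> l2dot f h = 0.
Proof.
move=> fn h hH; rewrite (dotC L2D) (_ : l2dot h f = 0) ?rmorph0//.
apply: (cvg_dot_eventually L2D (N0 := 0) (Hardy_partial hH)) => N _.
rewrite (dot_suml L2D) big1// => n _.
by rewrite (dotZl L2D) (dotC L2D f) fn rmorph0 mulr0.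
Qed.

Lemma szego_projP (f : L2fun R) : Hardy (szego_proj f) /\
  forall h, Hardy h -> inner (szego_proj f) h = inner f h.
Proof.
rewrite /szego_proj /oproj; case: xgetP => [g -> [gH gP]|].
  split => // h hH; have [g2 _] := gH; have [h2 _] := hH.
  have := gP h hH; rewrite (inner_toL2 (L2B (l2P f) g2) h2) toL2B//; last exact: l2P.
  by rewrite (dotBl L2D) -!inner_toL2//; [move/subr0_eq|exact: l2P].
have [g [gc gn gH]] := partial_limit f.
move/(_ (l2val g)); case; split => // h hH; have [h2 _] := hH.
rewrite (inner_toL2 (L2B (l2P f) (l2P g)) h2) toL2B ?toL2K; try exact: l2P.
apply: orthogonal_Hardy; last by rewrite toL2E.
by move=> n; rewrite (dotBl L2D) gn subrr.
Qed.

Lemma szego_proj_ext (f g : R -> R[i]) : L2 f -> L2 g ->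
  (forall h, Hardy h -> inner f h = inner g h) ->
  szego_proj f = szego_proj g.
Proof.
move=> f2 g2 fg; rewrite /szego_proj /oproj; congr xget.
have sub (a b : R -> R[i]) : L2 a -> L2 b -> (forall h, Hardy h -> inner a h = inner b h) ->
  forall k h, Hardy k -> Hardy h -> inner (fun x => a x - k x) h = inner (fun x => b x - k x) h.
  move=> a2 b2 ab k h kH hH; have [k2 _] := kH; have [h2 _] := hH.
  rewrite !inner_toL2//; try exact: L2B.
  by rewrite !toL2B// !(dotBl L2D) -!inner_toL2// ab.
by apply/seteqP; split => k /= [kH kP]; split => // h hH;
  [rewrite -(sub f g)//|rewrite (sub f g)//]; exact: kP.
Qed.

(** The value of [szego_proj] depends only on the class of its argument in the
    quotient by equality almost everywhere ([szego_proj_ext]). Its fixed points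
    are thus canonical representatives, for which Leibniz equality is equality
    in the Hilbert space; [cls] is the map from functions to representatives. *)
Record hardy := MkHardy {
  hval : L2fun R;
  hvalP : Hardy hval /\ szego_proj hval = hval }.

Lemma hval_Hardy (a : hardy) : Hardy (hval a). Proof. by have [] := hvalP a. Qed.
Hint Resolve hval_Hardy : core.

Lemma szego_proj_id (f : L2fun R) : szego_proj (szego_proj f) = szego_proj f.
Proof.
have [H P] := szego_projP f.
by apply: szego_proj_ext => //; [case: H|exact: l2P].
Qed.

Lemma cls_subproof (f : L2fun R) :
  Hardy (toL2 (szego_proj f)) /\
  szego_proj (toL2 (szego_proj f)) = toL2 (szego_proj f).
Proof.
have [H P] := szego_projP f; rewrite toL2E; last by case: H.
by split => //; exact: szego_proj_id.
Qed.

Definition cls (f : L2fun R) : hardy := MkHardy (cls_subproof f).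

Lemma hval_cls f : l2val (hval (cls f)) = szego_proj f.
Proof. by rewrite toL2E//; case: (szego_projP f) => -[]. Qed.

Lemma l2dot_cls f (h : L2fun R) : Hardy h -> l2dot (hval (cls f)) h = l2dot f h.
Proof. by move=> hH; rewrite /l2dot hval_cls; have [_ ->] := szego_projP f. Qed.

Lemma hardy_ext (a b : hardy) :
  (forall h : L2fun R, Hardy h -> l2dot (hval a) h = l2dot (hval b) h) -> a = b.
Proof.
move=> ab.
have : hval a = hval b.
  apply: L2fun_ext => x; have [_ <-] := hvalP a; have [_ <-] := hvalP b.
  congr (_ x); apply: szego_proj_ext; try exact: l2P.
  by move=> h hH; have := ab (MkL2fun hH.1) hH.
case: a b {ab} => a aP [b bP] /= ab; subst b; congr MkHardy.
exact: Prop_irrelevance.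
Qed.

HB.instance Definition _ := gen_eqMixin hardy.
HB.instance Definition _ := gen_choiceMixin hardy.

(* The operations are given by opaque existence facts, which keep unification
   from unfolding them. *)
Fact hzero_fact : {op : hardy | op = cls 0}.
Proof. by eexists. Qed.
Definition hzero := sval hzero_fact.
Lemma hzeroE : hzero = cls 0.
Proof. exact: (svalP hzero_fact). Qed.

Fact hadd_fact : {op : hardy -> hardy -> hardy | forall a b, op a b = cls (hval a + hval b)}.
Proof. by eexists. Qed.
Definition hadd := sval hadd_fact.
Lemma haddE a b : hadd a b = cls (hval a + hval b).
Proof. exact: (svalP hadd_fact). Qed.

Fact hopp_fact : {op : hardy -> hardy | forall a, op a = cls (- hval a)}.
Proof. by eexists. Qed.
Definition hopp := sval hopp_fact.
Lemma hoppE a : hopp a = cls (- hval a).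
Proof. exact: (svalP hopp_fact). Qed.

Fact hscale_fact : {op : R[i] -> hardy -> hardy | forall c a, op c a = cls (c *: hval a)}.
Proof. by eexists. Qed.
Definition hscale := sval hscale_fact.
Lemma hscaleE c a : hscale c a = cls (c *: hval a).
Proof. exact: (svalP hscale_fact). Qed.

Let lin := (hzeroE, haddE, hoppE, hscaleE, @dotDl _ _ _ L2D, @dotZl _ _ _ L2D, @dotNl _ _ _ L2D, @dot0l _ _ _ L2D).

Fact haddA : associative hadd.
Proof. by move=> a b c; apply: hardy_ext => h hH; rewrite !(l2dot_cls, lin)//; rewrite addrA. Qed.
Fact haddC : commutative hadd.
Proof. by move=> a b; apply: hardy_ext => h hH; rewrite !(l2dot_cls, lin)//; rewrite addrC. Qed.
Fact hadd0 : left_id hzero hadd.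
Proof. by move=> a; apply: hardy_ext => h hH; rewrite !(l2dot_cls, lin)//; rewrite add0r. Qed.
Fact haddN : left_inverse hzero hopp hadd.
Proof. by move=> a; apply: hardy_ext => h hH; rewrite !(l2dot_cls, lin)//; rewrite addNr. Qed.
HB.instance Definition _ := GRing.isZmodule.Build hardy haddA haddC hadd0 haddN.

Lemma addhE (a b : hardy) : a + b = cls (hval a + hval b).
Proof. exact: haddE. Qed.

Fact hscaleA a b v : hscale a (hscale b v) = hscale (a * b) v.
Proof. by apply: hardy_ext => h hH; rewrite !(l2dot_cls, lin)//; rewrite mulrA. Qed.
Fact hscale1 : left_id 1 hscale.
Proof. by move=> v; apply: hardy_ext => h hH; rewrite !(l2dot_cls, lin)//; rewrite mul1r. Qed.
Fact hscaleDr : right_distributive hscale +%R.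
Proof. by move=> c v w; apply: hardy_ext => h hH; rewrite !(l2dot_cls, addhE, lin)//; rewrite mulrDr. Qed.
Fact hscaleDl v : {morph hscale^~ v : a b / a + b}.
Proof. by move=> a b; apply: hardy_ext => h hH; rewrite !(l2dot_cls, addhE, lin)//; rewrite mulrDl. Qed.
HB.instance Definition _ := GRing.Zmodule_isLmodule.Build R[i] hardy
  hscaleA hscale1 hscaleDr hscaleDl.

Definition hdot (a b : hardy) : R[i] := l2dot (hval a) (hval b).

Lemma hdot_cls f b : hdot (cls f) b = l2dot f (hval b).
Proof. exact: l2dot_cls. Qed.

Lemma hdot_clsr f b : hdot b (cls f) = l2dot (hval b) f.
Proof. by rewrite /hdot (dotC L2D) l2dot_cls// -(dotC L2D). Qed.

Lemma h_is_dot : is_dot hdot.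
Proof.
split.
- by move=> a b c; rewrite addhE hdot_cls (dotDl L2D).
- by move=> a b c; rewrite [a *: b]hscaleE hdot_cls (dotZl L2D).
- by move=> a b; exact: (dotC L2D).
- by move=> a; exact: (dot_ge0 L2D).
Qed.

Lemma hardy_dot_ext (a b : hardy) : (forall h, hdot a h = hdot b h) -> a = b.
Proof.
move=> ab; apply: hardy_ext => h hH.
have key c : l2dot (hval c) h = hdot c (cls h) by rewrite hdot_clsr.
by rewrite !key ab.
Qed.

Lemma hnsq_eq0 (a : hardy) : nsq hdot a = 0 -> a = 0.
Proof.
move=> a0; apply: hardy_dot_ext => h; rewrite (dot0l h_is_dot).
apply: ComplexField.Normc.eq0_normc; apply/eqP; rewrite -sqrf_eq0 eq_le sqr_ge0 andbT.
by have := cauchy_schwarz h_is_dot a h; rewrite a0 mul0r.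
Qed.

Lemma clsD f g : cls (f + g) = cls f + cls g.
Proof.
by apply: hardy_dot_ext => h; rewrite (dotDl h_is_dot) !hdot_cls (dotDl L2D).
Qed.
Lemma clsZ c f : cls (c *: f) = c *: cls f.
Proof.
by apply: hardy_dot_ext => h; rewrite (dotZl h_is_dot) !hdot_cls (dotZl L2D).
Qed.
Lemma clsN f : cls (- f) = - cls f.
Proof. by rewrite -scaleN1r clsZ scaleN1r. Qed.
Lemma clsB f g : cls (f - g) = cls f - cls g.
Proof. by rewrite clsD clsN. Qed.

Lemma clsK (a : hardy) : cls (hval a) = a.
Proof. by apply: hardy_dot_ext => h; rewrite hdot_cls. Qed.

Lemma nsq_cls_le f : nsq hdot (cls f) <= l2sq f.
Proof.
have eq1 : nsq hdot (cls f) = complex.Re (l2dot f (hval (cls f))).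
  by rewrite /nsq hdot_cls.
have := nsq_ge0 L2D (f - hval (cls f)).
by rewrite (nsqB L2D) -eq1 -[X in _ + X - _]/(nsq hdot (cls f)); lra.
Qed.

Lemma nsq_hval_sub a b : nsq hdot (a - b) = l2sq (hval a - hval b).
Proof. by rewrite (nsqB h_is_dot) (nsqB L2D). Qed.

Lemma hardy_complete x : cauchy_seq_dot hdot x -> exists l, cvg_dot hdot x l.
Proof.
move=> cx; have [|g gP] := @L2_complete R (fun n => hval (x n)).
  move=> eps e0; have [N NP] := cx eps e0; exists N => m n Nm Nn.
  by rewrite -nsq_hval_sub NP.
exists (cls g) => eps e0; have [N NP] := gP eps e0; exists N => n Nn.
rewrite -(clsK (x n)) -clsB; apply: le_trans (nsq_cls_le _) _; exact: NP.
Qed.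

Lemma Hardy_expi n : Hardy (en n).
Proof.
split; first exact: l2P.
move=> k k0; rewrite /fourier expi_orthonormal.
by case: eqP => // e; rewrite -e in k0.
Qed.

Definition hen n : hardy := cls (en n).

Lemma hdot_hen a n : hdot a (hen n) = l2dot (hval a) (en n).
Proof. by rewrite hdot_clsr. Qed.

Lemma hen_orthonormal m n : hdot (hen m) (hen n) = (m == n)%:R.
Proof. by rewrite hdot_clsr l2dot_cls ?en_orthonormal//; exact: Hardy_expi. Qed.

Lemma hardy_partial a : cvg_dot hdot (partial hdot hen a) a.
Proof.
move=> eps e0; have [N NP] := Hardy_partial (hval_Hardy a) e0.
exists N => n Nn; have := NP n Nn.
rewrite (nsq_sub_partial L2D en_orthonormal) (nsq_sub_partial h_is_dot hen_orthonormal).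
rewrite (nsq_partial L2D en_orthonormal) (nsq_partial h_is_dot hen_orthonormal).
by under [X in _ -> _ - X <= _]eq_bigr do rewrite hdot_hen.
Qed.

Lemma hardy_coef_ext a b : (forall n, hdot a (hen n) = hdot b (hen n)) -> a = b.
Proof.
move=> ab; apply/subr0_eq/hnsq_eq0; rewrite nsq_hval_sub.
have ab0 n : l2dot (hval a - hval b) (en n) = 0.
  by rewrite (dotBl L2D) -!hdot_hen ab subrr.
rewrite /nsq (dotBr L2D) !(orthogonal_Hardy ab0)//.
by rewrite subrr.
Qed.

End HardySpace.
#[global] Hint Resolve hval_Hardy : core.

(** * Hankel and Toeplitz operators *)

Section Operators.
Variable R : realType.
Local Notation L2D := (l2_is_dot R).
Local Notation HD := (h_is_dot R).
Local Notation hd := (@hdot R).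
Implicit Types (u x y p g : hardy R) (f : R -> R[i]).

Lemma sq_modulus_conj f t : sq_modulus (fun s => ((f s)^*)%C) t = sq_modulus f t.
Proof. by rewrite !sq_modulusE /re_part /im_part; case: (f t) => a b /=; rewrite sqrrN. Qed.

Lemma bounded_conj C f : bounded_by C f -> bounded_by C (fun t => ((f t)^*)%C).
Proof.
move=> [f2 [N [mN N0 sub]]]; split; first exact: L2_conj.
by exists N; split => // t nt; apply: sub => h; apply: nt => /h; rewrite sq_modulus_conj.
Qed.

Lemma bounded_mul C1 C2 f1 f2 : bounded_by C1 f1 -> bounded_by C2 f2 ->
  bounded_by (C1 * C2) (fun t => f1 t * f2 t).
Proof.
move=> b1 b2; split; first exact: L2M b1 b2.1.
move: b1 b2 => [_ [N1 [mN1 N10 sub1]]] [_ [N2 [mN2 N20 sub2]]].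
exists (N1 `|` N2); split; [exact: measurableU|by rewrite measureU0|].
move=> t /= nt; apply: contrapT => /not_orP[n1 n2]; apply: nt => Dt.
have h1 : sq_modulus f1 t <= C1 ^+ 2.
  by apply: contrapT => h; apply: n1; apply: sub1 => /= /(_ Dt).
have h2 : sq_modulus f2 t <= C2 ^+ 2.
  by apply: contrapT => h; apply: n2; apply: sub2 => /= /(_ Dt).
by rewrite sq_modulusM exprMn ler_pM ?sq_modulus_ge0.
Qed.

Lemma bounded_expi_mul C f n : bounded_by C f -> bounded_by C (fun t => expi n t * f t).
Proof. by move=> /(bounded_mul (bounded_expi R n)); rewrite mul1r. Qed.

Lemma conjM (a b : R[i]) : ((a * b)^*)%C = (a^*)%C * (b^*)%C.
Proof. exact: rmorphM. Qed.

Lemma inner_move f1 f2 f3 : inner (fun t => f1 t * f2 t) f3 =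
  inner f2 (fun t => ((f1 t)^*)%C * f3 t) :> R[i].
Proof.
rewrite /inner; congr cint; apply/funext => t.
by rewrite rmorphM/= conjcK; ring.
Qed.

(** The product of a Hardy function by a bounded Hardy function has no negative
    frequency, because this holds for the partial sums of the Fourier series. *)
Lemma Hardy_mul C f (h : L2fun R) : Hardy f -> bounded_by C f -> Hardy h ->
  Hardy (fun t => f t * h t).
Proof.
move=> fH fC hH; have fh2 := L2M fC (l2P h); split => // n n0.
rewrite /fourier inner_move.
have w2 : L2 (fun t => ((f t)^*)%C * expi n t) := L2M (bounded_conj fC) (L2_expi R n).
rewrite (inner_toL2 (l2P h) w2) toL2K.
apply: (cvg_dot_eventually L2D (N0 := 0) (Hardy_partial hH)) => N _.
rewrite /partial (dot_suml L2D) big1// => k _; rewrite (dotZl L2D).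
rewrite [X in _ * X](_ : _ = fourier f (n - k%:Z)); last first.
  rewrite /l2dot toL2E// -inner_move /fourier /inner; congr cint; apply/funext => t.
  rewrite !expi_conj -mulrA; congr (_ * _); rewrite -[l2val _ t]/(expi k t) -expiD.
  by congr (expi _ t); ring.
by rewrite fH.2 ?mulr0// subr_lt0 (lt_le_trans n0).
Qed.

Lemma Hardy_expi1 (h : L2fun R) : Hardy h -> Hardy (fun t => expi 1 t * h t).
Proof.
move=> hH; apply: (Hardy_mul (C := 1)) => //; last exact: bounded_expi.
exact: (Hardy_expi R 1).
Qed.

(** A product with one bounded factor stays square-integrable: in the identities
    below either the symbol or the argument is bounded. *)
Definition bdd u := exists C, bounded_by C (hval u).

Fact H_fact : {op : hardy R -> hardy R -> hardy R | forall u x, op u x = cls (toL2 (fun t => hval u t * ((hval x t)^*)%C))}.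
Proof. by eexists. Qed.
Definition H := sval H_fact.
Lemma HE u x : H u x = cls (toL2 (fun t => hval u t * ((hval x t)^*)%C)).
Proof. exact: (svalP H_fact). Qed.

Fact K_fact : {op : hardy R -> hardy R -> hardy R | forall u x, op u x = cls (toL2 (fun t => expi (-1) t * (hval u t * ((hval x t)^*)%C)))}.
Proof. by eexists. Qed.
Definition K := sval K_fact.
Lemma KE u x : K u x = cls (toL2 (fun t => expi (-1) t * (hval u t * ((hval x t)^*)%C))).
Proof. exact: (svalP K_fact). Qed.

Fact T_fact : {op : hardy R -> hardy R -> hardy R | forall u x, op u x = cls (toL2 (fun t => (sq_modulus (hval u) t)%:C * hval x t))}.
Proof. by eexists. Qed.
Definition T := sval T_fact.
Lemma TE u x : T u x = cls (toL2 (fun t => (sq_modulus (hval u) t)%:C * hval x t)).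
Proof. exact: (svalP T_fact). Qed.

Fact Sadj_fact : {op : hardy R -> hardy R | forall x, op x = cls (toL2 (fun t => expi (-1) t * hval x t))}.
Proof. by eexists. Qed.
Definition Sadj := sval Sadj_fact.
Lemma SadjE x : Sadj x = cls (toL2 (fun t => expi (-1) t * hval x t)).
Proof. exact: (svalP Sadj_fact). Qed.

Fact M_fact : {op : hardy R -> hardy R -> hardy R | forall x y, op x y = cls (toL2 (fun t => expi 1 t * (hval x t * hval y t)))}.
Proof. by eexists. Qed.
Definition M := sval M_fact.
Lemma ME x y : M x y = cls (toL2 (fun t => expi 1 t * (hval x t * hval y t))).
Proof. exact: (svalP M_fact). Qed.

Definition hone := hen R 0.

Lemma hval_cls_ae (w : L2fun R) : Hardy w -> l2sq (hval (cls w) - w) = 0.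
Proof.
move=> wH; rewrite /nsq (dotBr L2D).
have key (h : L2fun R) : Hardy h -> l2dot (hval (cls w) - w) h = 0.
  by move=> hH; rewrite (dotBl L2D) l2dot_cls ?subrr.
by rewrite !key ?subrr.
Qed.

Lemma l2dot_null (w v h : L2fun R) : l2sq (w - v) = 0 -> l2dot w h = l2dot v h.
Proof.
move=> e; apply/subr0_eq; rewrite -(dotBl L2D); apply: ComplexField.Normc.eq0_normc.
apply/eqP; rewrite -sqrf_eq0 eq_le sqr_ge0 andbT.
by have := cauchy_schwarz L2D (w - v) h; rewrite e mul0r.
Qed.

Lemma bdd_KL2 C f (h : L2fun R) : bounded_by C f ->
  L2 (fun t => expi (-1) t * (f t * ((h t)^*)%C)).
Proof.
move=> fC; apply: (L2M (bounded_expi R (-1))); apply: (L2M fC).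
by apply: L2_conj; exact: l2P.
Qed.

Lemma K_weak u x g : bdd u ->
  hd (K u x) g = inner (fun t => expi (-1) t * (hval u t * ((hval g t)^*)%C)) (hval x).
Proof.
move=> [C uC]; rewrite KE hdot_cls /l2dot toL2E; last exact: (bdd_KL2 _ uC).
by rewrite /inner; congr cint; apply/funext => t; ring.
Qed.

Lemma K_sym u x g : bdd u -> hd (K u x) g = hd (K u g) x.
Proof.
move=> bu; rewrite K_weak// KE hdot_cls /l2dot toL2E//.
by have [C uC] := bu; exact: (bdd_KL2 _ uC).
Qed.

Lemma M_bddE x g : bdd x ->
  Hardy (fun t => expi 1 t * (hval x t * hval g t)).
Proof.
move=> [C xC].
have xg : Hardy (fun t => hval x t * hval g t) by apply: (Hardy_mul _ xC).
exact: (@Hardy_expi1 (MkL2fun xg.1)).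
Qed.

Lemma KL2_bdd u x : bdd x ->
  L2 (fun t => expi (-1) t * (hval u t * ((hval x t)^*)%C)).
Proof.
move=> [C xC]; have := @bdd_KL2 C (fun t => ((hval x t)^*)%C) (MkL2fun (L2_conj (l2P (hval u)))) (bounded_conj xC).
by congr L2; apply/funext => t /=; rewrite conjcK; ring.
Qed.

(** In this form [K u x] depends linearly on [u], and the bound is on [x]: this
    makes sense of [K u'] for a time derivative [u'], which is only in the Hardy
    space. *)
Lemma K_M u x g : bdd x -> hd (K u x) g = hd u (M x g).
Proof.
move=> bx; have mH := M_bddE g bx.
rewrite KE hdot_cls ME hdot_clsr /l2dot !toL2E//; [|exact: mH.1|exact: KL2_bdd].
rewrite /inner; congr cint; apply/funext => t.
by rewrite !conjM expi_conj; ring.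
Qed.

Lemma KDl u v x : bdd x -> K (u + v) x = K u x + K v x.
Proof.
by move=> bx; apply: hardy_dot_ext => g; rewrite (dotDl HD) !K_M// (dotDl HD).
Qed.

Lemma KZl c u x : bdd x -> K (c *: u) x = c *: K u x.
Proof.
by move=> bx; apply: hardy_dot_ext => g; rewrite (dotZl HD) !K_M// (dotZl HD).
Qed.

Lemma KBl u v x : bdd x -> K (u - v) x = K u x - K v x.
Proof. by move=> bx; rewrite KDl// -[- v]scaleN1r KZl// scaleN1r. Qed.

Lemma KDr u x y : bdd u -> K u (x + y) = K u x + K u y.
Proof.
move=> bu; apply: hardy_dot_ext => g.
by rewrite (dotDl HD) !(K_sym _ g bu) (dotDr HD).
Qed.

Lemma KZr c u x : bdd u -> K u (c *: x) = (c^*)%C *: K u x.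
Proof.
move=> bu; apply: hardy_dot_ext => g.
by rewrite (dotZl HD) !(K_sym _ g bu) (dotZr HD).
Qed.

Lemma KBr u x y : bdd u -> K u (x - y) = K u x - K u y.
Proof.
by move=> bu; rewrite KDr// -[- y]scaleN1r KZr// rmorphN1 scaleN1r.
Qed.

Lemma l2sq_conj (h : L2fun R) : l2sq (toL2 (fun t => ((h t)^*)%C)) = l2sq h.
Proof.
rewrite !l2sqE toL2E; last by apply: L2_conj; exact: l2P.
by congr (_ * _); apply: eq_Rintegral => t _; rewrite sq_modulus_conj.
Qed.

Lemma K_le_bounded C u x : 0 <= C -> bounded_by C (hval u) ->
  nrm hd (K u x) <= C * nrm hd x.
Proof.
move=> C0 uC; apply: (nrm_le HD) => //; first by rewrite mulr_ge0// nrm_ge0.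
rewrite exprMn (nrm_sq HD) KE; apply: le_trans (nsq_cls_le _) _.
have eC := bounded_expi_mul (-1) uC.
have := l2sqM (toL2 (fun t => ((hval x t)^*)%C)) eC; rewrite l2sq_conj.
rewrite toL2E; last by apply: L2_conj; exact: l2P.
by under eq_fun do rewrite -mulrA.
Qed.

Lemma K_le_boundedr C u x : 0 <= C -> bounded_by C (hval x) ->
  nrm hd (K u x) <= C * nrm hd u.
Proof.
move=> C0 xC; apply: (nrm_le HD) => //; first by rewrite mulr_ge0// nrm_ge0.
rewrite exprMn (nrm_sq HD) KE; apply: le_trans (nsq_cls_le _) _.
have eC := bounded_expi_mul (-1) (bounded_conj xC).
have := l2sqM (hval u) eC.
rewrite (_ : (fun t => _) = fun t => expi (-1) t * (hval u t * ((hval x t)^*)%C))//.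
by apply/funext => t; ring.
Qed.

End Operators.

(** * Identities between the operators *)

Section Lax.
Variable R : realType.
Local Notation L2D := (l2_is_dot R).
Local Notation HD := (h_is_dot R).
Local Notation hd := (@hdot R).
Implicit Types (u x y p g : hardy R).
Local Notation hone := (hone R).

Lemma bounded_sq C u : bounded_by C (hval u) ->
  bounded_by (C * C) (fun t => (sq_modulus (hval u) t)%:C).
Proof.
move=> uC; have := bounded_mul uC (bounded_conj uC); congr (bounded_by _).
by apply/funext => t; rewrite /sq_modulus; exact: mul_conj.
Qed.

Lemma sq_modulus_mul f t : (sq_modulus f t)%:C = f t * ((f t)^*)%C :> R[i].
Proof. by rewrite mul_conj. Qed.

Lemma T_L2 C u (h : L2fun R) : bounded_by C (hval u) ->
  L2 (fun t => (sq_modulus (hval u) t)%:C * h t).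
Proof. by move=> /bounded_sq uC; exact: L2M uC (l2P h). Qed.

Lemma T_weak u x (h : L2fun R) : bdd u -> Hardy h ->
  l2dot (hval (T u x)) h = inner (fun t => (sq_modulus (hval u) t)%:C * hval x t) h.
Proof.
move=> [C uC] hH; rewrite TE l2dot_cls// /l2dot toL2E//; exact: T_L2 uC.
Qed.

Lemma T_sym u x y : bdd u -> hd (T u x) y = hd x (T u y).
Proof.
move=> bu; rewrite (dotC HD (T u y)) /hdot !T_weak//.
have [C uC] := bu; rewrite /inner -cint_conj; last first.
  by apply: inner_integr; [exact: T_L2 uC|exact: l2P].
congr cint; apply/funext => t; rewrite !conjM conjcK !sq_modulus_mul.
by rewrite !conjM conjcK; ring.
Qed.

Lemma K_cls u (w : L2fun R) g : bdd u -> Hardy w ->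
  hd (K u (cls w)) g = inner (fun t => expi (-1) t * (hval u t * ((hval g t)^*)%C)) w.
Proof.
move=> [C uC] wH.
rewrite K_sym; last by exists C.
rewrite hdot_clsr KE l2dot_cls// /l2dot toL2E//; exact: (bdd_KL2 _ uC).
Qed.

(** Write [F] for the function [expi (-1) * u * conj h], whose projection is
    [K u h]. The antiholomorphic part of [F] is the conjugate of [expi 1 * q], with [q]
    in the Hardy space, and [u * q] is again in the Hardy space. *)
Lemma lax_identity u h : bdd u -> bdd h ->
  K (T u u) h = T u (K u h) + K u (T u h) - K u (K u (K u h)).
Proof.
move=> bu bh; have [C uC] := bu; have [C' hC] := bh.
pose p := K u h.
pose F := fun t => expi (-1) t * (hval u t * ((hval h t)^*)%C).
have F2 : L2 F := bdd_KL2 _ uC.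
have Fp2 : L2 (fun t => F t - hval p t) by apply: L2B => //; exact: l2P.
pose q := fun t => expi (-1) t * ((F t - hval p t)^*)%C.
have q2 : L2 q := L2M (bounded_expi R (-1)) (L2_conj Fp2).
have qH : Hardy q.
  split => // n n0.
  rewrite /fourier (_ : inner q _ = ((inner (fun t => F t - hval p t) (expi (- n - 1)))^*)%C); last first.
    rewrite /inner -cint_conj; last by apply: inner_integr => //; exact: L2_expi.
    congr cint; apply/funext => t.
    by rewrite /q !conjM conjcK !expi_conj mulrAC -expiD mulrC; congr (_ * expi _ _); ring.
  have : 0 <= - n - 1 by rewrite subr_ge0 -gtz0_ge1 oppr_gt0.
  case: (- n - 1) => // k _.
  rewrite (inner_toL2 Fp2 (L2_expi R k)) toL2B//; last exact: l2P.
  rewrite toL2K (dotBl L2D) (_ : toL2 (expi k) = en R k); last first.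
    by apply: L2fun_ext => t; rewrite toL2E//; exact: L2_expi.
  by rewrite /p KE l2dot_cls ?subrr ?rmorph0//; exact: Hardy_expi.
pose w := toL2 (fun t => hval u t * q t).
have uqH : Hardy (fun t => hval u t * q t).
  by apply: (@Hardy_mul _ C _ (MkL2fun q2)).
have wH : Hardy w by rewrite toL2E//; exact: uqH.1.
have wE : cls w = T u h - K u p.
  rewrite TE KE -clsB -toL2B; [|exact: T_L2 uC|exact: bdd_KL2 _ uC].
  congr (cls (toL2 _)); apply/funext => t.
  rewrite /q /F sq_modulus_mul rmorphB/= !conjM expi_conj opprK conjcK.
  rewrite mulrBr mulrBr; congr (_ - _); last by ring.
  transitivity ((expi (-1) t * expi 1 t) * (hval u t * ((hval u t)^*)%C * hval h t)).
    by ring.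
  by rewrite -expiD addNr expi0 mul1r.
have -> : T u (K u h) + K u (T u h) - K u (K u (K u h)) = T u p + K u (cls w).
  by rewrite wE (KBr _ _ bu) addrA.
apply: hardy_dot_ext => g.
rewrite (dotDl HD).
rewrite (K_M _ g bh).
rewrite (K_cls g bu wH).
rewrite ME hdot_clsr T_weak//; last by rewrite toL2E; have := M_bddE g bh => // -[].
rewrite /hdot T_weak//.
have mH := M_bddE g bh.
rewrite toL2E; last exact: mH.1.
rewrite toL2E; last exact: uqH.1.
rewrite /inner -cintD; last 2 first.
- by apply: inner_integr; [exact: T_L2 uC|exact: l2P].
- by apply: inner_integr; [exact: bdd_KL2 _ uC|exact: uqH.1].
congr cint; apply/funext => t; rewrite -/p /q sq_modulus_mul.
rewrite !conjM !expi_conj opprK conjcK /F.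
have e1 : expi (-1) t * expi 1 t = 1 :> R[i] by rewrite -expiD addNr expi0.
transitivity ((hval u t * ((hval u t)^*)%C * hval p t) * ((hval g t)^*)%C +
  (expi (-1) t * expi 1 t) * (hval u t * ((hval u t)^*)%C * ((hval g t)^*)%C *
   (expi (-1) t * (hval u t * ((hval h t)^*)%C) - hval p t))); last by ring.
by rewrite e1; ring.
Qed.

(** The shift after the backward shift is the identity minus the projection on
    the constants. *)
Lemma shift_Sadj x : l2sq (toL2 (fun t => expi 1 t * hval (Sadj x) t) -
  (hval x - hval (hd x hone *: hone))) = 0.
Proof.
set c := hd x hone.
have shH : Hardy (toL2 (fun t => expi 1 t * hval (Sadj x) t)).
  have h := Hardy_expi1 (hval_Hardy (Sadj x)); rewrite toL2E//; exact: h.1.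
have sh2 := L2M (bounded_expi R 1) (l2P (hval (Sadj x))).
set w := _ - _.
have wn n : l2dot w (en R n) = 0.
  rewrite /w !(dotBl L2D).
  rewrite -[X in _ - (_ - X)]hdot_hen (dotZl HD) /hone hen_orthonormal.
  case: n => [|n].
    rewrite eqxx mulr1 /c /hone hdot_hen subrr subr0.
    rewrite /l2dot toL2E// inner_move.
    have -> : (fun t => ((expi 1 t)^*)%C * en R 0 t) = expi (-1) :> (R -> R[i]).
      by apply/funext => t; rewrite expi_conj -[l2val _ t]/(expi 0 t) -expiD addr0.
    by have [_ neg] := hval_Hardy (Sadj x); exact: neg.
  rewrite mulr0 subr0.
  rewrite {1}/l2dot toL2E// inner_move.
  have -> : (fun t => ((expi 1 t)^*)%C * en R n.+1 t) = en R n.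
    apply/funext => t; rewrite expi_conj -[l2val _ t]/(expi n.+1%:Z t) -expiD.
    by congr (expi _ t); rewrite -addn1 PoszD; ring.
  rewrite -/(l2dot _ _) SadjE l2dot_cls; last exact: Hardy_expi.
  rewrite {1}/l2dot toL2E; last exact: L2M (bounded_expi R (-1)) (l2P _).
  rewrite inner_move.
  have -> : (fun t => ((expi (-1) t)^*)%C * en R n t) = en R n.+1.
    apply/funext => t; rewrite expi_conj -[l2val _ t]/(expi n%:Z t) -expiD.
    by congr (expi _ t); rewrite -addn1 PoszD opprK addrC.
  by rewrite subrr.
have ortho := orthogonal_Hardy wn.
by rewrite {1}/nsq {2}/w !(dotBr L2D) !ortho// !subrr.
Qed.

Lemma hval_one : l2sq (hval hone - toL2 (fun=> 1)) = 0.
Proof.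
have -> : toL2 (fun=> 1) = en R 0.
  apply: L2fun_ext => t; rewrite toL2E; last exact: L2_cst.
  by rewrite -[RHS]/(expi 0 t) expi0.
by apply: hval_cls_ae; exact: Hardy_expi.
Qed.

Lemma H_L2 C u (x : L2fun R) : bounded_by C (hval u) ->
  L2 (fun t => hval u t * ((x t)^*)%C).
Proof. by move=> uC; apply: (L2M uC); apply: L2_conj; exact: l2P. Qed.

Lemma H_weak u x g : bdd u ->
  hd (H u x) g = inner (fun t => hval u t * ((hval g t)^*)%C) (hval x).
Proof.
move=> [C uC]; rewrite HE hdot_cls /l2dot toL2E; last exact: H_L2 uC.
by rewrite /inner; congr cint; apply/funext => t; ring.
Qed.

Lemma H_sym u x g : bdd u -> hd (H u x) g = hd (H u g) x.
Proof.
move=> bu; rewrite H_weak// HE hdot_cls /l2dot toL2E//.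
by have [C uC] := bu; exact: H_L2 uC.
Qed.

Lemma K_Sadj_H u x : bdd u -> K u x = Sadj (H u x).
Proof.
move=> [C uC]; apply: hardy_dot_ext => g; rewrite SadjE hdot_cls.
have sh2 := L2M (bounded_expi R (-1)) (l2P (hval (H u x))).
rewrite [RHS]/l2dot toL2E// inner_move.
have eg : (fun t => ((expi (-1) t)^*)%C * hval g t) = fun t => expi 1 t * hval g t.
  by apply/funext => t; rewrite expi_conj opprK.
rewrite eg; have gH := Hardy_expi1 (hval_Hardy g).
have := @l2dot_cls R (toL2 (fun t => hval u t * ((hval x t)^*)%C)) (MkL2fun gH.1) gH.
rewrite /l2dot toL2E /=; last exact: H_L2 uC.
rewrite HE => ->; rewrite KE hdot_cls /l2dot toL2E; last exact: bdd_KL2 _ uC.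
by rewrite inner_move -eg; congr inner.
Qed.

Lemma H_one u : bdd u -> H u hone = u.
Proof.
move=> bu; apply: hardy_dot_ext => g; rewrite H_weak//.
have [C uC] := bu.
have := l2dot_null (toL2 (fun t => hval u t * ((hval g t)^*)%C)) hval_one.
move=> /(congr1 (fun z => (z^*)%C)); rewrite -!(dotC L2D) {1}/l2dot toL2E; last exact: H_L2 uC.
move=> ->; rewrite /hdot /l2dot !toL2E; [|exact: L2_cst|exact: H_L2 uC].
by rewrite /inner; congr cint; apply/funext => t; rewrite conjc1 mulr1.
Qed.

(** [K u] is the backward shift after [H u], and by symmetry also [H u] after the
    shift; the rank-one term comes from [shift_Sadj]. *)
Lemma K2_H2 u x : bdd u -> K u (K u x) = H u (H u x) - hd x u *: u.
Proof.
move=> bu; have [C uC] := bu; apply: hardy_dot_ext => g.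
rewrite (dotBl HD) (dotZl HD) [X in K u X]K_Sadj_H//.
set y := H u x; rewrite K_weak// H_weak//.
have ug2 := H_L2 (hval g) uC.
have sh2 := L2M (bounded_expi R 1) (l2P (hval (Sadj y))).
rewrite (_ : inner _ _ = l2dot (toL2 (fun t => hval u t * ((hval g t)^*)%C))
    (toL2 (fun t => expi 1 t * hval (Sadj y) t))); last first.
  rewrite /l2dot (toL2E ug2) (toL2E sh2) /inner; congr cint; apply/funext => t.
  by rewrite !conjM expi_conj; ring.
have := l2dot_null (toL2 (fun t => hval u t * ((hval g t)^*)%C)) (shift_Sadj y).
move=> /(congr1 (fun z => (z^*)%C)); rewrite -!(dotC L2D) => ->.
rewrite (dotBr L2D); congr (_ - _); first by rewrite /l2dot toL2E.
rewrite {1}/l2dot toL2E// -H_weak// (H_sym _ _ bu) (dotC HD) (dotZl HD) conjM.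
rewrite -!(dotC HD) (H_sym _ _ bu) H_one//.
by rewrite (dotC HD y hone) /y (H_sym _ _ bu) H_one// -(dotC HD).
Qed.

Lemma T_one u : bdd u -> T u hone = K u (K u hone) + hd hone u *: u.
Proof.
move=> bu; rewrite K2_H2// H_one// subrK.
have [C uC] := bu; apply: hardy_dot_ext => g; rewrite T_sym// (dotC HD (T u g)).
rewrite H_weak// hdot_hen /hdot T_weak//; last exact: Hardy_expi.
rewrite /inner -cint_conj; last first.
  by apply: inner_integr; [exact: T_L2 uC|exact: l2P].
congr cint; apply/funext => t; rewrite sq_modulus_mul -[l2val (en R 0) t]/(expi 0 t) expi0.
by rewrite conjc1 mulr1 !conjM conjcK; ring.
Qed.

End Lax.

(** * Functions with summable Fourier coefficients *)

Arguments ComplexField.Normc.normc : simpl never.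
Arguments expi : simpl never.
Arguments hdot : simpl never.
Arguments l2dot : simpl never.

Section Wiener.
Variable R : realType.
Local Notation mu := (@lebesgue_measure R).
Local Notation D := (@circle R).
Local Notation normc := ComplexField.Normc.normc.
Local Notation L2D := (l2_is_dot R).
Local Notation HD := (h_is_dot R).
Local Notation hd := (@hdot R).
Local Notation hen := (hen R).
Implicit Types (u x y : hardy R).

Definition wiener x (C : R) := forall N, \sum_(n < N) normc (hd x (hen n)) <= C.

Lemma wiener_ge0 x C : wiener x C -> 0 <= C.
Proof. by move/(_ 0%N); rewrite big_ord0. Qed.

Lemma normc_triangle (a b : R[i]) : normc (a + b) <= normc a + normc b.
Proof. exact: le_normcD. Qed.

Lemma normc_conj (a : R[i]) : normc (a^*%C) = normc a.
Proof. by case: a => a b; rewrite /ComplexField.Normc.normc /= sqrrN. Qed.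

Lemma normc_sum I (r : seq I) (P : pred I) (F : I -> R[i]) :
  normc (\sum_(i <- r | P i) F i) <= \sum_(i <- r | P i) normc (F i).
Proof.
elim/big_rec2: _ => [|i y z _ le]; first by rewrite ComplexField.Normc.normc0.
by apply: le_trans (normc_triangle _ _) _; rewrite lerD2l.
Qed.

Lemma wienerD x y C C' : wiener x C -> wiener y C' -> wiener (x + y) (C + C').
Proof.
move=> wx wy N; apply: le_trans (lerD (wx N) (wy N)); rewrite -big_split/=.
by apply: ler_sum => n _; rewrite (dotDl HD) normc_triangle.
Qed.

Lemma normc_expi n t : normc (@expi R n t) = 1.
Proof. by rewrite /ComplexField.Normc.normc /expi cos2Dsin2 sqrtr1. Qed.

Lemma l2val_sum (I : Type) (r : seq I) (F : I -> L2fun R) t :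
  l2val (\sum_(i <- r) F i) t = \sum_(i <- r) l2val (F i) t.
Proof. exact: (big_morph (fun f : L2fun R => l2val f t)). Qed.

Lemma partial_le x C N t : wiener x C ->
  normc (partial (@l2dot R) (en R) (hval x) N t) <= C.
Proof.
move=> wx; rewrite /partial l2val_sum; apply: le_trans (normc_sum _ _ _) _.
apply: le_trans (wx N); apply: ler_sum => n _ /=.
by rewrite ComplexField.Normc.normcM normc_expi mulr1 hdot_hen.
Qed.

Lemma normc_meas f : L2 f -> measurable_fun D (fun t => normc (f t) : R).
Proof.
move=> [mr mi _]; have ms := meas_sq_modulus mr mi.
rewrite (_ : (fun t => _) = Num.sqrt \o sq_modulus f).
  apply: measurableT_comp => //; apply: continuous_measurable_fun.
  exact: sqrt_continuous.
by apply/funext => t /=; rewrite /sq_modulus sqrtr_sqr ger0_norm// normc_ge0.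
Qed.

(** A function whose Fourier coefficients are summable is bounded: the part of
    [|x|] above [C] is at most the distance to any partial sum, which is bounded
    by [C] everywhere. *)
Lemma wiener_bounded x C : wiener x C -> bounded_by C (hval x).
Proof.
move=> wx; have C0 := wiener_ge0 wx; split; first exact: l2P.
pose m t := (Num.max (normc (hval x t) - C) 0) ^+ 2.
have m0 t : 0 <= m t by exact: sqr_ge0.
have mm : measurable_fun D m.
  apply: measurable_funX; apply: measurable_maxr; last exact: measurable_cst.
  by apply: measurable_funB; [apply: normc_meas; exact: l2P|exact: measurable_cst].
have le_m N t : m t <= sq_modulus (hval x - partial (@l2dot R) (en R) (hval x) N) t.
  rewrite /m /sq_modulus; set P := partial _ _ _ _.
  have := normc_triangle (hval x t - P t) (P t); rewrite subrK => h.
  have hP : normc (P t) <= C := partial_le N t wx.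
  have d0 : 0 <= normc (hval x t - P t) := normc_ge0 _.
  apply: lerXn2r; rewrite ?nnegrE ?le_max ?lexx ?orbT//.
  by rewrite ge_max d0 andbT; lra.
have int0 : (\int[mu]_(t in D) (m t)%:E = 0)%E.
  apply/eqP; rewrite eq_le integral_ge0 ?andbT; last by move=> t _; rewrite lee_fin.
  apply/lee_addgt0Pr => e e0; rewrite add0e.
  have [N NP] := Hardy_partial (hval_Hardy x) (divr_gt0 e0 (twopi_gt0 R)).
  have := NP N (leqnn N); rewrite ler_pdivlMr ?twopi_gt0// mulrC => le_e.
  apply: (@le_trans _ _ (\int[mu]_(t in D)
      (sq_modulus (hval x - partial (@l2dot R) (en R) (hval x) N) t)%:E)%E).
    apply: ge0_le_integral => //.
    - by move=> t _; rewrite lee_fin.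
    - exact/measurable_EFinP.
    - apply/measurable_EFinP; have [mr mi _] := l2P (hval x - partial (@l2dot R) (en R) (hval x) N).
      exact: meas_sq_modulus.
    - by move=> t _; rewrite lee_fin.
  by rewrite l2sq_integral lee_fin.
have : ae_eq mu D (EFin \o m) (cst 0%E).
  have [+ _] := @ae_eq_integral_abs _ _ R mu D (@measurable_circle R) (EFin \o m) ltac:(exact/measurable_EFinP).
  by apply; rewrite -int0; apply: eq_integral => t _; rewrite /= ger0_norm.
case=> N [mN N0 sub]; exists N; split => // t nt; apply: sub => /= h; apply: nt => Dt.
have [/eqP] := h Dt; rewrite expf_eq0/= => /eqP mx.
rewrite /sq_modulus lerXn2r ?nnegrE ?normc_ge0//.
have : normc (hval x t) - C <= 0 by rewrite -mx le_max lexx.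
by rewrite subr_le0.
Qed.

Lemma wiener_bdd x C : wiener x C -> bdd x.
Proof. by move=> wx; exists C; exact: wiener_bounded. Qed.

Lemma K_cls2 u (w v : L2fun R) : bdd u -> Hardy w -> Hardy v ->
  hd (K u (cls w)) (cls v) = inner (fun t => expi (-1) t * (hval u t * ((v t)^*)%C)) w.
Proof.
move=> bu wH vH; have [C uC] := bu; rewrite K_cls//.
have k2 := bdd_KL2 w uC.
transitivity (l2dot (toL2 (fun t => expi (-1) t * (hval u t * ((w t)^*)%C))) (hval (cls v))).
  by rewrite /l2dot toL2E// /inner; congr cint; apply/funext => t; ring.
rewrite (dotC L2D) (l2dot_null _ (hval_cls_ae vH)) -(dotC L2D) /l2dot toL2E//.
by rewrite /inner; congr cint; apply/funext => t; ring.
Qed.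

Lemma K_basis u m n : bdd u -> hd (K u (hen m)) (hen n) = hd u (hen (n + m + 1)).
Proof.
move=> bu; rewrite K_cls2 ?hdot_hen//; try exact: Hardy_expi.
rewrite /l2dot /inner; congr cint; apply/funext => t.
rewrite -[l2val (en R n) t]/(expi n t) -[l2val (en R m) t]/(expi m t).
rewrite -[l2val (en R (n + m + 1)) t]/(expi (n + m + 1)%N t) !expi_conj.
transitivity (hval u t * (expi (-1) t * expi (- n%:Z) t * expi (- m%:Z) t)); first by ring.
by rewrite -!expiD; congr (_ * expi _ t); rewrite !PoszD; ring.
Qed.

(** The matrix of [K u] in the basis [hen] is the Hankel matrix of the
    coefficients of [u]: the sum of its entries against those of [x] is at most
    the product of the two sums. *)
Lemma wienerK u x C C' : wiener u C -> wiener x C' -> wiener (K u x) (C * C').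
Proof.
move=> wu wx; have bu := wiener_bdd wu; have C0 := wiener_ge0 wu.
move=> N.
have fin M : \sum_(n < N) normc (hd (K u (partial hd hen x M)) (hen n)) <= C * C'.
  apply: (@le_trans _ _ (\sum_(n < N) \sum_(m < M)
      normc (hd x (hen m)) * normc (hd u (hen (n + m + 1))))).
    apply: ler_sum => n _; rewrite (K_sym _ _ bu) /partial (dot_sumr HD).
    apply: le_trans (normc_sum _ _ _) _; apply: ler_sum => m _.
    rewrite (dotZr HD) (K_basis n m bu) (ComplexField.Normc.normcM (_^*%C)).
    by rewrite normc_conj [in (n + m)%N]addnC.
  rewrite exchange_big/= mulrC; apply: le_trans (ler_wpM2r C0 (wx M)).
  rewrite mulr_suml; apply: ler_sum => m _; rewrite -mulr_sumr ler_wpM2l ?normc_ge0//.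
  apply: le_trans (wu (m.+1 + N)); rewrite big_split_ord/=.
  rewrite -[leLHS]add0r; apply: lerD; first by apply: sumr_ge0 => i _; exact: normc_ge0.
  by apply: ler_sum => n _; rewrite addn1 addSn addnC.
apply/ler_addgt0Pr => e e0.
have B0 : 0 < N%:R * C + 1 by rewrite ltr_wpDl// mulr_ge0.
have [M MP] := cvg_dot_nsq HD (hardy_partial x) (divr_gt0 e0 B0).
have {}MP := MP M (leqnn M).
set P := partial _ _ _ _ in MP.
apply: (@le_trans _ _ (\sum_(n < N) (normc (hd (K u P) (hen n)) + C * nrm hd (x - P)))).
  apply: ler_sum => n _; rewrite -{1}(subrK P x) (KDr _ _ bu) (dotDl HD) addrC.
  apply: le_trans (normc_triangle _ _) _; rewrite lerD2l.
  apply: le_trans (dot_le HD _ _) _.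
  have -> : nrm hd (hen n) = 1 by rewrite /nrm /nsq hen_orthonormal eqxx sqrtr1.
  rewrite mulr1; apply: K_le_bounded => //; exact: wiener_bounded.
rewrite big_split/= sumr_const card_ord -[X in _ + X]mulr_natl mulrA.
apply: lerD; first exact: fin.
apply: le_trans (ler_wpM2l _ MP) _; first by rewrite mulr_ge0.
rewrite mulrA ler_pdivrMr// mulrC ler_wpM2l ?ltW//; lra.
Qed.

Lemma wiener_one : wiener (hone R) 1.
Proof.
move=> N; case: N => [|N]; first by rewrite big_ord0.
rewrite big_ord_recl /hone hen_orthonormal eqxx big1 ?addr0.
  by rewrite ComplexField.Normc.normc1.
by move=> i _; rewrite hen_orthonormal /= ComplexField.Normc.normc0.
Qed.

End Wiener.

(** * Sobolev regularity above one half *)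

Section Sobolev.
Variable R : realType.
Local Notation normc := ComplexField.Normc.normc.
Local Notation L2D := (l2_is_dot R).
Local Notation hd := (@hdot R).

Definition weight (s : R) (n : nat) : R := (1 + n%:R ^+ 2) `^ s.

Lemma weight_gt0 s n : 0 < weight s n.
Proof. by rewrite powR_gt0// ltr_pwDl// sqr_ge0. Qed.

(** Dyadic blocks: the [2 ^ j] terms with [2 ^ j <= n < 2 ^ j.+1] add up to at
    most the [j]-th power of [2 / 4 `^ s], which is less than 1. *)
Lemma weight_summable s : 2^-1 < s ->
  exists A, 0 <= A /\ forall N, \sum_(n < N) (weight s n)^-1 <= A.
Proof.
move=> s2; have s0 : 0 < s by apply: lt_trans s2; rewrite invr_gt0.
pose q : R := 4 `^ s.
have q2 : 2 < q.
  have h : (4 : R) `^ (2^-1) = 2.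
    rewrite powR12_sqrt// (_ : 4 = 2 ^+ 2 :> R) ?sqrtr_sqr ?ger0_norm//.
    by rewrite -natrX.
  by rewrite -h /q /powR gt_eqF// ltr_expR ltr_pM2r// ln_gt0// ltr1n.
pose r := 2 / q.
have r0 : 0 < r by rewrite divr_gt0//; lra.
have r1 : r < 1 by rewrite ltr_pdivrMr; lra.
have pw j : (4 ^+ j : R) `^ s = q ^+ j.
  elim: j => [|j ih]; first by rewrite !expr0 powR1.
  by rewrite !exprS powRM ?exprn_ge0// ih.
have block j n : (2 ^ j <= n)%N -> (weight s n)^-1 <= (q ^+ j)^-1.
  move=> jn; rewrite lef_pV2 ?posrE ?weight_gt0// -?pw ?powR_gt0 ?exprn_gt0//.
  apply: (ge0_ler_powR (ltW s0)); rewrite ?nnegrE ?exprn_ge0 ?addr_ge0 ?sqr_ge0//.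
  rewrite (_ : 4 = 2 ^+ 2 :> R); last by rewrite -natrX.
  rewrite exprAC; apply: (@le_trans _ _ (n%:R ^+ 2)); last by rewrite lerDr.
  by rewrite lerXn2r ?nnegrE ?exprn_ge0// -natrX ler_nat.
have dyadic k : \sum_(n < 2 ^ k) (weight s n)^-1 <= 1 + (1 - r ^+ k) / (1 - r).
  elim: k => [|k ih].
    rewrite expr0 subrr mul0r addr0 expn0 big_ord1 invf_le1 ?weight_gt0//.
    by rewrite /weight expr0n addr0 powR1.
  rewrite expnS mul2n -addnn big_split_ord/=.
  have : \sum_(i < 2 ^ k) (weight s (2 ^ k + i))^-1 <= r ^+ k.
    apply: (@le_trans _ _ (\sum_(i < 2 ^ k) (q ^+ k)^-1)).
      by apply: ler_sum => i _; apply: block; exact: leq_addr.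
    by rewrite sumr_const card_ord -mulr_natl natrX -exprVn -exprMn.
  move=> h; apply: le_trans (lerD ih h) _.
  rewrite le_eqVlt; apply/orP; left; apply/eqP; rewrite exprS; field.
  by rewrite subr_eq0 gt_eqF.
exists (1 + (1 - r)^-1); split.
  by rewrite addr_ge0// invr_ge0 subr_ge0 ltW.
move=> N; apply: (@le_trans _ _ (\sum_(n < 2 ^ N) (weight s n)^-1)).
  have NN : (N <= 2 ^ N)%N by apply/ltnW; exact: ltn_expl.
  rewrite -(subnKC NN) big_split_ord/= lerDl sumr_ge0// => i _.
  by rewrite invr_ge0 ltW// weight_gt0.
apply: le_trans (dyadic N) _; rewrite lerD2l -[leRHS]mul1r.
by rewrite ler_wpM2r ?invr_ge0 ?subr_ge0 ?(ltW r1)// gerBl exprn_ge0// ltW.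
Qed.

Lemma Hs_term_ge0 s f (n : int) :
  (0 <= ((1 + n%:~R ^+ 2) `^ s * normc (@fourier R f n) ^+ 2)%:E)%E.
Proof. by rewrite lee_fin mulr_ge0 ?powR_ge0 ?sqr_ge0. Qed.

Lemma Hs_norm_sum s f N : (Hs_sqnorm s f < +oo)%E ->
  \sum_(n < N) weight s n * normc (@fourier R f n%:Z) ^+ 2 <= Hs_norm s f ^+ 2.
Proof.
move=> foo.
pose a (n : int) : \bar R := ((1 + n%:~R ^+ 2) `^ s * normc (fourier f n) ^+ 2)%:E.
have a0 n : (0 <= a n)%E by exact: Hs_term_ge0.
have fin : Hs_sqnorm s f \is a fin_num.
  by rewrite ge0_fin_numE// esum_ge0// => n _; exact: a0.
rewrite /Hs_norm sqr_sqrtr; last by rewrite fine_ge0// esum_ge0// => n _; exact: a0.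
rewrite -lee_fin fineK// -sumEFin.
have : (\sum_(n <oo) a n%:Z <= Hs_sqnorm s f)%E.
  rewrite nneseries_esumT; last by move=> n; exact: a0.
  rewrite -(@esum_image _ _ _ [set: nat] Posz a); last by move=> m n _ _ [].
  rewrite /Hs_sqnorm esum_mkcond; apply: le_esum => n _.
  by case: ifP => // _; exact: a0.
apply: le_trans; have := @nneseries_lim_ge R (fun n => a n%:Z) xpredT 0%N N (fun n _ _ => a0 n).
by rewrite big_mkord.
Qed.

Lemma Hs_sqnormB s (f g : L2fun R) : (Hs_sqnorm s f < +oo)%E -> (Hs_sqnorm s g < +oo)%E ->
  (Hs_sqnorm s (fun x => (f x - g x)%R) < +oo)%E.
Proof.
move=> fs gs.
apply: (@le_lt_trans _ _ ((Hs_sqnorm s f + Hs_sqnorm s f) + (Hs_sqnorm s g + Hs_sqnorm s g))%E).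
  rewrite /Hs_sqnorm -!esumD; try (by move=> *; rewrite ?adde_ge0//; exact: Hs_term_ge0).
  apply: le_esum => n _; rewrite -!EFinD lee_fin.
  have -> : fourier (fun x => f x - g x) n = fourier f n - fourier g n.
    exact: (dotBl L2D f g (MkL2fun (L2_expi R n))).
  rewrite -!(mulrDr (_ `^ s)) ler_wpM2l ?powR_ge0//.
  rewrite !normc_sq; case: (fourier f n) (fourier g n) => a b [c d] /=.
  by have := sqr_ge0 (a + c); have := sqr_ge0 (b + d); nra.
by apply: lte_add_pinfty; exact: lte_add_pinfty.
Qed.

(** The Cauchy-Schwarz inequality for the sums of [weight s n ^ -1] and
    [weight s n * a ^ 2], in the form [a <= l / w + w * a ^ 2 / l]; the number [l]
    is slightly larger than the norm, which may be zero. *)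
Lemma Hs_wiener s : 2^-1 < s -> exists c, 0 <= c /\ forall f : L2fun R, Hardy f ->
  (Hs_sqnorm s f < +oo)%E -> wiener (cls f) (c * Hs_norm s f).
Proof.
move=> /weight_summable[A [A0 AP]]; exists (A + 1); split; first by rewrite addr_ge0.
move=> f fH foo N; set b := Hs_norm s f.
have b0 : 0 <= b by exact: sqrtr_ge0.
have key (l : R) : 0 < l -> b <= l ->
    \sum_(n < N) normc (hd (cls f) (hen R n)) <= (A + 1) * l.
  move=> l0 bl.
  apply: (@le_trans _ _ (\sum_(n < N) (l * (weight s n)^-1 +
      l^-1 * (weight s n * normc (fourier f n%:Z) ^+ 2)))).
    apply: ler_sum => n _; rewrite hdot_clsr l2dot_cls; last exact: Hardy_expi.
    rewrite -/(fourier f n); set a := normc _; set w := weight s n.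
    have w0 : 0 < w := weight_gt0 s n.
    have a0 : 0 <= a := normc_ge0 _.
    have E : l / w + l^-1 * (w * a ^+ 2) - a = (l / w) * ((1 - a * w / (2 * l)) ^+ 2 + 3 / 4 * (a * w / l) ^+ 2).
      by field; rewrite !gt_eqF.
    rewrite -subr_ge0 E; apply: mulr_ge0; first by rewrite divr_ge0 ?ltW.
    by rewrite addr_ge0 ?sqr_ge0// mulr_ge0 ?sqr_ge0// divr_ge0.
  rewrite big_split/= -!mulr_sumr.
  have h1 := ler_wpM2l (ltW l0) (AP N).
  have h2 : l^-1 * (\sum_(n < N) weight s n * normc (fourier f n%:Z) ^+ 2) <= l.
    rewrite ler_pdivrMl// -expr2; apply: le_trans (Hs_norm_sum N foo) _.
    by rewrite lerXn2r ?nnegrE ?(ltW l0).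
  lra.
apply/ler_addgt0Pr => e e0.
have A1 : 0 < A + 1 by lra.
apply: le_trans (key (b + e / (A + 1)) _ _) _.
- by rewrite ltr_wpDl// divr_gt0.
- by rewrite lerDl ltW// divr_gt0.
- by rewrite mulrDr [_ * (e / _)]mulrCA divff ?gt_eqF// mulr1.
Qed.

End Sobolev.

(** * Evolution in time *)

Section Evolution.
Variable R : realType.
Local Notation normc := ComplexField.Normc.normc.
Local Notation Re := complex.Re.
Local Notation HD := (h_is_dot R).
Local Notation hd := (@hdot R).
Local Notation nr := (nrm (@hdot R)).

Definition tderiv (x : R -> hardy R) (t : R) (x' : hardy R) : Prop :=
  nr ((h^-1)%:C *: (x (t + h) - x t) - x') @[h --> 0^'] --> (0 : R).

(** Continuity for the norm given by the sum of the moduli of the Fourier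
    coefficients. *)
Definition wiener_continuous (x : R -> hardy R) (t : R) : Prop :=
  exists c : R -> R, (forall h, wiener (x (t + h) - x t) (c h)) /\
    c h @[h --> 0^'] --> (0 : R).

Lemma K_coef (u x : hardy R) n : bdd x ->
  hd (K u x) (hen R n) = hd (cls (toL2 (fun t => expi (-1 - n%:Z) t * hval u t))) x.
Proof.
move=> bx; rewrite hdot_cls hdot_hen KE l2dot_cls; last exact: Hardy_expi.
rewrite /l2dot !toL2E; [|exact: L2M (bounded_expi R _) (l2P _)|exact: KL2_bdd].
rewrite /inner; congr cint; apply/funext => t.
rewrite -[l2val (en R n) t]/(expi n t) expi_conj expiD; ring.
Qed.

(** Unlike in [KBr], the symbol is arbitrary. *)
Lemma KBr_bdd (u x y : hardy R) : bdd x -> bdd y -> bdd (x - y) ->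
  K u (x - y) = K u x - K u y.
Proof.
move=> bx b_y bxy; apply: hardy_coef_ext => n.
by rewrite (dotBl HD) !K_coef// (dotBr HD).
Qed.

Lemma squeeze0 (f g : R -> R) : (forall h, h != 0 -> 0 <= f h <= g h) ->
  g h @[h --> 0^'] --> (0 : R) -> f h @[h --> 0^'] --> (0 : R).
Proof.
move=> fg g0; apply: (@squeeze_cvgr _ _ _ _ (fun=> 0) g) => //; last exact: cvg_cst.
by near=> h; apply: fg; near: h; exact: nbhs_dnbhs_neq.
Unshelve. all: by end_near. Qed.

Lemma normc_real (a : R) : normc a%:C = `|a|.
Proof. by rewrite /ComplexField.Normc.normc/= expr0n addr0 sqrtr_sqr. Qed.

Lemma deriv_continuous x t x' : tderiv x t x' ->
  nr (x (t + h) - x t) @[h --> 0^'] --> (0 : R).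
Proof.
move=> dx.
pose g h := `|h| * (nr ((h^-1)%:C *: (x (t + h) - x t) - x') + nr x').
apply: (@squeeze0 _ g) => [h h0|].
  rewrite nrm_ge0//= /g; apply: le_trans (ler_wpM2l (normr_ge0 h) (nrmD HD _ _)).
  rewrite subrK (nrmZ HD) mulrA.
  by rewrite normc_real normfV divff ?normr_eq0// mul1r.
rewrite -[X in _ --> X](mul0r (0 + nr x')).
apply: cvgM; last by apply: cvgD => //; exact: cvg_cst.
rewrite -[X in _ --> X](normr0 R); apply: cvg_norm; exact: nbhs_dnbhs.
Qed.

Lemma wiener_continuous_K U x t CU CX :
  (forall s, bdd (U s)) -> (forall s, bdd (x s)) ->
  wiener (U t) CU -> wiener (x t) CX ->
  wiener_continuous U t -> wiener_continuous x t ->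
  wiener_continuous (fun s => K (U s) (x s)) t.
Proof.
move=> bU bx wU wx [c1 [w1 z1]] [c2 [w2 z2]].
exists (fun h => c1 h * (CX + c2 h) + CU * c2 h); split => [h|].
  have -> : K (U (t + h)) (x (t + h)) - K (U t) (x t) =
      K (U (t + h) - U t) (x (t + h)) + K (U t) (x (t + h) - x t).
    by rewrite (KBl _ _ (bx _)) (KBr _ _ (bU _)) addrA subrK.
  have wxh : wiener (x (t + h)) (CX + c2 h).
    by rewrite -(subrK (x t) (x (t + h))) addrC; exact: wienerD.
  by apply: wienerD; apply: wienerK.
rewrite [X in _ --> X](_ : 0 = 0 * (CX + 0) + CU * 0); last by rewrite mul0r mulr0 addr0.
apply: cvgD; last by apply: cvgM => //; exact: cvg_cst.
by apply: cvgM => //; apply: cvgD => //; exact: cvg_cst.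
Qed.

(** Each factor is continuous for the stronger norm and differentiable for the
    weaker one; [K_le_bounded] and [K_le_boundedr] bound [K] by the product of
    one norm of each kind. *)
Lemma deriv_K U x t U' x' CU CX :
  (forall s, bdd (U s)) -> (forall s, bdd (x s)) ->
  wiener (U t) CU -> wiener (x t) CX -> wiener_continuous x t ->
  tderiv U t U' -> tderiv x t x' ->
  tderiv (fun s => K (U s) (x s)) t (K U' (x t) + K (U t) x').
Proof.
move=> bU bx wU wx [c [wc z]] dU dx.
pose DU h := (h^-1)%:C *: (U (t + h) - U t).
pose DX h := (h^-1)%:C *: (x (t + h) - x t).
pose g h := (CX + c h) * nr (DU h - U') + c h * nr U' + CU * nr (DX h - x').
have c0 h : 0 <= c h := wiener_ge0 (wc h).
have CX0 := wiener_ge0 wx; have CU0 := wiener_ge0 wU.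
apply: (@squeeze0 _ g) => [h h0|].
  rewrite nrm_ge0//=.
  have bdx : bdd (x (t + h) - x t) := wiener_bdd (wc h).
  have wxh : wiener (x (t + h)) (CX + c h).
    by rewrite -(subrK (x t) (x (t + h))) addrC; exact: wienerD.
  have -> : (h^-1)%:C *: (K (U (t + h)) (x (t + h)) - K (U t) (x t)) -
      (K U' (x t) + K (U t) x') =
      K (DU h - U') (x (t + h)) + (K U' (x (t + h) - x t) + K (U t) (DX h - x')).
    rewrite (KBr _ _ (bU t)) /DX (KZr _ _ (bU t)) conjc_real (KBr _ _ (bU t)).
    rewrite (KBl _ _ (bx _)) /DU (KZl _ _ (bx _)) (KBl _ _ (bx _)).
    rewrite (KBr_bdd U' (bx _) (bx _) bdx) !scalerBr.
    set a := _ *: K (U (t + h)) _; set b := _ *: K (U t) (x (t + h)).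
    rewrite -[K U' (x (t + h)) - _ + _]addrA subrKA -![_ - _ - _]addrA.
    rewrite [- K U' _ + _]addrCA subrKA; congr (_ + _).
    by rewrite opprD; exact: addrCA.
  apply: le_trans (nrmD HD _ _) _; rewrite /g -addrA; apply: lerD.
    apply: K_le_boundedr; first by rewrite addr_ge0.
    exact: wiener_bounded.
  apply: le_trans (nrmD HD _ _) _; apply: lerD.
    by apply: K_le_boundedr => //; exact: wiener_bounded.
  by apply: K_le_bounded => //; exact: wiener_bounded.
rewrite [X in _ --> X](_ : 0 = (CX + 0) * 0 + 0 * nr U' + CU * 0); last by rewrite !(mul0r, mulr0) !addr0.
apply: cvgD; last by apply: cvgM => //; exact: cvg_cst.
apply: cvgD; last by apply: cvgM => //; exact: cvg_cst.
by apply: cvgM => //; apply: cvgD => //; exact: cvg_cst.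
Qed.

Lemma nsq_deriv x t x' : tderiv x t x' ->
  is_derive t (1 : R) (fun s => nsq hd (x s)) (2 * Re (hd x' (x t))).
Proof.
move=> dx.
have lim : h^-1 *: (nsq hd (x (h *: (1 : R) + t)) - nsq hd (x t)) @[h --> 0^'] -->
    2 * Re (hd x' (x t)).
  pose DX h := (h^-1)%:C *: (x (t + h) - x t).
  have cx := deriv_continuous dx.
  pose g h := nr (DX h - x') * (2 * nr (x t)) +
     (nr (DX h - x') + nr x') * nr (x (t + h) - x t).
  have g0 : g h @[h --> 0^'] --> (0 : R).
    rewrite [X in _ --> X](_ : 0 = 0 * (2 * nr (x t)) + (0 + nr x') * 0); last by rewrite mul0r mulr0 addr0.
    apply: cvgD; first by apply: cvgM => //; exact: cvg_cst.
    by apply: cvgM => //; apply: cvgD => //; exact: cvg_cst.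
  pose v := 2 * Re (hd x' (x t)).
  have zn : (fun h => h^-1 * (nsq hd (x (t + h)) - nsq hd (x t)) - v) h @[h --> 0^'] --> (0 : R).
    apply/norm_cvg0P; apply: (@squeeze0 _ g) => // h h0; rewrite normr_ge0/=.
    pose dd := x (t + h) - x t.
    have e1 : nsq hd (x (t + h)) = nsq hd (x t) + nsq hd dd + 2 * Re (hd dd (x t)).
      by rewrite -[x (t + h)](subrK (x t)) -/dd (nsqD HD) addrC; ring.
    have e2 : Re (hd (DX h) (x t)) = h^-1 * Re (hd dd (x t)).
      by rewrite /DX (dotZl HD) -/dd; case: (hd dd (x t)) => p q /=; ring.
    have e3 : Re (hd (DX h) dd) = h^-1 * nsq hd dd.
      by rewrite /DX (dotZl HD) -/dd (dotxx HD) /=; ring.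
    have -> : h^-1 * (nsq hd (x (t + h)) - nsq hd (x t)) - v =
        2 * Re (hd (DX h - x') (x t)) + Re (hd (DX h) dd).
      rewrite e1 e3 (dotBl HD (DX h)) /v; move: e2.
      by case: (hd (DX h) _) (hd x' _) => p q [p' q'] /= ->; ring.
    apply: le_trans (ler_normD _ _) _; apply: lerD.
      rewrite normrM ger0_norm// [leRHS]mulrCA ler_wpM2l//.
      exact: le_trans (Re_le_normc _) (dot_le HD _ _).
    apply: le_trans (Re_le_normc _) _; apply: le_trans (dot_le HD _ _) _.
    rewrite ler_wpM2r ?nrm_ge0// -{1}[DX h](subrK x'); exact: (nrmD HD).
  rewrite (_ : (fun h => _) = fun h => h^-1 * (nsq hd (x (t + h)) - nsq hd (x t)) - v + v).
    by rewrite -[X in _ --> X]add0r; apply: cvgD; [exact: zn|exact: cvg_cst].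
  by apply/funext => h; rewrite subrK /GRing.scale/= mulr1 [h + t]addrC.
by apply: DeriveDef; [apply/cvg_ex; eexists; exact: lim|exact: cvg_lim].
Qed.

End Evolution.

(** * Conserved moments *)

Section Conservation.
Variable R : realType.
Local Notation Re := complex.Re.
Local Notation HD := (h_is_dot R).
Local Notation hd := (@hdot R).
Local Notation hone := (hone R).
Local Notation I := ('i%C : R[i]).

Lemma i2E : I / 2 = 0 +i* 2^-1.
Proof.
apply: (mulIf (x := 2)); first by rewrite pnatr_eq0.
rewrite divfK ?pnatr_eq0//.
rewrite mulr_natr mulr2n.
by apply/eqP; rewrite eq_complex/=; apply/andP; split; apply/eqP; field.
Qed.

Lemma iterK2 (f : hardy R -> hardy R) n x : iter n f (f (f x)) = f (f (iter n f x)).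
Proof. by rewrite -!iterSr. Qed.

Lemma conj_i : (I^*)%C = - I.
Proof. by apply/eqP; rewrite eq_complex/= oppr0 !eqxx. Qed.

Lemma conj_Ni : ((- I)^*)%C = I.
Proof. by apply/eqP; rewrite eq_complex/= oppr0 opprK !eqxx. Qed.

Lemma conj_i2 : ((I / 2)^*)%C = - (I / 2).
Proof. by rewrite conjM conj_i conjc_inv conjc_nat mulNr. Qed.

(** The product [expi 1 * x * g] has mean zero. This is why the perturbation
    [alpha (u | 1)] of the equation does not change the Lax pair. *)
Lemma K_one_left x : bdd x -> K hone x = 0.
Proof.
move=> bx; apply: hardy_dot_ext => g.
rewrite (dot0l HD) (K_M _ _ bx) (dotC HD) ME.
have mH := M_bddE g bx.
rewrite (_ : hd _ _ = 0) ?rmorph0// hdot_hen l2dot_cls; last exact: Hardy_expi.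
rewrite /l2dot toL2E; last exact: mH.1.
rewrite inner_move.
have [C xC] := bx.
have xg : Hardy (fun t => hval x t * hval g t) by apply: (Hardy_mul _ xC).
rewrite (_ : (fun t => ((expi 1 t)^*)%C * en R 0 t) = expi (-1)); first exact: xg.2.
by apply/funext => t; rewrite expi_conj -[l2val (en R 0) t]/(expi 0 t) -expiD addr0.
Qed.

(** The generator of the Lax pair. *)
Definition gen (u x : hardy R) : hardy R := - I *: T u x + (I / 2) *: K u (K u x).

Lemma hd_K2 u x : bdd u -> hd (K u (K u x)) x = (nsq hd (K u x))%:C.
Proof. by move=> bu; rewrite (K_sym _ _ bu) (dotxx HD). Qed.

Lemma gen_skew u x : bdd u -> Re (hd (gen u x) x) = 0.
Proof.
move=> bu; rewrite /gen (dotDl HD) !(dotZl HD) (hd_K2 _ bu).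
have : complex.Im (hd (T u x) x) = 0.
  have := T_sym x x bu; rewrite (dotC HD (T u x)) => /(congr1 (@complex.Im R)).
  by case: (hd _ _) => a b /=; lra.
case: (hd (T u x) x) => a b /= ->.
by rewrite !(mul0r, mulr0, oppr0, subr0, sub0r, addr0, add0r); ring.
Qed.

Definition regular (x : R -> hardy R) : Prop :=
  (forall t, exists C, wiener (x t) C) /\ (forall t, wiener_continuous x t).

Lemma regular_bdd x : regular x -> forall t, bdd (x t).
Proof. by move=> [wx _] t; have [C] := wx t; exact: wiener_bdd. Qed.

Lemma regular_K U x : regular U -> regular x -> regular (fun t => K (U t) (x t)).
Proof.
move=> rU rx; have bU := regular_bdd rU; have bx := regular_bdd rx.
move: rU rx => [wU cU] [wx cx]; split => t; have [C UC] := wU t; have [C' xC] := wx t.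
  by exists (C * C'); exact: wienerK.
exact: wiener_continuous_K.
Qed.

Lemma iterKD (u x y : hardy R) n : bdd u ->
  iter n (K u) (x + y) = iter n (K u) x + iter n (K u) y.
Proof. by move=> bu; elim: n => //= n ->; rewrite (KDr _ _ bu). Qed.

Definition conj_iter n (c : R[i]) : R[i] := if odd n then (c^*)%C else c.

Lemma iterKZ (u x : hardy R) n c : bdd u ->
  iter n (K u) (c *: x) = conj_iter n c *: iter n (K u) x.
Proof.
move=> bu; rewrite /conj_iter; elim: n => //= n ->; rewrite (KZr _ _ bu).
by case: (odd n) => //=; rewrite conjcK.
Qed.

Section Flow.
Variables (U : R -> hardy R) (alpha : R).
Hypothesis rU : regular U.
Hypothesis dU : forall t, tderiv U t
  (- I *: (T (U t) (U t) + (alpha%:C * hd (U t) hone) *: hone)).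

Let bU t : bdd (U t) := regular_bdd rU t.

(** By [lax_identity], the derivative of [K (U t)] is the commutator of [gen (U t)]
    with [K (U t)]; here [d] is the covariant derivative of [x]. *)
Lemma deriv_K_gen x d t : regular x -> tderiv x t (gen (U t) (x t) + d) ->
  tderiv (fun s => K (U s) (x s)) t (gen (U t) (K (U t) (x t)) + K (U t) d).
Proof.
move=> rx dx; have [C UC] := rU.1 t; have [C' xC] := rx.1 t.
have bx := regular_bdd rx.
have := deriv_K bU bx UC xC (rx.2 t) (dU t) dx.
congr (tderiv _ _ _); rewrite (KZl _ _ (bx t)) (KDl _ _ (bx t)) (KZl _ _ (bx t)).
rewrite (K_one_left (bx t)) scaler0 addr0 (lax_identity (bU t) (bx t)).
rewrite (KDr _ _ (bU t)) addrA; congr (_ + _).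
rewrite /gen (KDr _ _ (bU t)) !(KZr _ _ (bU t)).
set a := T _ _; set b := K _ (T _ _); set c := K _ _.
rewrite conj_Ni conj_i2.
apply: hardy_dot_ext => g.
rewrite !(dotDl HD, dotZl HD, dotNl HD).
set A := hd a g; set B := hd b g; set C0 := hd c g.
clearbody A B C0.
by field.
Qed.

Lemma iterK_deriv x d : regular x ->
  (forall t, tderiv x t (gen (U t) (x t) + d t)) ->
  forall n, regular (fun t => iter n (K (U t)) (x t)) /\
    forall t, tderiv (fun s => iter n (K (U s)) (x s)) t
      (gen (U t) (iter n (K (U t)) (x t)) + iter n (K (U t)) (d t)).
Proof.
move=> rx dx; elim => [//|n [rn dn]]; split => [|t]; first exact: regular_K.
exact: deriv_K_gen.
Qed.

Lemma iterK_nsq_deriv x d : regular x ->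
  (forall t, tderiv x t (gen (U t) (x t) + d t)) ->
  forall n t, is_derive t (1 : R) (fun s => nsq hd (iter n (K (U s)) (x s)))
    (2 * Re (hd (iter n (K (U t)) (d t)) (iter n (K (U t)) (x t)))).
Proof.
move=> rx dx n t; have [_ dn] := iterK_deriv rx dx n.
have := nsq_deriv (dn t); rewrite (dotDl HD).
set a := hd (gen _ _) _; have : Re a = 0 by exact: gen_skew.
by case: a (hd _ _) => [a b] [c e] /= ->; rewrite add0r.
Qed.

Lemma regular_one : regular (fun=> hone).
Proof.
split => t; first by exists 1; exact: wiener_one.
exists (fun=> 0); split => [h|]; last exact: cvg_cst.
rewrite subrr => N; rewrite big1// => n _.
by rewrite (dot0l HD) ComplexField.Normc.normc0.
Qed.

(** The constant function has derivative 0; the covariant derivative follows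
    from [T_one]. *)
Lemma deriv_one t : tderiv (fun=> hone) t
  (gen (U t) hone + ((I / 2) *: K (U t) (K (U t) hone) + (I * hd hone (U t)) *: U t)).
Proof.
rewrite (_ : _ + _ = 0); last first.
  apply: hardy_dot_ext => g.
  rewrite /gen (T_one (bU t)) !(dotDl HD, dotZl HD) (dot0l HD).
  by field.
rewrite /tderiv; under eq_fun do rewrite subrr scaler0 subrr (nrm0 HD).
exact: cvg_cst.
Qed.

(** By symmetry of [K (U t)] the two terms are [(K^(2n) u | u)] and
    [(K^(2n) 1 | 1)]. *)
Definition moment n t : R := nsq hd (iter n (K (U t)) (U t)) -
  alpha * nsq hd (iter n (K (U t)) hone).

(** As [gen] is skew-adjoint, only the covariant derivatives contribute. The
    terms with a factor [(i / 2) K^2] are imaginary, and those with [(u | 1)]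
    cancel each other, having conjugate values. *)
Lemma moment_constant n t t' : moment n t = moment n t'.
Proof.
apply: is_derive_0_is_cst => {}t.
pose du s := (- (I * (alpha%:C * hd (U s) hone))) *: hone +
  (- (I / 2)) *: K (U s) (K (U s) (U s)).
have dU' s : tderiv U s (gen (U s) (U s) + du s).
  have := dU s; congr tderiv; rewrite /gen /du scalerDr scalerA mulNr.
  by rewrite -addrA; congr (_ + _); rewrite addrCA -scalerDl subrr scale0r addr0.
have D1 := iterK_nsq_deriv rU dU' n t.
have D2 := iterK_nsq_deriv regular_one deriv_one n t.
have := is_deriveB D1 (is_deriveZ alpha D2).
move=> h; apply: (is_derive_eq h).
rewrite /du !(iterKD _ _ _ (bU t)) !(iterKZ _ _ _ (bU t)) !(dotDl HD) !(dotZl HD).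
rewrite !iterK2 !hd_K2// i2E.
rewrite (dotC HD (iter n _ hone)) (dotC HD (U t) hone).
set w := hd (iter _ _ _) (iter _ _ _); set a := hd (U t) hone.
set r1 := nsq _ _; set r2 := nsq _ _; clearbody w a r1 r2.
rewrite /GRing.scale/= /conj_iter; case: (odd n); case: w => p q; case: a => b c /=; ring.
Qed.

End Flow.
End Conservation.

(** * Spectral projections as limits of polynomials *)

Section Spectral.
Variables (R : realType) (V : lmodType R[i]) (dot : V -> V -> R[i]).
Hypothesis D : is_dot dot.
Local Notation Re := complex.Re.
Local Notation nq := (nsq dot).
Local Notation nr := (nrm dot).
Hypothesis definite : forall x, nq x = 0 -> x = 0.
Hypothesis complete : forall x, cauchy_seq_dot dot x -> exists l, cvg_dot dot x l.

Variable A : V -> V.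
Hypothesis AD : forall x y, A (x + y) = A x + A y.
Hypothesis AZ : forall c x, A (c *: x) = c *: A x.
Hypothesis A_sym : forall x y, dot (A x) y = dot x (A y).

Variables (lam m : R).
Hypothesis m0 : 0 < m.
Hypothesis A_le : forall x, nr (A x - lam%:C *: x) <= m * nr x.

(** The operator [(A - lam) / m], a contraction, and the operator
    [1 - ((A - lam) / m) ^ 2], which is 1 on the eigenspace of [lam] and lies
    between 0 and 1 as a self-adjoint operator. *)
Definition shifted x := (m^-1)%:C *: (A x - lam%:C *: x).
Definition peak x := x - shifted (shifted x).

Let AB x y : A (x - y) = A x - A y.
Proof. by rewrite AD -[- y]scaleN1r AZ scaleN1r. Qed.

Lemma shiftedD x y : shifted (x + y) = shifted x + shifted y.
Proof. by rewrite /shifted AD (scalerDr lam%:C) opprD addrACA scalerDr. Qed.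
Lemma shiftedZ c x : shifted (c *: x) = c *: shifted x.
Proof. by rewrite /shifted AZ scalerA mulrC -scalerA -scalerBr scalerA mulrC -scalerA. Qed.
Lemma shiftedB x y : shifted (x - y) = shifted x - shifted y.
Proof. by rewrite shiftedD -[- y]scaleN1r shiftedZ scaleN1r. Qed.

Lemma shifted_sym x y : dot (shifted x) y = dot x (shifted y).
Proof.
rewrite /shifted (dotZl D) (dotZr D) conjc_real (dotBl D) (dotBr D).
by rewrite (dotZl D) (dotZr D) conjc_real A_sym.
Qed.

Lemma shifted_le x : nq (shifted x) <= nq x.
Proof.
have h : nr (shifted x) <= nr x.
  rewrite /shifted (nrmZ D) normc_real ger0_norm ?invr_ge0 ?(ltW m0)//.
  by rewrite ler_pdivrMl// A_le.
by rewrite -!(nrm_sq D) lerXn2r ?nnegrE ?nrm_ge0.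
Qed.

Lemma peakB x y : peak (x - y) = peak x - peak y.
Proof.
by rewrite /peak !shiftedB !opprB addrACA [RHS]addrACA; congr (_ + _); exact: addrC.
Qed.
Lemma peak_sym x y : dot (peak x) y = dot x (peak y).
Proof. by rewrite /peak (dotBl D) (dotBr D) !shifted_sym. Qed.
Lemma peak_shifted x : peak (shifted x) = shifted (peak x).
Proof. by rewrite /peak shiftedB. Qed.
Lemma A_shifted x : A (shifted x) = shifted (A x).
Proof. by rewrite /shifted AZ AB AZ. Qed.
Lemma iter_sym (f : V -> V) k : (forall x y, dot (f x) y = dot x (f y)) ->
  forall x y, dot (iter k f x) y = dot x (iter k f y).
Proof. by move=> fs; elim: k => //= k ih x y; rewrite fs ih -iterSr. Qed.

Lemma iter_comm (f g : V -> V) k : (forall x, f (g x) = g (f x)) ->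
  forall x, f (iter k g x) = iter k g (f x).
Proof. by move=> fg; elim: k => //= k ih x; rewrite fg ih. Qed.

Let b k := iter k peak.

(** An even power is a square; an odd one is a square with one factor
    [peak] in the middle, and [peak] is positive because [shifted] is a
    contraction. *)
Lemma peak_pos k y : 0 <= Re (dot (b k y) y).
Proof.
have ev j z : dot (b (j + j) z) z = dot (b j z) (b j z).
  by rewrite /b iterD (iter_sym _ peak_sym).
rewrite -(odd_double_half k) -addnn; set j := k./2; case: (odd k).
  rewrite /b add1n iterS -/(b _) /b iterD -iterS iterSr.
  rewrite (iter_sym _ peak_sym) -/(b j y).
  rewrite {1}/peak (dotBl D) (shifted_sym (shifted _)) (dotxx D) (dotxx D) /=.
  by rewrite subr_ge0 shifted_le.
by rewrite add0n ev; exact: nsq_ge0 D _.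
Qed.

Lemma peak_decr k x : Re (dot (b k.+1 x) x) <= Re (dot (b k x) x).
Proof.
have -> : b k.+1 x = b k x - b k (shifted (shifted x)).
  have bB n u v : b n (u - v) = b n u - b n v by elim: n => //= n ->; rewrite peakB.
  by rewrite -bB /b iterSr.
rewrite (dotBl D) (_ : dot (b k (shifted (shifted x))) x = dot (b k (shifted x)) (shifted x)).
  have := peak_pos k (shifted x).
  by case: (dot _ x) (dot (b k (shifted x)) _) => p q [p' q'] /=; lra.
by rewrite /b -(iter_comm _ (fun z => esym (peak_shifted z))) shifted_sym.
Qed.

Lemma peak_fixed h : A h = lam%:C *: h -> forall k, b k h = h.
Proof.
move=> Ah; have n0 : shifted h = 0 by rewrite /shifted Ah subrr scaler0.
have s0 : shifted 0 = 0 by rewrite -(scale0r 0) shiftedZ !scale0r.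
by elim=> //= k ->; rewrite /peak n0 s0 subr0.
Qed.

Lemma peak_le x : nr (peak x) <= 2 * nr x.
Proof.
apply: le_trans (nrmB D _ _) _.
have h y : nr (shifted y) <= nr y.
  by rewrite /nrm ler_wsqrtr// shifted_le.
by have := le_trans (h (shifted x)) (h x); lra.
Qed.

(** The numbers [(b k x | x)] decrease to a limit, so that the iterates [b k x]
    form a Cauchy sequence. Its limit [p] is a fixed point of [peak], which
    means that [p] is in the kernel of the square of [shifted], hence in that
    of [shifted]. *)
Lemma spectral_projection x : exists p, [/\ A p = lam%:C *: p,
  forall h, A h = lam%:C *: h -> dot p h = dot x h &
  forall eps, 0 < eps -> exists N, forall k, (N <= k)%N ->
    `|Re (dot (b (k + k) x) x) - nq p| <= eps].
Proof.
pose a k := Re (dot (b k x) x).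
have ad : {homo a : i j / (i <= j)%N >-> j <= i}.
  by apply/nonincreasing_seqP => k; exact: peak_decr.
have bb i j : dot (b i x) (b j x) = dot (b (j + i) x) x.
  by rewrite [in RHS]/b iterD [RHS](iter_sym _ peak_sym).
have [p pP] : exists l, cvg_dot dot (fun k => b k x) l.
  apply: complete; apply: (@cauchy_of_monotone _ _ _ D _ (fun k => - a (k + k)%N) 0).
    move=> i j ij; rewrite (nsqB D) /nsq !bb -/(a _) opprK addrC.
    have : a (j + j)%N <= a (i + j)%N by apply: ad; rewrite leq_add2r.
    by rewrite /a; lra.
  by move=> k; rewrite oppr_le0; exact: peak_pos.
have fixp : peak p = p.
  apply/subr0_eq/definite; apply/eqP; rewrite eq_le (nsq_ge0 D) andbT.
  apply/ler_addgt0Pr => e e0; rewrite add0r.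
  have e3 : 0 < e / 10 by rewrite divr_gt0.
  have [N NP] := pP _ e3.
  have -> : peak p - p = peak (p - b N x) - (p - b N.+1 x).
    by rewrite peakB -[b N.+1 x]/(peak (b N x)) (opprB p) subrKA.
  have h1 := NP N (leqnn N); have h2 := NP N.+1 (leqnSn N).
  have h3 := peak_le (p - b N x).
  have h4 : nq (peak (p - b N x)) <= 4 * nq (p - b N x).
    have -> : 4 * nq (p - b N x) = (2 * nr (p - b N x)) ^+ 2.
      by rewrite exprMn (nrm_sq D) -natrX.
    by rewrite -(nrm_sq D) lerXn2r ?nnegrE ?mulr_ge0 ?nrm_ge0.
  have := nsqD_le D (peak (p - b N x)) (- (p - b N.+1 x)); rewrite (nsqN D).
  lra.
have Ap : A p = lam%:C *: p.
  have LL : shifted (shifted p) = 0.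
    by have := congr1 (fun z => p - z) fixp; rewrite /peak subKr subrr.
  have L0 : shifted p = 0.
    by apply: definite; rewrite /nsq shifted_sym LL (dot0r D).
  move: L0; rewrite /shifted => /eqP; rewrite scaler_eq0 => /orP[|].
    by rewrite (inj_eq (@complexI R)) invr_eq0 gt_eqF.
  by rewrite subr_eq0 => /eqP.
have proj h : A h = lam%:C *: h -> dot p h = dot x h.
  move=> Ah; apply: (cvg_dot_eventually D (N0 := 0) pP) => k _.
  by rewrite /b (iter_sym _ peak_sym) -/(b k) peak_fixed.
exists p; split => // eps e0; have [N NP] := pP _ e0; exists N => k Nk.
have -> : Re (dot (b (k + k) x) x) - nq p = nq (p - b k x).
  have e1 : nq (b k x) = Re (dot (b (k + k) x) x) by rewrite /nsq bb.
  rewrite (nsqB D) e1.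
  have -> : dot p (b k x) = dot p p.
    rewrite (dotC D) /b (iter_sym _ peak_sym) -/(b k) (peak_fixed Ap) -proj//.
    by rewrite -(dotC D).
  by rewrite /nsq; lra.
by rewrite ger0_norm ?nsq_ge0//; exact: NP.
Qed.

(** With this recursion a conservation law for the moments of [A] extends to the
    moments of [A] after iterates of [peak]. *)
Lemma moment_step l k x y :
  Re (dot (iter l A (b k.+1 x)) y) = Re (dot (iter l A (b k x)) y) -
   m^-1 ^+ 2 * (Re (dot (iter l.+2 A (b k x)) y) -
     2 * lam * Re (dot (iter l.+1 A (b k x)) y) +
     lam ^+ 2 * Re (dot (iter l A (b k x)) y)).
Proof.
set z := b k x; rewrite /b iterS -/(b k x) -/z.
have itB n u v : iter n A (u - v) = iter n A u - iter n A v.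
  by elim: n => //= n ->; rewrite AB.
have itS n u : iter n A (shifted u) = shifted (iter n A u).
  by elim: n => //= n ->; rewrite A_shifted.
rewrite /peak itB !itS (dotBl D).
set w := iter l A z; rewrite !iterS -/w.
rewrite /shifted !(AZ, AB) !(dotZl D, dotBl D).
case: (dot w y) (dot (A w) y) (dot (A (A w)) y) => ? ? [? ?] [? ?] /=.
ring.
Qed.

End Spectral.

(** * The sign at a crossing *)

Section Crossing.
Variable R : realType.
Local Notation Re := complex.Re.
Local Notation HD := (h_is_dot R).
Local Notation hd := (@hdot R).
Local Notation nr := (nrm (@hdot R)).
Local Notation hone := (hone R).

Definition eigenK (u : hardy R) (s : R) (x : hardy R) : Prop :=
  K u (K u x) = (s ^+ 2)%:C *: x.

Definition eigenH (u : hardy R) (s : R) (x : hardy R) : Prop :=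
  H u (H u x) = (s ^+ 2)%:C *: x.

Definition eigen_proj (u : hardy R) (s : R) (x p : hardy R) : Prop :=
  eigenK u s p /\ forall h, eigenK u s h -> hd p h = hd x h.

Lemma eigenKD u s x y : bdd u -> eigenK u s x -> eigenK u s y -> eigenK u s (x + y).
Proof. by move=> bu; rewrite /eigenK !(KDr _ _ bu) => -> ->; rewrite scalerDr. Qed.

Lemma eigenKZ u s c x : bdd u -> eigenK u s x -> eigenK u s (c *: x).
Proof.
by move=> bu; rewrite /eigenK !(KZr _ _ bu) conjcK => ->; rewrite !scalerA mulrC.
Qed.

Lemma eigen_proj_unique u s x p p' : bdd u ->
  eigen_proj u s x p -> eigen_proj u s x p' -> p = p'.
Proof.
move=> bu [ep hp] [ep' hp']; apply/subr0_eq/hnsq_eq0.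
have ed : eigenK u s (p - p').
  by rewrite -scaleN1r; apply: eigenKD => //; exact: eigenKZ.
by rewrite /nsq (dotBl HD) hp// hp'// subrr.
Qed.

(** The hypothesis of [spectral_projection]. The bound may be increased, so that
    one value of [m] serves for two times. *)
Lemma K2_le C u x m s : wiener u C -> C ^+ 2 + s ^+ 2 <= m ->
  nr (K u (K u x) - (s ^+ 2)%:C *: x) <= m * nr x.
Proof.
move=> wu Cm; have C0 := wiener_ge0 wu; have b := wiener_bounded wu.
apply: le_trans (nrmB HD _ _) _; rewrite (nrmZ HD) normc_real ger0_norm ?sqr_ge0//.
have h1 := K_le_bounded (K u x) C0 b.
have h2 := ler_wpM2l C0 (K_le_bounded x C0 b).
have h3 := ler_wpM2r (nrm_ge0 hd x) Cm.
apply: le_trans h3; rewrite mulrDl lerD2r.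
by apply: le_trans h1 _; rewrite expr2 -mulrA.
Qed.

Lemma iter_K2 u l x : bdd u ->
  Re (hd (iter l (fun y => K u (K u y)) x) x) = nsq hd (iter l (K u) x).
Proof.
move=> bu; elim: l x => [//|l ih] x.
rewrite iterS [iter l.+1 (K u) x]iterSr -ih (K_sym _ _ bu).
have -> : K u (iter l (fun y => K u (K u y)) x) = iter l (fun y => K u (K u y)) (K u x).
  by apply: iter_comm.
by rewrite (dotC HD); case: (hd _ _).
Qed.

Section Conserved.
Variables (U : R -> hardy R) (alpha : R).
Hypothesis rU : regular U.
Hypothesis dU : forall t, tderiv U t
  (- ('i%C : R[i]) *: (T (U t) (U t) + (alpha%:C * hd (U t) hone) *: hone)).

Let bU t : bdd (U t) := regular_bdd rU t.
Let A t x := K (U t) (K (U t) x).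

Let AD t x y : A t (x + y) = A t x + A t y.
Proof. by rewrite /A !(KDr _ _ (bU t)). Qed.
Let AZ t c x : A t (c *: x) = c *: A t x.
Proof. by rewrite /A !(KZr _ _ (bU t)) conjcK. Qed.
Let A_sym t x y : hd (A t x) y = hd x (A t y).
Proof.
rewrite /A (K_sym (K (U t) x) y (bU t)) (dotC HD _ x).
by rewrite (K_sym (K (U t) y) x (bU t)) -(dotC HD).
Qed.

(** Both sides are limits of linear combinations of moments. The coefficients
    depend only on [s] and on [m], and [m] can be the same at both times. *)
Lemma ell_conserved s t t' p q p' q' :
  eigen_proj (U t) s (U t) p -> eigen_proj (U t) s hone q ->
  eigen_proj (U t') s (U t') p' -> eigen_proj (U t') s hone q' ->
  nsq hd p - alpha * nsq hd q = nsq hd p' - alpha * nsq hd q'.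
Proof.
move=> pp qp pp' qp'.
have [C wC] := rU.1 t; have [C' wC'] := rU.1 t'.
pose m := C ^+ 2 + C' ^+ 2 + s ^+ 2 + 1.
have m0 : 0 < m by rewrite /m; have := sqr_ge0 C; have := sqr_ge0 C'; have := sqr_ge0 s; lra.
have le1 x : nr (A t x - (s ^+ 2)%:C *: x) <= m * nr x.
  by apply: (K2_le _ wC); rewrite /m; have := sqr_ge0 C'; lra.
have le2 x : nr (A t' x - (s ^+ 2)%:C *: x) <= m * nr x.
  by apply: (K2_le _ wC'); rewrite /m; have := sqr_ge0 C; lra.
have spec r (le : forall x, nr (A r x - (s ^+ 2)%:C *: x) <= m * nr x) x y :
    eigen_proj (U r) s x y ->
    forall eps, 0 < eps -> exists N, forall k, (N <= k)%N ->
    `|Re (hd (iter (k + k) (peak (A r) (s ^+ 2) m) x) x) - nsq hd y| <= eps.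
  move=> yp; have [z [z1 z2 z3]] := spectral_projection HD (@hnsq_eq0 R)
    (@hardy_complete R) (AD r) (AZ r) (A_sym r) m0 le x.
  by rewrite (eigen_proj_unique (bU r) yp (conj z1 z2)).
pose mom r l k := Re (hd (iter l (A r) (iter k (peak (A r) (s ^+ 2) m) (U r))) (U r)) -
  alpha * Re (hd (iter l (A r) (iter k (peak (A r) (s ^+ 2) m) hone)) hone).
have mom_eq k : forall l, mom t l k = mom t' l k.
  elim: k => [|k ih] l.
    by rewrite /mom !iter_K2//; exact: (moment_constant rU dU).
  have step r : mom r l k.+1 = mom r l k - m^-1 ^+ 2 *
      (mom r l.+2 k - 2 * s ^+ 2 * mom r l.+1 k + s ^+ 2 ^+ 2 * mom r l k).
    rewrite /mom; have := moment_step HD (AD r) (AZ r) (s ^+ 2) m l k (U r) (U r).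
    have := moment_step HD (AD r) (AZ r) (s ^+ 2) m l k hone hone.
    by move: (Re _) (Re _) (Re _) (Re _) (Re _) (Re _) (Re _) (Re _) => a b c d e f g h -> ->; ring.
  by rewrite (step t) (step t') !ih.
have close r (le : forall x, nr (A r x - (s ^+ 2)%:C *: x) <= m * nr x) y z eps :
    eigen_proj (U r) s (U r) y -> eigen_proj (U r) s hone z -> 0 < eps ->
    exists N, forall k, (N <= k)%N ->
    `|mom r 0 (k + k)%N - (nsq hd y - alpha * nsq hd z)| <= eps.
  move=> yp zp e0; have e2 : 0 < eps / (1 + `|alpha|).
    by rewrite divr_gt0// ltr_pwDl.
  have [N NP] := spec r le _ _ yp _ e2; have [N' NP'] := spec r le _ _ zp _ e2.
  exists (maxn N N') => k; rewrite geq_max => /andP[Nk Nk'].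
  pose a := Re (hd (iter (k + k) (peak (A r) (s ^+ 2) m) (U r)) (U r)).
  pose b := Re (hd (iter (k + k) (peak (A r) (s ^+ 2) m) hone) hone).
  rewrite -[mom _ _ _]/(a - alpha * b).
  rewrite (_ : _ - _ = (a - nsq hd y) - alpha * (b - nsq hd z)); last by ring.
  apply: le_trans (ler_normB _ _) _; rewrite normrM.
  have h1 := NP k Nk; have h2 := ler_wpM2l (normr_ge0 alpha) (NP' k Nk').
  have e : eps / (1 + `|alpha|) + `|alpha| * (eps / (1 + `|alpha|)) = eps.
    by field; rewrite gt_eqF// ltr_pwDl.
  by rewrite -e; exact: lerD h1 h2.
apply/eqP; rewrite -subr_eq0 -normr_le0; apply/ler_addgt0Pr => e e0; rewrite add0r.
have e2 : 0 < e / 2 by rewrite divr_gt0.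
have [N NP] := close t le1 _ _ _ pp qp e2.
have [N' NP'] := close t' le2 _ _ _ pp' qp' e2.
have := NP (maxn N N') (leq_maxl _ _); have := NP' (maxn N N') (leq_maxr _ _).
rewrite mom_eq !ler_norml => /andP[h1 h2] /andP[h3 h4].
by apply/andP; split; lra.
Qed.

Lemma eigen_proj_exists s t x : exists p, eigen_proj (U t) s x p.
Proof.
have [C wC] := rU.1 t.
have m0 : 0 < C ^+ 2 + s ^+ 2 + 1 by have := sqr_ge0 C; have := sqr_ge0 s; lra.
have le x' : nr (A t x' - (s ^+ 2)%:C *: x') <= (C ^+ 2 + s ^+ 2 + 1) * nr x'.
  by apply: (K2_le _ wC); lra.
have [p [p1 p2 _]] := spectral_projection HD (@hnsq_eq0 R)
    (@hardy_complete R) (AD t) (AZ t) (A_sym t) m0 le x.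
by exists p.
Qed.

End Conserved.

Lemma H2_sym u x y : bdd u -> hd (H u (H u x)) y = hd x (H u (H u y)).
Proof.
move=> bu; rewrite (H_sym (H u x) y bu) (dotC HD _ x).
by rewrite (H_sym (H u y) x bu) -(dotC HD).
Qed.

Lemma HDr (u x y : hardy R) : bdd u -> H u (x + y) = H u x + H u y.
Proof.
move=> bu; apply: hardy_dot_ext => g.
by rewrite (dotDl HD) !(H_sym _ g bu) (dotDr HD).
Qed.

Lemma HZr (c : R[i]) (u x : hardy R) : bdd u -> H u (c *: x) = (c^*)%C *: H u x.
Proof.
move=> bu; apply: hardy_dot_ext => g.
by rewrite (dotZl HD) !(H_sym _ g bu) (dotZr HD).
Qed.

(** The scalar product of [H u (H u h) - s ^ 2 h = (h | u) u] with [e] vanishes by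
    symmetry, while [(u | e)] does not. *)
Lemma eigenK_eigenH u s e h : bdd u -> eigenH u s e -> hd u e <> 0 ->
  eigenK u s h <-> eigenH u s h /\ hd h u = 0.
Proof.
move=> bu eH ue; rewrite /eigenK (K2_H2 _ bu) /eigenH; split => [hK|[-> ->]]; last first.
  by rewrite scale0r subr0.
have hH : H u (H u h) = (s ^+ 2)%:C *: h + hd h u *: u by rewrite -hK subrK.
suff h0 : hd h u = 0 by rewrite hH h0 scale0r addr0.
have := H2_sym h e bu; rewrite eH hH (dotDl HD) !(dotZl HD) (dotZr HD) conjc_real.
rewrite -[RHS]addr0 => /addrI /eqP; rewrite mulf_eq0 => /orP[/eqP//|/eqP].
by [].
Qed.

Lemma Sadj_coef x n : hd (Sadj x) (hen R n) = hd x (hen R n.+1).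
Proof.
rewrite !hdot_hen SadjE l2dot_cls; last exact: Hardy_expi.
rewrite {1}/l2dot toL2E; last exact: L2M (bounded_expi R (-1)) (l2P _).
rewrite inner_move /l2dot; congr inner; apply/funext => t.
rewrite expi_conj -[l2val _ t]/(expi n%:Z t) -expiD -[RHS]/(expi n.+1%:Z t).
by congr (expi _ t); rewrite -addn1 PoszD opprK addrC.
Qed.

Lemma SadjZ (c : R[i]) (x : hardy R) : Sadj (c *: x) = c *: Sadj x.
Proof.
by apply: hardy_coef_ext => n; rewrite (dotZl HD) !Sadj_coef (dotZl HD).
Qed.

Lemma iter_Sadj_coef x n m : hd (iter n (@Sadj R) x) (hen R m) = hd x (hen R (n + m)).
Proof.
elim: n m => [|n ih] m; first by rewrite add0n.
by rewrite iterS Sadj_coef ih addnS addSn.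
Qed.

(** If the eigenspace of [K u] were orthogonal to [1], it would be stable under
    the backward shift, so that all Fourier coefficients of its elements would
    vanish. *)
Lemma eigenK_one u s e k : bdd u -> 0 < s -> eigenH u s e -> hd u e <> 0 ->
  eigenK u s k -> (forall h, eigenK u s h -> hd hone h = 0) -> k = 0.
Proof.
move=> bu s0 eH ue kK one0.
have FH h := eigenK_eigenH h bu eH ue.
have s2 : (s ^+ 2)%:C != 0 :> R[i].
  by rewrite (inj_eq (@complexI R)) expf_eq0/= gt_eqF.
have stabH h : eigenK u s h -> eigenK u s (H u h).
  move=> hK; have [hH hu] := (FH h).1 hK; apply/FH; split.
    by rewrite /eigenH hH (HZr _ _ bu) conjc_real.
  have -> : hd (H u h) u = hd (H u (H u hone)) h by rewrite (H_one bu) (H_sym _ _ bu).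
  rewrite (H2_sym _ _ bu) hH (dotZr HD) one0// mulr0.
  by [].
have stabS h : eigenK u s h -> eigenK u s (Sadj h).
  move=> hK; have [hH hu] := (FH h).1 hK.
  have : eigenK u s (K u (H u h)).
    by rewrite /eigenK (stabH h hK) (KZr _ _ bu) conjc_real.
  rewrite (K_Sadj_H _ bu) hH SadjZ => /(eigenKZ (s ^+ 2)%:C^-1 bu).
  by rewrite scalerA mulVf// scale1r.
have stab n : eigenK u s (iter n (@Sadj R) k) by elim: n => //= n; exact: stabS.
apply: hardy_coef_ext => n; rewrite (dot0l HD).
rewrite -[n]addn0 -iter_Sadj_coef (dotC HD) -/hone one0 ?rmorph0//.
Qed.

(** The combination [(e1 | u) e0 - (e0 | u) e1], or [e0] itself if it is orthogonal
    to [u], is a nonzero element of the eigenspace of [K u]. *)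
Lemma crossing_ell u s alpha e e0 e1 p q : bdd u -> 0 < s -> 0 < alpha ->
  eigenH u s e -> hd u e <> 0 -> eigenH u s e0 -> eigenH u s e1 ->
  (forall c0 c1 : R[i], c0 *: e0 + c1 *: e1 = 0 -> c0 = 0 /\ c1 = 0) ->
  eigen_proj u s u p -> eigen_proj u s hone q ->
  nsq hd p - alpha * nsq hd q < 0.
Proof.
move=> bu s0 a0 eH ue e0H e1H free [pK pP] [qK qP].
have FH h := eigenK_eigenH h bu eH ue.
have [k kK k0] : exists2 k, eigenK u s k & k <> 0.
  have [z0|z0] := pselect (hd e0 u = 0).
    exists e0; first exact/FH.
    move=> e00; have [] := free 1 0; first by rewrite e00 scaler0 scale0r addr0.
    by move/eqP; rewrite oner_eq0.
  exists (hd e1 u *: e0 + (- hd e0 u) *: e1).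
    apply/FH; split; last by rewrite (dotDl HD) !(dotZl HD); ring.
    rewrite /eigenH !(HDr _ _ bu) !(HZr _ _ bu) !conjcK e0H e1H scalerDr !scalerA.
    by congr (_ *: _ + _ *: _); rewrite mulrC.
  by case/free => _ /eqP; rewrite oppr_eq0 => /eqP.
have p0 : nsq hd p = 0.
  by rewrite /nsq pP// (dotC HD); have [_ ->] := (FH p).1 pK; rewrite rmorph0.
rewrite p0 sub0r oppr_lt0 pmulr_rgt0// lt_neqAle (nsq_ge0 HD) andbT.
apply/eqP => /esym q0; apply: k0; apply: (eigenK_one bu s0 eH ue kK) => h hK.
by rewrite -qP// (hnsq_eq0 q0) (dot0l HD).
Qed.

End Crossing.

(** * Functions and their classes *)

Section Classes.
Variable R : realType.
Local Notation LD := (l2_is_dot R).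
Local Notation HD := (h_is_dot R).
Local Notation hd := (@hdot R).
Local Notation hone := (hone R).
Implicit Types (f g h u v w : R -> R[i]).

Definition clsf f : hardy R := cls (toL2 f).

Lemma eqae_sym f g : eqae f g -> eqae g f.
Proof.
by move=> [N [mN N0 sub]]; exists N; split => // x nx; apply: sub => /= fx; apply: nx => /fx.
Qed.

Lemma eqae_mul f f' g g' : eqae f f' -> eqae g g' ->
  eqae (fun x => f x * g x) (fun x => f' x * g' x).
Proof. by move=> ef eg; apply: filterS2 ef eg => x fx gx Dx; rewrite fx// gx. Qed.

Lemma eqae_conj f f' : eqae f f' ->
  eqae (fun x => ((f x)^*)%C) (fun x => ((f' x)^*)%C).
Proof. by apply: filterS => x fx Dx; rewrite fx. Qed.

Lemma bounded_eqae C f g : bounded_by C f -> L2 g -> eqae f g -> bounded_by C g.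
Proof.
move=> [_ fC] g2 fg; split=> //; apply: filterS2 fg fC => x e fx Dx.
by rewrite /sq_modulus -e//; exact: fx.
Qed.

Lemma inner_eqae f g h : L2 f -> L2 g -> L2 h -> eqae f g -> inner f h = inner g h.
Proof.
move=> f2 g2 h2 /(eqae_l2sq f2 g2) fg.
by rewrite !inner_toL2//; exact: l2dot_null.
Qed.

Lemma szego_proj_eqae f g : L2 f -> L2 g -> eqae f g -> szego_proj f = szego_proj g.
Proof.
move=> f2 g2 fg; apply: szego_proj_ext => // h [h2 _]; exact: inner_eqae.
Qed.

Lemma cls_null (a b : L2fun R) : l2sq (a - b) = 0 -> cls a = cls b.
Proof.
by move=> ab; apply: hardy_dot_ext => h; rewrite !hdot_cls; exact: l2dot_null.
Qed.

Lemma hval_clsf f : Hardy f -> eqae (hval (clsf f)) f.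
Proof.
move=> fH; have f2 := fH.1; apply/(eqae_l2sq (l2P _) f2).
by rewrite toL2K; apply: hval_cls_ae; rewrite toL2E.
Qed.

Lemma szego_proj_clsf f : L2 f -> szego_proj f = hval (clsf f).
Proof. by move=> f2; rewrite hval_cls toL2E. Qed.

Lemma clsf_hval (a : hardy R) : clsf (hval a) = a.
Proof. by rewrite /clsf toL2K clsK. Qed.

Lemma clsf_one : clsf (fun=> 1) = hone.
Proof.
rewrite -[RHS]clsK; apply: cls_null.
by rewrite -(nsqN LD) opprB; exact: hval_one.
Qed.

Lemma HardyZ (c : R[i]) f : Hardy f -> Hardy (fun x => c * f x).
Proof.
move=> [f2 fn]; split; first exact: L2Z.
move=> n n0; rewrite /fourier (inner_toL2 (L2Z c f2) (L2_expi R n)).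
rewrite toL2Z// (dotZl LD) -inner_toL2//; last exact: L2_expi.
by rewrite -/(fourier f n) fn ?mulr0.
Qed.

Lemma clsfZ c f : L2 f -> clsf (fun x => c * f x) = c *: clsf f.
Proof. by move=> f2; rewrite /clsf toL2Z// clsZ. Qed.

Lemma clsfB f g : L2 f -> L2 g -> clsf (fun x => f x - g x) = clsf f - clsf g.
Proof. by move=> f2 g2; rewrite /clsf (toL2B f2 g2) clsB. Qed.

Lemma clsf_eqae f g : Hardy f -> Hardy g -> eqae f g <-> clsf f = clsf g.
Proof.
move=> fH gH; split=> [/(eqae_l2sq fH.1 gH.1)|fg]; first exact: cls_null.
have := hval_clsf fH; rewrite fg => e1; have e2 := hval_clsf gH.
by apply: filterS2 e1 e2 => x h1 h2 Dx; exact: etrans (esym (h1 Dx)) (h2 Dx).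
Qed.

Lemma HardyD f g : Hardy f -> Hardy g -> Hardy (fun x => f x + g x).
Proof.
move=> [f2 fn] [g2 gn]; split; first exact: L2D.
move=> n n0; rewrite /fourier (inner_toL2 (L2D f2 g2) (L2_expi R n)).
rewrite toL2D// (dotDl LD) -!inner_toL2//; try exact: L2_expi.
by rewrite -!/(fourier _ n) fn// gn// addr0.
Qed.

Lemma clsfD f g : L2 f -> L2 g -> clsf (fun x => f x + g x) = clsf f + clsf g.
Proof. by move=> f2 g2; rewrite /clsf (toL2D f2 g2) clsD. Qed.

Lemma inner_clsf f (a : hardy R) : L2 f -> inner f (hval a) = hd (clsf f) a.
Proof. by move=> f2; rewrite hdot_cls /l2dot toL2E. Qed.

Lemma inner_Hardy f h : L2 f -> Hardy h -> inner f h = hd (clsf f) (clsf h).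
Proof.
move=> f2 hH; rewrite hdot_cls.
have e := hval_cls_ae (w := toL2 h); rewrite toL2E in e; last exact: hH.1.
by rewrite (dotC LD) (l2dot_null _ (e hH)) -(dotC LD) inner_toL2//; exact: hH.1.
Qed.

Lemma nsq_clsf f : Hardy f -> nsq hd (clsf f) = L2norm f ^+ 2.
Proof.
move=> fH; have f2 := fH.1; have tH : Hardy (toL2 f) by rewrite toL2E.
have -> : L2norm f ^+ 2 = l2sq (toL2 f).
  by rewrite -(nrm_sq LD) -L2norm_nrm toL2E.
by rewrite /nsq hdot_cls (dotC LD) l2dot_cls//; case: (l2dot _ _).
Qed.

Lemma clsf_eq0 f : Hardy f -> clsf f = 0 -> eqae f (fun=> 0).
Proof.
move=> fH f0; have -> : f = toL2 f by rewrite toL2E//; exact: fH.1.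
apply/l2sq_eq0; rewrite -(nrm_sq LD) -L2norm_nrm toL2E; last exact: fH.1.
by rewrite -nsq_clsf// f0 /nsq (dot0l HD).
Qed.

(** The sets from which the two representatives are chosen are equal. *)
Lemma shift_adj_szego h : L2 h -> shift_adj h = szego_proj (fun x => expi (-1) x * h x).
Proof.
move=> h2; have e2 := L2M (bounded_expi R (-1)) h2.
rewrite /shift_adj /szego_proj /oproj; congr xget.
have sh f : inner h (Defs.shift f) = inner (fun x => expi (-1) x * h x) f.
  rewrite inner_move /Defs.shift; congr inner; apply/funext => x.
  by rewrite expi_conj opprK.
have sub g f : Hardy g -> Hardy f -> inner (fun x => expi (-1) x * h x - g x) f =
    inner h (Defs.shift f) - inner g f.
  move=> [g2 _] [f2 _]; rewrite sh !inner_toL2//; last exact: L2B.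
  by rewrite toL2B// (dotBl LD).
apply/seteqP; split=> g /= [gH gP]; split=> // f fH.
  by rewrite sub// gP// subrr.
by have := gP f fH; rewrite sub// => /subr0_eq.
Qed.

Section Hankel.
Variable u : R -> R[i].
Hypothesis uH : Hardy u.
Hypothesis ub : bdd (clsf u).
Local Notation U := (clsf u).

Let u_bounded : exists C, bounded_by C u.
Proof.
have [C UC] := ub; exists C; apply: (bounded_eqae UC); first exact: uH.1.
exact: hval_clsf.
Qed.

Lemma hankel_H h : Hardy h -> hankel u h = hval (H U (clsf h)).
Proof.
move=> hH; have [C uC] := u_bounded; have [C' UC] := ub.
transitivity (l2val (hval (clsf (fun t => hval U t * ((hval (clsf h) t)^*)%C)))); last by rewrite HE.
rewrite -szego_proj_clsf; last exact: H_L2 UC.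
apply: szego_proj_eqae; last first.
- apply: eqae_mul; first exact/eqae_sym/hval_clsf.
  by apply: eqae_conj; exact/eqae_sym/hval_clsf.
- exact: H_L2 UC.
- by apply: (L2M uC); apply: L2_conj; exact: hH.1.
Qed.

Lemma shifted_hankel_K h : Hardy h -> shifted_hankel u h = hval (K U (clsf h)).
Proof.
move=> hH; rewrite /shifted_hankel hankel_H// shift_adj_szego; last exact: l2P.
rewrite (K_Sadj_H _ ub) SadjE -/(clsf _) -szego_proj_clsf//.
exact: L2M (bounded_expi R (-1)) (l2P _).
Qed.

Lemma eigHE s h : eigH u s h <-> Hardy h /\ eigenH U s (clsf h).
Proof.
rewrite /eigH /eigenH/=; split=> -[hH]; rewrite !hankel_H//.
  rewrite clsf_hval => /clsf_eqae; rewrite clsf_hval clsfZ; last exact: hH.1.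
  by move=> e; split=> //; apply: e => //; exact: HardyZ.
move=> e; split=> //; apply/clsf_eqae => //; first exact: HardyZ.
by rewrite !clsf_hval e clsfZ//; exact: hH.1.
Qed.

Lemma eigKE s h : eigK u s h <-> Hardy h /\ eigenK U s (clsf h).
Proof.
rewrite /eigK /eigenK/=; split=> -[hH]; rewrite !shifted_hankel_K//.
  rewrite clsf_hval => /clsf_eqae; rewrite clsf_hval clsfZ; last exact: hH.1.
  by move=> e; split=> //; apply: e => //; exact: HardyZ.
move=> e; split=> //; apply/clsf_eqae => //; first exact: HardyZ.
by rewrite !clsf_hval e clsfZ//; exact: hH.1.
Qed.

Lemma oproj_eigK s f p : L2 f -> eigen_proj U s (clsf f) p ->
  L2norm (oproj (eigK u s) f) ^+ 2 = nsq hd p.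
Proof.
move=> f2 pP; rewrite /oproj; case: xgetP => [g e [/eigKE[gH gK] gP]|].
  rewrite -?e {e}.
  rewrite -(nsq_clsf gH); suff -> : clsf g = p by [].
  have gp : eigen_proj U s (clsf f) (clsf g); last exact: (eigen_proj_unique ub gp pP).
  split; first exact: gK.
  move=> k kK; have := gP (hval k).
  rewrite inner_clsf; last by apply: L2B => //; exact: gH.1.
  rewrite (clsfB f2 gH.1) (dotBl HD) => e; apply/esym/subr0_eq/e/eigKE.
  by split; [exact: hval_Hardy|rewrite clsf_hval].
case: pP => pK pP /(_ (hval p)); case; split.
  by apply/eigKE; split; [exact: hval_Hardy|rewrite clsf_hval].
move=> h /eigKE[hH hK]; have fp2 : L2 (fun x => f x - hval p x).
  by apply: L2B => //; exact: l2P.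
rewrite (inner_Hardy fp2 hH) (clsfB f2 (l2P _)) (dotBl HD) clsf_hval.
by rewrite (pP _ hK) subrr.
Qed.

Lemma ell_eigen_proj alpha s p q :
  eigen_proj U s U p -> eigen_proj U s hone q ->
  ell alpha u s = nsq hd p - alpha * nsq hd q.
Proof.
move=> pP qP; have hp := oproj_eigK uH.1 pP.
rewrite -clsf_one in qP; have hq := oproj_eigK (L2_cst (1 : R[i])) qP.
by rewrite -hp -hq.
Qed.

Lemma clsf_szego_rhs alpha : L2 (szego_rhs alpha u) /\
  clsf (szego_rhs alpha u) = T U U + (alpha%:C * hd U hone) *: hone.
Proof.
have [C uC] := u_bounded; have [C' UC] := ub.
have cub2 : L2 (fun y => (sq_modulus u y)%:C * u y).
  have := L2M (bounded_mul uC (bounded_conj uC)) uH.1; congr L2; apply/funext => y.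
  by rewrite sq_modulus_mul.
have TE' : szego_proj (fun y => (sq_modulus u y)%:C * u y) = hval (T U U).
  rewrite TE -/(clsf _) -szego_proj_clsf; last exact: T_L2 UC.
  apply: szego_proj_eqae => //; first exact: T_L2 UC.
  apply: filterS (hval_clsf uH) => x e Dx.
  by rewrite /sq_modulus e.
rewrite /szego_rhs TE'; have c2 := L2_cst (alpha%:C * inner u (fun=> 1)).
split; first exact: (L2D (l2P _) c2).
rewrite (clsfD (l2P _) c2) clsf_hval; congr (_ + _).
rewrite (inner_Hardy (h := fun=> 1) uH.1); last first.
  rewrite (_ : (fun=> 1) = l2val (en R 0)); first exact: Hardy_expi.
  by rewrite -[RHS]/(expi 0) expi0.
rewrite clsf_one -[X in X *: _]/(alpha%:C * hd U hone) -clsf_one -clsfZ; last exact: L2_cst.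
by congr (cls (toL2 _)); apply/funext => x; rewrite mulr1.
Qed.

End Hankel.

End Classes.

(** * Solutions of the equation *)

Section Solution.
Variables (R : realType) (s alpha : R) (u : R -> R -> R[i]).
Local Notation HD := (h_is_dot R).
Local Notation hd := (@hdot R).
Local Notation hone := (hone R).
Hypothesis s2 : 2^-1 < s.
Hypothesis uHs : forall t, Hs_plus s (u t).
Hypothesis u_cont :
  forall t0, Hs_norm s (fun x => u t x - u t0 x) @[t --> t0] --> (0 : R).
Hypothesis u_deriv : forall t,
  L2norm (fun x => 'i%C * ((h^-1)%:C * (u (t + h) x - u t x))
                   - szego_rhs alpha (u t) x) @[h --> 0^'] --> (0 : R).
Local Notation U t := (clsf (u t)).

Let u_L2 t : L2 (u t) := (uHs t).1.1.

Lemma solution_regular : regular (fun t => U t).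
Proof.
have [c [c0 cP]] := Hs_wiener s2; split=> t.
  exists (c * Hs_norm s (u t)); have := cP (toL2 (u t)); rewrite toL2E//.
  by case: (uHs t) => uH uoo; exact.
exists (fun h => c * Hs_norm s (fun x => u (t + h) x - u t x)); split=> [h|].
  have d2 : L2 (fun x => u (t + h) x - u t x) by exact: L2B.
  have -> : U (t + h) - U t = clsf (fun x => u (t + h) x - u t x).
    by rewrite clsfB.
  have := cP (toL2 (fun x => u (t + h) x - u t x)); rewrite toL2E//; apply.
    split=> // n n0; rewrite /fourier (inner_toL2 d2 (L2_expi R n)).
    rewrite toL2B// (dotBl (l2_is_dot R)) -!inner_toL2//; try exact: L2_expi.
    by rewrite -!/(fourier _ n) !(uHs _).1.2// subrr.
  have := @Hs_sqnormB R s (toL2 (u (t + h))) (toL2 (u t)); rewrite !toL2E//.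
  by apply; [exact: (uHs _).2|exact: (uHs _).2].
rewrite -[X in _ --> X](mulr0 c); apply: cvgM; first exact: cvg_cst.
have lim : t + h @[h --> 0^'] --> t.
  rewrite -[X in _ --> X]addr0; apply: cvgD; first exact: cvg_cst.
  exact: nbhs_dnbhs.
exact: (cvg_comp _ _ lim (u_cont t)).
Qed.

Lemma solution_tderiv t : tderiv (fun t => U t) t
  (- ('i%C : R[i]) *: (T (U t) (U t) + (alpha%:C * hd (U t) hone) *: hone)).
Proof.
have bU := regular_bdd solution_regular t.
have [W2 WE] := clsf_szego_rhs (uHs t).1 bU alpha.
apply: (squeeze0 _ (u_deriv t)) => h _; rewrite nrm_ge0/=.
rewrite -WE; set f := fun x : R => _.
have d2 : L2 (fun x => u (t + h) x - u t x) by exact: L2B.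
have e2 := L2Z 'i%C (L2Z (h^-1)%:C d2).
have f2 : L2 f by exact: L2B.
have -> : nrm hd ((h^-1)%:C *: (U (t + h) - U t) -
    - ('i%C : R[i]) *: clsf (szego_rhs alpha (u t))) = nrm hd (clsf f).
  rewrite /clsf /f toL2B// toL2Z; last exact: L2Z.
  rewrite toL2Z// toL2B// !clsB !clsZ clsB.
  set a := _ *: _; set b := cls _; move: a b => a b.
  have -> : 'i%C *: a - b = 'i%C *: (a - - 'i%C *: b).
    have e : 'i%C * - 'i%C = 1 :> R[i] by rewrite mulrN -expr2 sqr_i opprK.
    by rewrite scalerBr scalerA e scale1r.
  rewrite (nrmZ HD) /ComplexField.Normc.normc/= expr0n/= add0r expr1n sqrtr1 mul1r.
  by [].
have := L2norm_nrm (toL2 f); rewrite (toL2E f2) => ->; apply: (nrm_le HD); first exact: nrm_ge0.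
by rewrite (nrm_sq (l2_is_dot R)); exact: nsq_cls_le.
Qed.

End Solution.


Theorem lemma4p2 (R : realType) (alpha s : R) (u0 : R -> R[i])
    (u : R -> R -> R[i]) (sigma t0 : R)
    (halpha : 0 < alpha) (hs : 2^-1 < s) (hu0 : Hs_plus s u0)
    (hu : szego_solution s alpha u0 u)
    (hsigma : 0 < sigma)
    (hsing : exists t : R, singular_value_K (u t) sigma)
    (hcross : crossing u sigma t0) :
  forall t : R, ell alpha (u t) sigma < 0.
Proof.
case: hu => uHs u_cont _ u_deriv t.
have reg := solution_regular hs uHs u_cont.
have der := solution_tderiv hs uHs u_cont u_deriv.
have bU r := regular_bdd reg r.
have proj r x := eigen_proj_exists reg sigma r x.
have [p pP] := proj t (clsf (u t)); have [q qP] := proj t (hone R).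
have [p0 pP0] := proj t0 (clsf (u t0)); have [q0 qP0] := proj t0 (hone R).
rewrite (ell_eigen_proj (uHs t).1 (bU t) alpha pP qP).
rewrite (ell_conserved reg der pP qP pP0 qP0).
have uH := (uHs t0).1.
case: hcross => [[_ [e [/(eigHE uH (bU t0))[eHardy eE] ue]]] [d [dE dfree]]].
have dH j := (eigHE uH (bU t0) sigma (d j)).1 (dE j).
apply: (crossing_ell (bU t0) hsigma halpha eE _ (dH ord0).2 (dH ord_max).2 _ pP0 qP0).
  by rewrite -(inner_Hardy uH.1 eHardy).
move=> c0 c1 c01.
have := dfree (fun j => if j == ord0 then c0 else c1).
have -> : (fun x => \sum_(j < 2) (if j == ord0 then c0 else c1) * d j x) =
    (fun x => c0 * d ord0 x + c1 * d ord_max x).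
  apply/funext => x; rewrite big_ord_recl big_ord1/=.
  by congr (_ + _ * d _ x); apply/val_inj.
have d2 j : L2 (d j) := (dH j).1.1.
move=> free; have {}free : forall j : 'I_2, (if j == ord0 then c0 else c1) = 0.
  apply: free; apply: clsf_eq0.
    by apply: HardyD; apply: HardyZ; exact: (dH _).1.
  by rewrite clsfD ?clsfZ//; exact: L2Z.
by split; [exact: (free ord0)|exact: (free ord_max)].
Qed.
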